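(* There is an absolute constant $c>0$ and, for every integer $d\ge 2$, a constant $C_d>0$ such that for all integers $p\ge q>d$ with $q\ge \log p$: (i) if $d\ge 3$, then $\mathrm{HD}_d(p,q)\le p-q+C_d\left(\frac pq\right)^d\left(\log \frac pq\right)^{c\,d^3\log d}$; (ii) if $d=2$, then $\mathrm{HD}_2(p,q)\le p-q+C_2\left(\frac pq\right)^2\left(\log\frac pq\right)^2$.
   Context: A family $\mathcal F$ of sets satisfies the $(p,q)$-property (for integers $p\ge q\ge 1$) if $|\mathcal F|\ge p$, no member of $\mathcal F$ is empty, and among any $p$ members of $\mathcal F$ there are $q$ with a common point. A set $T$ is a transversal of $\mathcal F$ if $T$ meets every member of $\mathcal F$. For integers $p\ge q\ge d+1$, $\mathrm{HD}_d(p,q)$ denotes the smallest integer $s$ such that every family of compact convex sets in $\mathbb R^d$ satisfying the $(p,q)$-property has a transversal of size at most $s$. Here $\log$ denotes the binary logarithm, and in the error terms $\log(p/q)$ is to be read as $\max\{1,\log(p/q)\}$. *)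

(* Defs.v *)
From Stdlib Require Vectors.Fin.
From Stdlib Require Import Reals Lra List.
Import ListNotations.
Open Scope R_scope.

Definition point (d : nat) := Fin.t d -> R.
Definition pset (d : nat) := point d -> Prop.

(* Open sets of R^d (product topology = topology of any norm; we use
   sup-norm balls). *)
Definition open_set {d : nat} (U : pset d) : Prop :=
  forall x, U x -> exists eps, 0 < eps /\
    forall y : point d, (forall i, Rabs (y i - x i) < eps) -> U y.

Definition compact_set {d : nat} (K : pset d) : Prop :=
  forall (I : Type) (U : I -> pset d),
    (forall i, open_set (U i)) ->
    (forall x, K x -> exists i, U i x) ->
    exists l : list I, forall x, K x -> exists i, In i l /\ U i x.

Definition convex_set {d : nat} (K : pset d) : Prop :=
  forall x y, K x -> K y -> forall t, 0 <= t <= 1 ->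
    K (fun i => t * x i + (1 - t) * y i).

Definition family (d : nat) := pset d -> Prop.

Definition pq_property {d : nat} (p q : nat) (F : family d) : Prop :=
  (exists l : list (pset d), length l = p /\ NoDup l /\ forall K, In K l -> F K)
  /\ (forall K, F K -> exists x, K x)
  /\ (forall l : list (pset d), length l = p -> NoDup l -> (forall K, In K l -> F K) ->
        exists l' : list (pset d), length l' = q /\ NoDup l' /\ incl l' l /\
          exists x : point d, forall K, In K l' -> K x).

Definition transversal {d : nat} (T : list (point d)) (F : family d) : Prop :=
  forall K, F K -> exists x, In x T /\ K x.

(* HD_d(p,q) <= s  (s real): every family of compact convex sets in R^d with
   the (p,q)-property has a transversal of size at most s.  Since HD_d(p,q) is
   the least such integer, "HD_d(p,q) <= s" is exactly this. *)
Definition HD_le (d p q : nat) (s : R) : Prop :=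
  forall F : family d,
    (forall K, F K -> compact_set K /\ convex_set K) ->
    pq_property p q F ->
    exists T : list (point d), transversal T F /\ INR (length T) <= s.

Definition log2 (x : R) : R := ln x / ln 2.

(* log(p/q) in error terms, read as max{1, log(p/q)} *)
Definition Llog (p q : nat) : R := Rmax 1 (log2 (INR p / INR q)).

(* Main.v *)
(** By an ultralimit of transversals of finite subfamilies, the family may be
    taken finite.  Let [y] be of order [p / q].

    Weights in [[0, 1]] on the family of total at least [4 (d + 1) p^2 / q] admit
    a point lying in sets of weight at least [1 / y] of the total.  Indeed a
    random [p]-tuple of sets has few repetitions, hence contains [k], nearly [q],
    entries with a common point; the point of least norm common to these [k]
    entries is determined by [d] of them and lies in the [k - d] others, which is
    unlikely if all points are light.  The union bound over the positions costs a
    factor [(p / q)^k p^d], and [q >= log p] makes [p^d] harmless.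

    Gradient descent on a smoothed hinge potential (its slopes are weights in
    [[0, 1]]) then produces a multiset of points such that all but [O(p^2 / q)]
    sets contain more than a [1 / (2 y)] fraction of it.  The exceptional sets are
    pierced [q] at a time while at least [p] of them are left, at the cost of
    [O((p / q)^2)] points, and the last ones with [p - q + 1] points.  A weak
    [1 / (2 y)]-net of the multiset pierces all other sets.

    Weak nets in the plane: halving by a vertical line gives
    [f(y) <= 2 f(5 y / 8) + O(y^2)].  In higher dimension the recursion is the one
    of Matousek and Wagner: partition the points into [r^d] equal classes such
    that every hyperplane of a small net of hyperplanes crosses [O(r^(d-1))]
    classes, take weak nets of the classes and centers of their centerpoints.  A
    convex set missed by all of these has few points in each class, so it has many
    points in some classes, [I] say; the hyperplane separating it from the center
    of [I] crosses a constant fraction of [I], which is too many.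

    The partition theorem is proved with a canonical cell around each point,
    spanned by the successive points of least norm of its faces: such a cell is
    determined by [O(d^2)] of the hyperplanes, so that backward analysis replaces
    cuttings, and reweighting turns one good class into a partition. *)
Require Import Defs.
From Stdlib Require Import Reals.
From Stdlib Require Lra List.
From mathcomp Require boolp classical_sets filter reals Rstruct.
From mathcomp Require all_boot all_order all_algebra ring lra zify.
Open Scope R_scope.

Module ConvexGeometry.

Local Close Scope R_scope.
From mathcomp Require Import boolp classical_sets reals all_boot all_order all_algebra ring lra zify.

Set Implicit Arguments.
Unset Strict Implicit.
Unset Printing Implicit Defensive.

Import Order.TTheory GRing.Theory Num.Theory.
Local Open Scope ring_scope.

(** * Minimum-norm points *)

Section Euclidean.
Variables (R : realType) (d : nat).
Implicit Types (x y z u v : 'rV[R]_d) (A B : 'rV[R]_d -> Prop).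

(** The (p, q)-property speaks of distinct members, so sets cannot be weighted by taking copies: a
    weight concentrated on few sets is useless. Hence the cap 1 on the weights, the total of order
    p^2 / q, which makes repetitions rare, and a descent with exceptional sets in place of LP
    duality, whose weights are arbitrary.

    A point of least norm of a finite intersection depends on d of the sets, not on d + 1, because
    an open ball takes one place in Helly's theorem. The same fact controls halfspace traces,
    centers and cells.

    The exponent d^3 log d: with D = d (d + 1) and r about y^(1/D) the centers cost O(y^d). One
    level sends y to about C y / r, so log y shrinks by a factor 1 - 1/(2 D) and O(d^2 log log y)
    levels suffice; each multiplies the ratio of the net size to y^d by at most (2 C)^d, where C is
    polynomial in d. In the plane 2 (5/8)^2 < 1, so the net itself has no logarithm. *)

Definition dot u v : R := \sum_i u 0 i * v 0 i.
(** The squared norm, which keeps most estimates polynomial. *)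
Definition nrm u : R := dot u u.
Definition ev (h : 'rV[R]_d * R) x : R := dot h.1 x + h.2.

Lemma dotC u v : dot u v = dot v u.
Proof. by apply: eq_bigr => i _; rewrite mulrC. Qed.

Lemma dotDr u v w : dot u (v + w) = dot u v + dot u w.
Proof. by rewrite -big_split; apply: eq_bigr => i _; rewrite mxE mulrDr. Qed.

Lemma dotZr a u v : dot u (a *: v) = a * dot u v.
Proof. by rewrite mulr_sumr; apply: eq_bigr => i _; rewrite mxE mulrCA. Qed.

Lemma dotNr u v : dot u (- v) = - dot u v.
Proof. by rewrite -scaleN1r dotZr mulN1r. Qed.

Lemma dot0r u : dot u 0 = 0.
Proof. by rewrite -(scale0r 0) dotZr mul0r. Qed.

Lemma dotDl u v w : dot (v + w) u = dot v u + dot w u.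
Proof. by rewrite ![dot _ u]dotC dotDr. Qed.

Lemma dotZl a u v : dot (a *: v) u = a * dot v u.
Proof. by rewrite ![dot _ u]dotC dotZr. Qed.

Lemma dotNl u v : dot (- v) u = - dot v u.
Proof. by rewrite ![dot _ u]dotC dotNr. Qed.

Definition dotE := (dotDl, dotDr, dotZl, dotZr, dotNl, dotNr).

Lemma dot_sumr (I : Type) (r : seq I) (P : pred I) (F : I -> 'rV[R]_d) u :
  dot u (\sum_(i <- r | P i) F i) = \sum_(i <- r | P i) dot u (F i).
Proof.
elim/big_rec2: _ => [|i a b _ <-]; first exact: dot0r.
by rewrite dotDr.
Qed.

Lemma nrm_ge0 u : 0 <= nrm u.
Proof. by apply: sumr_ge0 => i _; rewrite -expr2 sqr_ge0. Qed.

Lemma nrm_eq0 u : nrm u = 0 -> u = 0.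
Proof.
move=> /eqP; rewrite psumr_eq0 => [/allP h|i _]; last by rewrite -expr2 sqr_ge0.
apply/rowP => i; rewrite mxE; apply/eqP.
by have := h i (mem_index_enum _); rewrite /= mulf_eq0 orbb.
Qed.

Lemma nrm_coord u i : u 0 i ^+ 2 <= nrm u.
Proof.
rewrite /nrm /dot (bigD1 i) //= -expr2 lerDl.
by apply: sumr_ge0 => j _; rewrite -expr2 sqr_ge0.
Qed.

Lemma nrm_le_coord u (e : R) :
  (forall i, u 0 i ^+ 2 <= e) -> nrm u <= e *+ d.
Proof.
move=> h; have -> : e *+ d = \sum_(i < d) e by rewrite sumr_const card_ord.
by apply: ler_sum => i _; rewrite -expr2.
Qed.

Lemma evN h x : ev (- h.1, - h.2) x = - ev h x.
Proof. by rewrite /ev dotNl /=; ring. Qed.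

Lemma evD h t x y : ev h (t *: x + (1 - t) *: y) = t * ev h x + (1 - t) * ev h y.
Proof. by rewrite /ev !dotE; ring. Qed.

Definition convex A := forall x y t, A x -> A y -> 0 <= t -> t <= 1 ->
  A (t *: x + (1 - t) *: y).
Definition closed A := forall x,
  (forall e : R, 0 < e -> exists2 y, A y & nrm (y - x) < e) -> A x.

Lemma cauchy_lim (u : nat -> R) :
  (forall e : R, 0 < e -> exists N, forall m n, (N <= m)%N -> (N <= n)%N ->
     `|u m - u n| < e) ->
  exists l, forall e : R, 0 < e -> exists N, forall n, (N <= n)%N -> `|u n - l| < e.
Proof.
move=> cau; pose S := (fun r : R => exists N, forall n, (N <= n)%N -> r <= u n) : set R.
have [N0 hN0] := cau 1 ltr01.
have hS : has_sup S.
  split; first by exists (u N0 - 1), N0 => n hn; have := hN0 _ _ (leqnn _) hn;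
    rewrite ltr_norml => /andP[_]; lra.
  exists (u N0 + 1) => x [N hN]; have := hN (maxn N N0) (leq_maxl _ _).
  have := hN0 _ _ (leq_maxr N N0) (leqnn _); rewrite ltr_norml => /andP[_]; lra.
exists (sup S) => e e0; have e20 : 0 < e / 2 by lra.
have [N hN] := cau _ e20; exists N => n hn.
have h1 : u n - e / 2 <= sup S.
  apply: ub_le_sup; first by case: hS.
  exists N => m hm; have := hN _ _ hn hm; rewrite ltr_norml => /andP[_]; lra.
have h2 : sup S <= u n + e / 2.
  apply: ge_sup; first by case: hS.
  move=> x [M hM]; have := hM (maxn M N) (leq_maxl _ _).
  have := hN _ _ (leq_maxr M N) hn; rewrite ltr_norml => /andP[_]; lra.
by rewrite ltr_norml; apply/andP; split; lra.
Qed.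

Definition ismn A z := A z /\ forall y, A y -> nrm z <= nrm y.

Lemma nrm_mid x y (m e1 e2 : R) :
  nrm x <= m + e1 -> nrm y <= m + e2 -> m <= nrm (2^-1 *: x + (1 - 2^-1) *: y) ->
  nrm (x - y) <= 2 * (e1 + e2).
Proof.
rewrite /nrm !dotE (dotC y x); lra.
Qed.

(** By the parallelogram identity ([nrm_mid]) a minimizing sequence is Cauchy in each coordinate,
    and its coordinatewise limit lies in [A] because [A] is closed; no boundedness of [A] enters. *)
Lemma exists_mn A : convex A -> closed A -> (exists z, A z) -> exists z, ismn A z.
Proof.
move=> cA clA [z0 Az0].
pose S := (fun r : R => exists2 y, A y & r = - nrm y) : set R.
have hS : has_sup S.
  split; first by exists (- nrm z0), z0.
  by exists 0 => _ [y _ ->]; rewrite oppr_le0 nrm_ge0.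
pose m := - sup S.
have lbm y : A y -> m <= nrm y.
  move=> Ay; rewrite /m lerNl; apply: ub_le_sup; first by case: hS.
  by exists y.
have [w wE] : exists w : nat -> R, forall n, w n = n.+1%:R^-1 by eexists.
have apx n : exists y, A y /\ nrm y <= m + w n.
  have n0 : 0 < w n :> R by rewrite wE invr_gt0.
  have [_ [y Ay ->] lty] := sup_adherent n0 hS.
  exists y; split=> //; rewrite /m; move: lty n0; lra.
have [u uP] := choice apx.
have Au n : A (u n) by case: (uP n).
have um n : nrm (u n) <= m + w n by case: (uP n).
have dist k n : nrm (u k - u n) <= 2 * (w k + w n).
  apply: (@nrm_mid _ _ m); rewrite ?um //; apply/lbm/cA => //; lra.
have small (e : R) : 0 < e -> exists N, forall n, (N <= n)%N -> w n < e.
  move=> e0; exists (Num.bound e^-1) => n hn.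
  rewrite wE invf_plt ?posrE //; apply: lt_le_trans (archi_boundP _) _; first by rewrite invr_ge0 ltW.
  by rewrite ler_nat ltnW.
have cau i : exists l, forall e : R, 0 < e -> exists N, forall n, (N <= n)%N ->
    `|u n 0 i - l| < e.
  apply: cauchy_lim => e e0.
  have [N hN] := small (e ^+ 2 / 4) ltac:(by apply: divr_gt0 => //; apply: exprn_gt0).
  exists N => k n hk hn.
  have := le_trans (nrm_coord (u k - u n) i) (dist k n).
  rewrite !mxE => h; have := hN _ hk; have := hN _ hn => h1 h2.
  have : (u k 0 i - u n 0 i) ^+ 2 < e ^+ 2 by lra.
  by rewrite -real_normK ?num_real // ltr_pXn2r ?nnegrE // ltW.
have [z' z'i] := choice cau; pose z := \row_i z' i.
have zi i (e : R) : 0 < e -> exists N, forall n, (N <= n)%N -> `|u n 0 i - z 0 i| < e.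
  by rewrite mxE; apply: z'i.
have near (e : R) : 0 < e -> exists N, forall n, (N <= n)%N -> nrm (u n - z) <= e *+ d.
  move=> e0; have e1 : 0 < Num.sqrt e by rewrite sqrtr_gt0.
  have h i := cid (zi i _ e1).
  exists (\max_i projT1 (h i)) => n hn; apply: nrm_le_coord => i.
  rewrite [X in X ^+ 2]mxE [in X in _ + X]mxE -real_normK ?num_real // -[leRHS]sqr_sqrtr ?(ltW e0) //.
  rewrite ler_pXn2r ?nnegrE // ?sqrtr_ge0 // ltW //.
  apply: (projT2 (h i) n).
  by apply: leq_trans hn; apply: (leq_bigmax i).
have near' (e : R) : 0 < e -> exists N, forall n, (N <= n)%N -> nrm (u n - z) < e.
  move=> e0; have [|N hN] := near (e / d.+1%:R); first by rewrite divr_gt0.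
  exists N => n /hN h; apply: le_lt_trans h _.
  by rewrite -[_ *+ d]mulr_natr mulrAC ltr_pdivrMr // ltr_pM2l // ltr_nat.
have Az : A z.
  by apply: clA => e /near'[N hN]; exists (u N) => //; apply: hN.
exists z; split=> // y Ay; apply: le_trans (lbm _ Ay).
apply/ler_addgt0Pr => e e0.
have m0 : 0 <= m by rewrite /m oppr_ge0; apply: ge_sup; [case: hS|move=> _ [v _ ->]; rewrite oppr_le0 nrm_ge0].
pose t := e / (2 * (m + 1 + e)).
have t0 : 0 < t by rewrite divr_gt0 //; lra.
have tE : t * (2 * (m + 1 + e)) = e by rewrite /t divfK //; apply: lt0r_neq0; lra.
have t1 : t < 1 by nra.
have [N1 hN1] := small (Num.min 1 (e/4)) ltac:(rewrite lt_min; lra).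
have [N2 hN2] := near' (t * e / 8) ltac:(nra).
pose n := maxn N1 N2.
have := hN1 n (leq_maxl _ _); rewrite lt_min => /andP[k1 k2].
have := hN2 n (leq_maxr _ _) => k3.
have k4 := um n.
(* Expanding [0 <= nrm ((u n - z) + t *: u n)] compares [nrm z] with [nrm (u n)]; [t] is small
   enough that the loss stays below [e]. *)
have key : t * nrm z <= t * (1 + t) * nrm (u n) + (1 + t) * nrm (u n - z).
  have := nrm_ge0 ((u n - z) + t *: u n) => q0.
  have : t * nrm z = t * (1 + t) * nrm (u n) + (1 + t) * nrm (u n - z)
       - nrm ((u n - z) + t *: u n).
    rewrite /nrm !dotE (dotC z (u n)); ring.
  lra.
have p0 := nrm_ge0 (u n).
have : t * nrm z <= t * (m + e).
  apply: le_trans key _.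
  have q1 : (1 + t) * nrm (u n - z) <= t * (e / 4) by have := nrm_ge0 (u n - z); nra.
  have q2 : (1 + t) * nrm (u n) <= m + 3 * e / 4 by nra.
  nra.
by rewrite ler_pM2l.
Qed.

Lemma ismn_uniq A z z' : convex A -> ismn A z -> ismn A z' -> z = z'.
Proof.
move=> cA [Az hz] [Az' hz'].
have zz : nrm z' <= nrm z by apply: hz'.
have : nrm (z - z') <= 2 * (0 + 0).
  apply: (@nrm_mid _ _ (nrm z)); rewrite ?addr0 //.
  by apply: hz; apply: cA => //; lra.
rewrite addr0 mulr0 => h; apply/eqP; rewrite -subr_eq0; apply/eqP/nrm_eq0/eqP.
by rewrite eq_le h nrm_ge0.
Qed.

(* The point of least norm of A, and 0 if there is none. *)
Definition mn A : 'rV[R]_d :=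
  if pselect (exists z, ismn A z) is left e then projT1 (cid e) else 0.

Lemma mnP A : convex A -> closed A -> (exists z, A z) -> ismn A (mn A).
Proof.
move=> cA clA nA; rewrite /mn; case: pselect => [e|[]]; last exact: exists_mn.
by case: cid.
Qed.

Lemma mn_eq A B : (forall x, A x <-> B x) -> mn A = mn B.
Proof. by move=> h; congr mn; apply/funext => x; apply/propext. Qed.

Lemma mn_uniq A z : convex A -> ismn A z -> mn A = z.
Proof.
move=> cA h; rewrite /mn; case: pselect => [e|[]]; last by exists z.
by case: cid => w hw; apply: ismn_uniq hw h.
Qed.

End Euclidean.

(** * Helly's theorem and separation *)

Section Convexity.
Variables (R : realType) (d : nat).
Implicit Types (x y z u v c : 'rV[R]_d) (A B K : 'rV[R]_d -> Prop).

Lemma convex_ev (h : 'rV[R]_d * R) : convex (fun x => ev h x <= 0).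
Proof. by move=> x y t hx hy t0 t1; rewrite evD; nra. Qed.

Lemma closed_ev (h : 'rV[R]_d * R) : closed (fun x => ev h x <= 0).
Proof.
move=> x hx; rewrite leNgt; apply/negP => hpos.
pose N := nrm h.1; have N0 : 0 <= N by apply: nrm_ge0.
have [y hy hn] := hx (ev h x ^+ 2 / (N + 1)) ltac:(by rewrite divr_gt0 ?exprn_gt0 //; lra).
have := nrm_ge0 y; set p := ev h x in hpos hn *; have hp : 0 < p by [].
have e1 : dot h.1 (x - y) >= p by move: hy; rewrite /p /ev !dotE; lra.
have M0 := nrm_ge0 (y - x).
have e2 : nrm (y - x) * (N + 1) < p ^+ 2 by rewrite -ltr_pdivlMr //; lra.
have : 0 <= nrm ((N + 1) *: (x - y) - p *: h.1) by apply: nrm_ge0.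
have -> : nrm ((N + 1) *: (x - y) - p *: h.1) =
  (N + 1) ^+ 2 * nrm (y - x) - 2 * (N + 1) * p * dot h.1 (x - y) + p ^+ 2 * N.
  by rewrite /N /nrm !dotE (dotC x h.1) (dotC y h.1) (dotC x y); ring.
move=> h0 _.
have : (N + 1) * p * dot h.1 (x - y) >= (N + 1) * p * p by rewrite ler_pM2l //; nra.
nra.
Qed.

Lemma mn_cap (I : Type) (C : I -> 'rV[R]_d -> Prop) :
  (forall i, convex (C i)) -> (forall i, closed (C i)) -> (exists z, forall i, C i z) ->
  ismn (fun z => forall i, C i z) (mn (fun z => forall i, C i z)).
Proof.
move=> cC clC nC; apply: mnP => // [x y t hx hy t0 t1 i|x hx i]; first exact: cC.
by apply: clC => e /hx[y hy hn]; exists y.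
Qed.

Lemma convex_comb A (I : Type) (r : seq I) (P : pred I) (w : I -> R) (x : I -> 'rV[R]_d) z0 :
  convex A -> A z0 -> (forall i, P i -> 0 <= w i) -> (forall i, P i -> A (x i)) ->
  exists2 y, A y & \sum_(i <- r | P i) w i *: x i = (\sum_(i <- r | P i) w i) *: y.
Proof.
move=> cA Az w0 Ax; elim: r => [|i r [y Ay IH]].
  by exists z0; rewrite ?big_nil ?scale0r.
rewrite !big_cons; case Pi: (P i); last by exists y.
set W := \sum_(i <- r | P i) w i in IH *; rewrite IH.
have W0 : 0 <= W by apply: sumr_ge0.
have wi := w0 _ Pi.
have [/eqP e|e] := eqVneq (w i + W) 0.
  move: e; rewrite paddr_eq0 // => /andP[/eqP-> /eqP->].
  by exists y; rewrite ?addr0 ?scale0r ?addr0.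
have p : 0 < w i + W by rewrite lt_neqAle eq_sym e addr_ge0.
exists ((w i / (w i + W)) *: x i + (1 - w i / (w i + W)) *: y).
  apply: cA => //; first exact: Ax.
    by rewrite divr_ge0 // ltW.
  by rewrite ler_pdivrMr // mul1r lerDl.
rewrite scalerDr !scalerA mulrCA divff // mulr1; congr (_ + _ *: _).
by rewrite mulrBr mulr1 mulrCA divff // mulr1 addrC addKr.
Qed.

Lemma affine_dependence (I : finType) (x : I -> 'rV[R]_d) : (d.+1 < #|I|)%N ->
  exists l : I -> R, [/\ exists i, l i != 0, \sum_i l i = 0 &
    \sum_i l i *: x i = 0].
Proof.
move=> cI.
pose M : 'M[R]_(#|I|, d + 1) := \matrix_(k, j)
  (row_mx (x (enum_val k)) (const_mx 1)) 0 j.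
have : kermx M != 0.
  rewrite kermx_eq0 /row_free neq_ltn; apply/orP; left.
  by apply: leq_ltn_trans (rank_leq_col M) _; rewrite addn1.
case/rowV0Pn => u /sub_kermxP uM /eqP u0.
have uMj j : \sum_k u 0 k * M k j = 0.
  by have /rowP/(_ j) := uM; rewrite !mxE.
exists (fun i => u 0 (enum_rank i)); split.
- apply: contrapT => h; apply: u0; apply/rowP => k; rewrite mxE.
  apply/eqP/negP => /negP hk; apply: h; exists (enum_val k).
  by rewrite enum_valK.
- have := uMj (rshift d ord0); rewrite (reindex enum_rank) /=; last first.
    by exists enum_val => k _; rewrite ?enum_rankK ?enum_valK.
  by under eq_bigr do rewrite mxE row_mxEr mxE mulr1.
- apply/rowP => j; rewrite summxE [RHS]mxE.
  have := uMj (lshift 1 j); rewrite (reindex enum_rank) /=; last first.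
    by exists enum_val => k _; rewrite ?enum_rankK ?enum_valK.
  move=> h; rewrite -[RHS]h; apply: eq_bigr => i _.
  by rewrite !mxE (unsplitK (inl j)) enum_rankK.
Qed.

(** Radon's argument: choose [x i] in all sets but the [i]-th. In an affine dependence of these
    points the positive and the negative part have the same weighted mean, and it lies in every
    [C j], since [x j] occurs in only one of the two parts. *)
Lemma helly_step (I : finType) (C : I -> 'rV[R]_d -> Prop) : (d.+1 < #|I|)%N ->
  (forall i, convex (C i)) -> (forall i, exists z, forall j, j != i -> C j z) ->
  exists z, forall i, C i z.
Proof.
move=> cI cC hC.
have [x xC] := choice hC.
have [l [[i0 li0] l0 lx0]] := affine_dependence x cI.
have split0 (V : lmodType R) (F : I -> V) : \sum_i F i = 0 ->
    \sum_(i | 0 < l i) F i = - \sum_(i | ~~ (0 < l i)) F i.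
  by rewrite (bigID (fun i => 0 < l i)) /= => /eqP; rewrite addr_eq0 => /eqP.
pose L := \sum_(i | 0 < l i) l i.
have Lpos : 0 < L.
  rewrite lt_neqAle sumr_ge0 ?andbT; last by move=> i /ltW.
  apply/eqP => L0.
  have h1 : forall i, 0 < l i -> l i = 0.
    have /eqP := esym L0; rewrite psumr_eq0; last by move=> i /ltW.
    move=> /allP h i li; have := h i (mem_index_enum _); rewrite li /=.
    by move/eqP.
  have h2 : forall i, ~~ (0 < l i) -> l i = 0.
    have /eqP := split0 R^o l l0; rewrite -/L -L0 eq_sym oppr_eq0 => /eqP e.
    have : \sum_(i | ~~ (0 < l i)) - l i == 0 by rewrite sumrN e oppr0.
    rewrite psumr_eq0; last by move=> i; rewrite -leNgt oppr_ge0.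
    move=> /allP h i li; have := h i (mem_index_enum _); rewrite li /= oppr_eq0.
    by move/eqP.
  by case/negP: li0; apply/eqP; case: (boolP (0 < l i0)) => [/h1|/h2].
pose z := L^-1 *: \sum_(i | 0 < l i) l i *: x i.
have zE : z = L^-1 *: \sum_(i | ~~ (0 < l i)) (- l i) *: x i.
  rewrite /z (split0 _ (fun i => l i *: x i)) // -sumrN; congr (_ *: _).
  by apply: eq_bigr => i _; rewrite scaleNr.
have LE : L = \sum_(i | ~~ (0 < l i)) - l i by rewrite sumrN -(split0 R^o).
exists z => j; case: (boolP (0 < l j)) => lj.
- have xj i : ~~ (0 < l i) -> C j (x i).
    by move=> li; apply: xC; apply: contraNneq li => <-.
  have : exists i, ~~ (0 < l i).
    apply: contrapT => h; have : L = 0.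
      rewrite LE big_pred0 // => i; apply: contra_notF h => hi; by exists i.
    by apply/eqP; rewrite gt_eqF.
  case=> i1 li1.
  have [|y Cy e] := @convex_comb (C j) I (index_enum I) (fun i => ~~ (0 < l i))
     (fun i => - l i) x (x i1) (cC j) (xj _ li1) _ xj.
    by move=> i; rewrite -leNgt oppr_ge0.
  by rewrite zE e -LE scalerA mulVf ?gt_eqF // scale1r.
- have xj i : 0 < l i -> C j (x i).
    by move=> li; apply: xC; apply: contraNneq lj => ->.
  have : exists i, 0 < l i.
    apply: contrapT => h; have : L = 0.
      rewrite /L big_pred0 // => i; apply: contra_notF h => hi; by exists i.
    by apply/eqP; rewrite gt_eqF.
  case=> i1 li1.
  have [|y Cy e] := @convex_comb (C j) I (index_enum I) (fun i => 0 < l i)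
     l x (x i1) (cC j) (xj _ li1) _ xj.
    by move=> i /ltW.
  by rewrite /z e -/L scalerA mulVf ?gt_eqF // scale1r.
Qed.

Lemma card_sub_set (T : finType) (S : {set T}) : #|{: {t | t \in S}}| = #|S|.
Proof. by rewrite card_sig; apply: eq_card. Qed.

Lemma helly (I : finType) (C : I -> 'rV[R]_d -> Prop) :
  (forall i, convex (C i)) ->
  (forall S : {set I}, (#|S| <= d.+1)%N -> exists z, forall i, i \in S -> C i z) ->
  exists z, forall i, C i z.
Proof.
move=> cC hC.
suff main : forall n (S : {set I}), #|S| = n -> exists z, forall i, i \in S -> C i z.
  by have [z hz] := main _ [set: I] erefl; exists z => i; apply: hz.
elim/ltn_ind => n IH S cS; have [le|lt] := leqP n d.+1; first by apply: hC; rewrite cS.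
have cT := card_sub_set S; rewrite cS in cT.
have := @helly_step {i : I | i \in S} (fun i => C (val i)).
rewrite cT => /(_ lt) [| |z hz].
- by move=> i; apply: cC.
- move=> i; have n0 : (0 < n)%N by apply: leq_trans lt.
  have cSi : #|S :\ val i| = n.-1.
    by rewrite -cS (cardsD1 (val i) S) (valP i).
  have [|z hz] := IH n.-1 _ (S :\ val i) cSi; first by rewrite prednK.
  exists z => j ji; apply: hz; rewrite !inE (valP j) andbT.
  by [].
by exists z => i iS; apply: (hz (Sub i iS)).
Qed.

Lemma convex_ball (r : R) : convex (fun y : 'rV[R]_d => nrm y < r).
Proof.
move=> x y t hx hy t0 t1.
have -> : nrm (t *: x + (1 - t) *: y) =
  t * nrm x + (1 - t) * nrm y - t * (1 - t) * nrm (x - y).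
  by rewrite /nrm !dotE (dotC y x); ring.
have := nrm_ge0 (x - y) => h.
have : 0 <= t * (1 - t) * nrm (x - y) by rewrite !mulr_ge0 // subr_ge0.
pose M := Num.max (nrm x) (nrm y).
have Mr : M < r by rewrite gt_max hx hy.
have h1 : t * nrm x <= t * M by rewrite ler_wpM2l // le_max lexx.
have h2 : (1 - t) * nrm y <= (1 - t) * M.
  by rewrite ler_wpM2l ?subr_ge0 // le_max lexx orbT.
lra.
Qed.

(* Helly's theorem for the sets and the open ball of radius |v|, v being the point
   of least norm of the intersection. *)
Lemma mn_basis (I : finType) (C : I -> 'rV[R]_d -> Prop) :
  (forall i, convex (C i)) -> (forall i, closed (C i)) ->
  (exists z, forall i, C i z) ->
  exists S : {set I}, (#|S| <= d)%N /\
    forall B, (forall z, B z -> forall i, i \in S -> C i z) ->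
      (forall z, (forall i, C i z) -> B z) -> convex B ->
      mn B = mn (fun z => forall i, C i z).
Proof.
move=> cC clC nC; have [] := mn_cap cC clC nC.
set v := mn (fun z => forall i, C i z) => vC vmin.
have : exists S : {set I}, (#|S| <= d)%N /\
    forall z, (forall i, i \in S -> C i z) -> nrm v <= nrm z.
  apply: contrapT => h.
  pose C' (i : option I) := if i is Some i then C i else fun y => nrm y < nrm v.
  have [||z hz] := @helly (option I) C'.
  - by move=> [i|]; [apply: cC|apply: convex_ball].
  - move=> S' cS'; case: (boolP (None \in S')) => hN; last first.
      by exists v => -[i|] // hi; [apply: vC|rewrite hi in hN].
    pose S := [set i | Some i \in S'].
    have cS : (#|S| <= d)%N.
      rewrite -ltnS; apply: leq_trans cS'; rewrite (cardsD1 None S') hN add1n ltnS.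
      rewrite -(card_imset (mem S) (@Some_inj _)); apply: subset_leq_card.
      by apply/fintype.subsetP => _ /imsetP[i iS ->]; rewrite !inE in iS *.
    apply: contrapT => h'; apply: h; exists S; split=> // z hz.
    rewrite leNgt; apply/negP => zv; apply: h'; exists z => -[i|] hi //=.
    by apply: hz; rewrite inE.
  by have := vmin z (fun i => hz (Some i)); rewrite leNgt (hz None).
case=> S [cS hS]; exists S; split=> // B BS BC cB.
apply: mn_uniq => //; split; first exact: BC.
by move=> y /BS; apply: hS.
Qed.

(** The hyperplane passes through the point of [K] nearest to [c], orthogonally to the segment
    joining them: if [nrm z <= dot z y] failed, a short move from [z] towards [y] would shorten
    [z]. *)
Lemma separation K c : convex K -> closed K -> ~ K c ->
  exists h : 'rV[R]_d * R, 0 < ev h c /\ forall x, K x -> ev h x <= 0.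
Proof.
move=> cK clK nKc; case: (pselect (exists x, K x)) => [[x0 Kx0]|nK]; last first.
  exists (0, 1); split; first by rewrite /ev dotC dot0r add0r.
  by move=> x Kx; case: nK; exists x.
pose A y := K (y + c).
have cA : convex A.
  move=> x y t hx hy t0 t1; rewrite /A.
  have -> : t *: x + (1 - t) *: y + c = t *: (x + c) + (1 - t) *: (y + c).
    rewrite !scalerDr addrACA -scalerDl; congr (_ + _).
    by rewrite addrC subrK scale1r.
  exact: cK.
have clA : closed A.
  move=> x hx; apply: clK => e /hx[y Ay hn]; exists (y + c) => //.
  by rewrite opprD addrACA subrr addr0.
have [|Az zmin] := mnP cA clA; first by exists (x0 - c); rewrite /A subrK.
set z := mn A in Az zmin.
have z0 : 0 < nrm z.
  rewrite lt_neqAle nrm_ge0 andbT eq_sym; apply/eqP => /nrm_eq0 z0.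
  by apply: nKc; move: Az; rewrite /A z0 add0r.
have key y : A y -> nrm z <= dot z y.
  move=> Ay; rewrite leNgt; apply/negP => lt.
  pose s := nrm z - dot z y; pose N := nrm (y - z).
  have s0 : 0 < s by rewrite /s subr_gt0.
  have N0 : 0 <= N by apply: nrm_ge0.
  pose t := s / (N + s + 1).
  have tE : t * (N + s + 1) = s by rewrite /t divfK // gt_eqF //; lra.
  have t0 : 0 < t by rewrite divr_gt0 //; lra.
  have t1 : t < 1 by nra.
  have := zmin _ (cA _ _ t Ay Az (ltW t0) (ltW t1)).
  have -> : nrm (t *: y + (1 - t) *: z) = nrm z - 2 * t * s + t * (t * N).
    by rewrite /s /N /nrm !dotE (dotC y z); ring.
  have : t * N < s by nra.
  nra.
exists (- z, dot z c + nrm z); split.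
  by rewrite /ev /= dotNl; lra.
move=> x Kx; rewrite /ev /= dotNl.
have := key (x - c); rewrite /A subrK => /(_ Kx); rewrite dotDr dotNr; lra.
Qed.

End Convexity.

(** * Halfspace traces and centers *)

(** Words of length [k] padded with [None] bound the number of such sets by [(#|I| + 1) ^ k]; traces
    and centers are counted in this way. *)
Lemma set_code (I : finType) (k : nat) (S : {set I}) : (#|S| <= k)%N ->
  exists g : {ffun 'I_k -> option I}, forall i, (i \in S) <-> exists j, g j = Some i.
Proof.
move=> cS; exists [ffun j : 'I_k => nth None [seq Some x | x <- enum S] j] => i; split.
- move=> iS; have iE : i \in enum S by rewrite mem_enum.
  have ltk : (index i (enum S) < k)%N.
    by rewrite (leq_trans _ cS) // cardE index_mem.
  exists (Ordinal ltk); rewrite ffunE /= (nth_map i) ?index_mem //.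
  by rewrite nth_index.
- case=> j; rewrite ffunE; have [lt|ge] := ltnP j (size (enum S)).
    by rewrite (nth_map i) // => -[<-]; rewrite -mem_enum mem_nth.
  by rewrite nth_default // size_map.
Qed.

Lemma expn_mono a b k : (a <= b)%N -> (a ^ k <= b ^ k)%N.
Proof. by move=> ab; elim: k => // k IH; rewrite !expnS leq_mul. Qed.

Lemma card_bigcup_le (I T : finType) (P : pred I) (F : I -> {set T}) :
  (#|\bigcup_(i | P i) F i| <= \sum_(i | P i) #|F i|)%N.
Proof.
elim/big_rec2: _ => [|i n A _ IH]; first by rewrite cards0.
by apply: leq_trans (leq_add (leqnn _) IH); rewrite -cardsUI leq_addr.
Qed.

Lemma compl_card_lt d n a b :
  (d * n < d.+1 * a)%N -> (a + b)%N = n -> (d.+1 * b <= n.-1)%N.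
Proof. by move=> h e; subst n; nia. Qed.

Lemma compl_card_gt d n a b :
  (a + b)%N = n -> (d.+1 * b < n)%N -> (d * n < d.+1 * a)%N.
Proof. by move=> <- h; nia. Qed.

Section Traces.
Variables (R : realType) (d : nat).

Lemma pos_min (I : finType) (F : I -> R) :
  exists2 t : R, 0 < t & forall i, 0 < F i -> t <= F i.
Proof.
exists (\big[Num.min/1]_(i | 0 < F i) F i).
  by elim/big_ind: _ => // a b a0 b0; rewrite lt_min a0.
by move=> i Fi; apply: bigmin_le_cond.
Qed.

Variables (T : finType) (y : T -> 'rV[R]_d).

Definition tr (h : 'rV[R]_d * R) : {set T} := [set i | ev h (y i) <= 0].
Definition traces : {set {set T}} := [set A | `[< exists h, A = tr h >]].

Lemma tr_traces h : tr h \in traces.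
Proof. by rewrite inE; apply/asboolP; exists h. Qed.

(** Turns the strict side of a halfspace into a closed condition, so that the separating functionals
    form a closed convex set with a point of least norm. If t is a positive lower bound of the
    positive values, scaling by 2 / t and shifting by -1 opens the gap from -1 to 1. *)
Lemma trace_margin A : A \in traces ->
  exists h, forall i, if i \in A then ev h (y i) <= -1 else 1 <= ev h (y i).
Proof.
rewrite inE => /asboolP[h ->].
have [t t0 ht] := pos_min (fun i => ev h (y i)).
exists ((2 / t) *: h.1, (2 / t) * h.2 - 1) => i.
have -> : ev ((2 / t) *: h.1, (2 / t) * h.2 - 1) (y i) = (2 / t) * ev h (y i) - 1.
  by rewrite /ev /= dotZl; ring.
have q0 : 0 < 2 / t by rewrite divr_gt0.
rewrite inE; case: leP => hi; first by nra.
have := ht i hi; have : (2 / t) * t = 2 by rewrite divfK // gt_eqF.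
by nra.
Qed.

Definition lift1 (x : 'rV[R]_d) : 'rV[R]_(d + 1) := row_mx x (const_mx 1).

Lemma dot_lift1 (a : 'rV[R]_d) (b : R) x :
  dot (row_mx a (const_mx b)) (lift1 x) = ev (a, b) x.
Proof.
rewrite /dot big_split_ord /= /ev; congr (_ + _).
  by apply: eq_bigr => i _; rewrite !row_mxEl.
by rewrite big_ord1 !row_mxEr !mxE mulr1.
Qed.

Definition margin (ib : T * bool) (w : 'rV[R]_(d + 1)) : Prop :=
  if ib.2 then dot (lift1 (y ib.1)) w <= -1 else 1 <= dot (lift1 (y ib.1)) w.

Lemma marginE ib : exists h, margin ib = (fun w => ev h w <= 0).
Proof.
case: ib => i []; [exists (lift1 (y i), 1)|exists (- lift1 (y i), 1)];
  apply/funext => w; apply/propext; rewrite /margin /ev /= ?dotNl; split; lra.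
Qed.

Lemma convex_margin ib : convex (margin ib).
Proof. by have [h ->] := marginE ib; apply: convex_ev. Qed.

Lemma closed_margin ib : closed (margin ib).
Proof. by have [h ->] := marginE ib; apply: closed_ev. Qed.

(* A trace is recovered from the at most d+1 support points of its
   maximum-margin separating hyperplane. *)
Lemma card_traces : (#|traces| <= (2 * #|T| + 1) ^ d.+1)%N.
Proof.
pose B (g : {ffun 'I_d.+1 -> option (T * bool)}) w :=
  forall k ib, g k = Some ib -> margin ib w.
pose dec g := [set i | dot (lift1 (y i)) (mn (B g)) <= -1].
have cB g : convex (B g).
  move=> u v t hu hv t0 t1 k ib e; apply: convex_margin => //; first exact: hu e.
  exact: hv e.
suff sub : traces \subset dec @: [set: {ffun 'I_d.+1 -> option (T * bool)}].
  apply: leq_trans (subset_leq_card sub) _; apply: leq_trans (leq_imset_card _ _) _.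
  rewrite cardsT card_ffun card_ord card_option card_prod card_bool.
  by rewrite mulnC addn1.
apply/fintype.subsetP => A tA; have [h hA] := trace_margin tA.
pose C i := margin (i, i \in A).
have C0 : exists w, forall i, C i w.
  exists (row_mx h.1 (const_mx h.2)) => i; rewrite /C /margin /= dotC dot_lift1.
  by have := hA i; case: h {hA} => a b; case: ifP.
have cC i : convex (C i) by apply: convex_margin.
have clC i : closed (C i) by apply: closed_margin.
have [S [cS hS]] := mn_basis cC clC C0.
have cS' : (#|(fun i => (i, i \in A)) @: S| <= d.+1)%N.
  by apply: leq_trans (leq_imset_card _ _) _; rewrite -addn1.
have [g hg] := set_code cS'.
apply/imsetP; exists g; rewrite ?inE //.
have e : mn (B g) = mn (fun z => forall i, C i z).
  apply: hS => //.
  - move=> z hz i iS; have [k gk] := (hg (i, i \in A)).1 (imset_f _ iS).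
    exact: hz gk.
  - move=> z hz k ib gk; have := (hg ib).2 (ex_intro _ _ gk).
    by case/imsetP => i iS ->; apply: hz.
have [mC _] : ismn (fun z => forall i, C i z) (mn (B g)).
  by rewrite e; apply: mn_cap.
apply/setP => i; rewrite inE; have := mC i; rewrite /C /margin /=.
by case: (i \in A) => // h1; apply/esym/negbTE; rewrite -ltNge; lra.
Qed.

(** The convex hull as an intersection of closed halfspaces, which makes it closed and gives the
    depth estimate of [centers] directly. *)
Definition chull (A : {set T}) (x : 'rV[R]_d) : Prop :=
  forall h, (forall i, i \in A -> ev h (y i) <= 0) -> ev h x <= 0.

Lemma convex_chull A : convex (chull A).
Proof. by move=> u v t hu hv t0 t1 h hA; apply: convex_ev => //; [apply: hu|apply: hv]. Qed.

Lemma closed_chull A : closed (chull A).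
Proof.
move=> x hx h hA; apply: (@closed_ev _ _ h) => e /hx[z Az hn]; exists z => //.
exact: Az.
Qed.

(** One list serves all subsets [I]. A center of [I] is the point of least norm common to the hulls
    of the traces holding more than d / (d + 1) of [I]; it is determined by [d] traces, so words of
    length [d] over all traces produce every center. *)
Lemma centers : exists N : seq 'rV[R]_d,
  (size N <= ((2 * #|T| + 1) ^ d.+1 + 1) ^ d)%N /\
  forall I : {set T}, I != set0 -> exists2 c, c \in N & forall h, 0 < ev h c ->
    (#|I| <= d.+1 * #|[set i in I | (0 < ev h (y i))%R]|)%N.
Proof.
pose TT := {A : {set T} | A \in traces}.
pose B (g : {ffun 'I_d -> option TT}) x := forall k A, g k = Some A -> chull (val A) x.
have cB g : convex (B g).
  move=> u v t hu hv t0 t1 k ib e; apply: convex_chull => //; first exact: hu e.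
  exact: hv e.
exists [seq mn (B g) | g <- enum [set: {ffun 'I_d -> option TT}]]; split.
  rewrite size_map -cardE cardsT card_ffun card_ord card_option card_sig.
  apply: expn_mono; rewrite addn1 ltnS.
  by apply: leq_trans card_traces; apply: subset_leq_card; apply/fintype.subsetP.
move=> I I0.
have I1 : (0 < #|I|)%N by rewrite card_gt0.
pose big (A : TT) := (d * #|I| < d.+1 * #|val A :&: I|)%N.
pose TI := {A : TT | big A}.
pose C (A : TI) := chull (val (val A)).
have cC A : convex (C A) by apply: convex_chull.
have clC A : closed (C A) by apply: closed_chull.
have HN : exists z, forall A, C A z.
  (* Each large trace misses fewer than [#|I| / (d + 1)] points of [I], so [d + 1] of them leave a
     common point [y i]. *)
  apply: helly => [A|S cS]; first exact: convex_chull.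
  suff [i hi] : exists i, forall A, A \in S -> i \in val (val A).
    by exists (y i) => A AS h; apply; apply: hi.
  apply: contrapT => hno.
  have cov : I \subset \bigcup_(A in S) (I :\: val (val A)).
    apply/fintype.subsetP => i iI; apply/bigcupP; apply: contrapT => h; apply: hno.
    exists i => A AS; apply: contrapT => /negP h'; apply: h; exists A => //.
    by rewrite in_setD h' iI.
  have := leq_trans (subset_leq_card cov) (card_bigcup_le _ _).
  have small (A : TI) : (d.+1 * #|I :\: val (val A)| <= #|I|.-1)%N.
    have h := valP A; apply: compl_card_lt h _.
    by rewrite setIC cardsID.
  rewrite -(leq_pmul2l (ltn0Sn d)) big_distrr /= leqNgt => /negP[].
  apply: leq_ltn_trans (leq_sum _ (fun A _ => small A)) _.
  rewrite sum_nat_const; apply: leq_ltn_trans (leq_mul cS (leqnn _)) _.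
  by rewrite ltn_pmul2l // prednK.
have [S [cS hS]] := mn_basis cC clC HN.
have cS' : (#|[set val A | A in S]| <= d)%N by apply: leq_trans (leq_imset_card _ _) _.
have [g hg] := set_code cS'.
have e : mn (B g) = mn (fun z => forall i, C i z).
  apply: hS => //.
  - move=> z hz A AS; have [k gk] := (hg (val A)).1 (imset_f _ AS).
    exact: hz gk.
  - move=> z hz k A gk; have := (hg A).2 (ex_intro _ _ gk).
    by case/imsetP => A' A'S ->; apply: hz.
exists (mn (B g)); first by apply: map_f; rewrite mem_enum inE.
have [mC _] : ismn (fun z => forall i, C i z) (mn (B g)).
  by rewrite e; apply: mn_cap.
move=> h hc; rewrite leqNgt; apply/negP => lt.
(* A halfspace with too few points of [I] has a large complementary trace; the center lies in the
   hull of that trace, hence outside the halfspace. *)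
have b : big (Sub (tr h) (tr_traces h)).
  rewrite /big /=.
  have : [set i in I | 0 < ev h (y i)] = I :\: tr h.
    by apply/setP => i; rewrite !inE ltNge andbC.
  have := cardsID (tr h) I; rewrite setIC => h1 h2; move: lt; rewrite h2.
  exact: (compl_card_gt h1).
have := mC (Sub (Sub (tr h) (tr_traces h)) b) h.
rewrite leNgt hc => h1; suff : false by [].
by apply: h1 => i; rewrite inE.
Qed.

End Traces.

(** * Cells with few vertices *)

(** Ties are broken by a fixed enumeration, so the choice survives the deletion of other candidates
    ([first_sub]). This keeps a cell unchanged when constraints outside its basis are dropped. *)
Definition first (J : finType) (P : pred J) : option J := ohead [seq j <- enum J | P j].

Lemma firstP (J : finType) (P : pred J) h : first P = Some h -> P h.
Proof.
rewrite /first; elim: (enum J) => //= a r IH; case: ifP => // Pa [<-] //.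
Qed.

Lemma first_some (J : finType) (P : pred J) j : P j -> exists h, first P = Some h.
Proof.
move=> Pj; rewrite /first; have : j \in enum J by rewrite mem_enum.
elim: (enum J) => //= a r IH; rewrite inE => /orP[/eqP <-|/IH e]; first by rewrite Pj; exists j.
by case: ifP => // _; exists a.
Qed.

Lemma first_sub (J : finType) (P P' : pred J) h : first P = Some h ->
  (forall j, P' j -> P j) -> P' h -> first P' = Some h.
Proof.
move=> + sub Ph; rewrite /first; elim: (enum J) => //= a r IH.
case: ifP => Pa; first by case=> ->; rewrite Ph.
by case: ifP => // /sub; rewrite Pa.
Qed.

Section Cells.
Variables (R : realType) (d : nat) (J : finType) (f : J -> 'rV[R]_d * R).
Implicit Types (x y z u v p q : 'rV[R]_d) (A B E s : {set J}).

Definition og s (j : J) y := if j \in s then ev (f j) y else - ev (f j) y.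

Lemma ogD s j t x y : og s j (t *: x + (1 - t) *: y) = t * og s j x + (1 - t) * og s j y.
Proof. by rewrite /og evD; case: ifP => _ //; ring. Qed.

Definition pos x : {set J} := [set j : J | 0 <= ev (f j) x].

Lemma og_pos x j : 0 <= og (pos x) j x.
Proof. by rewrite /og inE; case: (leP 0 (ev (f j) x)) => // /ltW; rewrite oppr_ge0. Qed.

Definition face s A E y := forall j, j \in A -> 0 <= og s j y /\ (j \in E -> og s j y = 0).

Definition face1 s E j y := 0 <= og s j y /\ (j \in E -> og s j y = 0).

Lemma convex_face1 s E j : convex (face1 s E j).
Proof.
move=> x y t [x0 xE] [y0 yE] t0 t1; rewrite /face1 ogD; split; first by nra.
by move=> jE; rewrite xE // yE //; ring.
Qed.

Lemma closed_face1 s E j : closed (face1 s E j).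
Proof.
have [h hE] : exists h, forall y, og s j y = ev h y.
  rewrite /og; case: (j \in s); first by exists (f j).
  by exists (- (f j).1, - (f j).2) => y; rewrite evN.
have [h' hE'] : exists h', forall y, og s j y = - ev h' y.
  by exists (- h.1, - h.2) => y; rewrite hE evN opprK.
move=> x hx; split.
  rewrite hE' oppr_ge0; apply: closed_ev => e /hx[y [y0 _] hn]; exists y => //.
  by rewrite -oppr_ge0 -hE'.
move=> jE; apply/eqP; rewrite eq_le; apply/andP; split.
  rewrite hE; apply: closed_ev => e /hx[y [_ yE] hn]; exists y => //.
  by rewrite -hE yE.
rewrite hE' oppr_ge0; apply: closed_ev => e /hx[y [_ yE] hn]; exists y => //.
by rewrite -oppr_ge0 -hE' yE.
Qed.

Lemma convex_face s A E : convex (face s A E).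
Proof.
move=> x y t hx hy t0 t1 j jA; apply: convex_face1 => //; [exact: hx|exact: hy].
Qed.

Lemma closed_face s A E : closed (face s A E).
Proof.
move=> x hx j jA; apply: closed_face1 => e /hx[y hy hn]; exists y => //; exact: hy.
Qed.

Definition vert s A E := mn (face s A E).

Lemma vert_face s A E z : face s A E z -> face s A E (vert s A E).
Proof.
move=> hz; suff [] : ismn (face s A E) (vert s A E) by [].
by apply: mnP; [apply: convex_face|apply: closed_face|exists z].
Qed.

Lemma vert_basis s A E z : face s A E z -> exists S : {set J},
  [/\ S \subset A, (#|S| <= d)%N & forall A', S \subset A' -> A' \subset A ->
     vert s A' E = vert s A E].
Proof.
move=> hz; pose C (j : {j | j \in A}) := face1 s E (val j).
have cC j : convex (C j) by apply: convex_face1.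
have clC j : closed (C j) by apply: closed_face1.
have [S [cS hS]] := mn_basis cC clC (ex_intro _ z (fun j => hz _ (valP j))).
exists (val @: S); split.
- by apply/subsetP => _ /imsetP[j _ ->]; apply: valP.
- exact: leq_trans (leq_imset_card _ _) cS.
- move=> A' SA' A'A; rewrite /vert (hS (face s A' E)).
  + apply: mn_eq => y; split=> [hy j jA|hy j]; last exact: hy (valP j).
    exact: (hy (Sub j jA)).
  + by move=> y hy j jS; apply: hy; apply: (subsetP SA'); apply: imset_f.
  + by move=> y hy j jA'; apply: (hy (Sub j (subsetP A'A _ jA'))).
  + exact: convex_face.
Qed.

(** On the ray from [v] through [z] constraint [j] vanishes at parameter 1 / (1 - rho), where rho is
    [og s j z / og s j v], provided rho < 1. The least rho therefore marks the constraint met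
    first. *)
Definition exits s A v z j : bool :=
  [&& j \in A, 0 < og s j v &
  [forall i in A, (0 < og s i v) ==> (og s j z / og s j v <= og s i z / og s i v)]].

(* One ray from the vertex v of the current face through z, up to the first
   constraint h which is tight; h is then added to the equations of the face. *)
Definition step s A (Ez : {set J} * 'rV[R]_d) : {set J} * 'rV[R]_d :=
  let v := vert s A Ez.1 in
  if first (exits s A v Ez.2) is Some h then
    let a := (1 - og s h Ez.2 / og s h v)^-1 in
    (h |: Ez.1, a *: Ez.2 + (1 - a) *: v)
  else Ez.

(** The successive points [rv], followed by the last [rz], span a simplex around [x] as in a
    bottom-vertex triangulation, least-norm points of the faces replacing lowest vertices. *)
Definition run A x k := iter k (step (pos x) A) (set0, x).
Definition rE A x k := (run A x k).1.
Definition rz A x k := (run A x k).2.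
Definition rv A x k := vert (pos x) A (rE A x k).
Definition rh A x k := first (exits (pos x) A (rv A x k) (rz A x k)).

(** Ensures that every ray is defined: each [rz] is an affine combination of the previous one, with
    nonzero weight, and of a point [rv]. So [ell], nonzero at [x], stays nonzero at every [rz],
    whereas it vanishes at the [rv]. *)
Definition generic A x := exists ell : 'rV[R]_d * R,
  (forall k, (k < d)%N -> ev ell (rv A x k) = 0) /\ ev ell x != 0.

(** Boundedness of the cell in the form needed for rays: every direction strictly decreases some
    constraint of [B], so every ray leaves the cell. *)
Definition bounded_at x B := forall u w : 'rV[R]_d, u <> w ->
  exists2 j, j \in B & og (pos x) j w < og (pos x) j u.

Lemma face_ev s A E j y : face s A E y -> j \in A -> j \in E -> ev (f j) y = 0.
Proof.
move=> hy jA jE; have [_ /(_ jE)] := hy j jA; rewrite /og; case: ifP => // _.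
by move/eqP; rewrite oppr_eq0 => /eqP.
Qed.

Lemma step_ok A B s E z : B \subset A -> face s A E z -> E \subset A ->
  (forall u w : 'rV[R]_d, u <> w -> exists2 j, j \in B & og s j w < og s j u) ->
  z <> vert s A E ->
  let v := vert s A E in
  exists h c, [/\ first (exits s A v z) = Some h, exits s A v z h, 0 <= c < 1,
     (step s A (E, z)).1 = h |: E &
     z = (1 - c) *: (step s A (E, z)).2 + (1 - (1 - c)) *: v /\
     face s A (h |: E) (step s A (E, z)).2 /\
     (step s A (E, z)).2 = (1 - c)^-1 *: z + (1 - (1 - c)^-1) *: v].
Proof.
move=> BA fz EA bd zv v.
have fv : face s A E v by apply: vert_face fz.
have [j0 j0B lt0] := bd v z (nesym zv).
have j0A := subsetP BA _ j0B.
have p0 : (j0 \in A) && (0 < og s j0 v).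
  by rewrite j0A (le_lt_trans _ lt0) //; case: (fz _ j0A).
have [h0 /andP[h0A h0v] h0min] := @arg_minP _ _ _ j0
  (fun j => (j \in A) && (0 < og s j v)) (fun j => og s j z / og s j v) p0.
have ex0 : exits s A v z h0.
  apply/and3P; split=> //; apply/forall_inP => i iA; apply/implyP => iv.
  by apply: h0min; rewrite iA.
have [h hE] := first_some ex0; have exh := firstP hE.
have /and3P[hA hv /forall_inP hmin] := exh.
pose c := og s h z / og s h v.
have c0 : 0 <= c by apply: divr_ge0; [case: (fz _ hA)|exact: ltW].
have c1 : c < 1.
  have := implyP (hmin _ j0A); case/andP: p0 => _ p0 /(_ p0) le.
  by apply: le_lt_trans le _; rewrite ltr_pdivrMr // mul1r.
have c10 : 1 - c != 0 by rewrite gt_eqF // subr_gt0.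
exists h, c; rewrite /step /= -/v hE -/c; split=> //; first by rewrite c0.
have e a : a != 0 -> z = a *: (a^-1 *: z + (1 - a^-1) *: v) + (1 - a) *: v.
  move=> a0; rewrite scalerDr !scalerA mulfV // scale1r mulrBr mulr1 mulfV // -addrA -scalerDl.
  by rewrite addrA subrK subrr scale0r addr0.
split; first exact: e.
split=> // j jA; rewrite ogD.
have [oz zE] := fz _ jA; have [ov vE] := fv _ jA.
have eq : (1 - c)^-1 * og s j z + (1 - (1 - c)^-1) * og s j v =
   (1 - c)^-1 * (og s j z - c * og s j v).
  by field.
rewrite eq; split.
  rewrite mulr_ge0 ?invr_ge0 ?subr_ge0 ?(ltW c1) //.
  move: ov; rewrite le_eqVlt => /orP[/eqP <-|ov]; first by rewrite mulr0.
  by rewrite -ler_pdivlMr //; apply: (implyP (hmin _ jA)).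
rewrite inE in_set1 => /orP[/eqP ->|jE]; last by rewrite zE // vE // mulr0 subr0 mulr0.
by rewrite /c divfK ?gt_eqF // subrr mulr0.
Qed.

Section Run.
Variables (A B : {set J}) (x : 'rV[R]_d).
Hypotheses (BA : B \subset A) (bd : bounded_at x B) (gx : generic A x).
Local Notation s := (pos x).

Lemma run_next k : (k < d)%N -> face s A (rE A x k) (rz A x k) -> rE A x k \subset A ->
  (forall ell, (forall k, (k < d)%N -> ev ell (rv A x k) = 0) -> ev ell x != 0 ->
    ev ell (rz A x k) != 0) ->
  exists h c, [/\ rh A x k = Some h, exits s A (rv A x k) (rz A x k) h, 0 <= c < 1,
     rE A x k.+1 = h |: rE A x k &
     rz A x k = (1 - c) *: rz A x k.+1 + (1 - (1 - c)) *: rv A x k /\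
     face s A (h |: rE A x k) (rz A x k.+1) /\
     rz A x k.+1 = (1 - c)^-1 *: rz A x k + (1 - (1 - c)^-1) *: rv A x k].
Proof.
move=> kd fz EA gz; have zv : rz A x k <> rv A x k.
  by case: gx => ell [e0 ex] e; have := gz _ e0 ex; rewrite e e0 // eqxx.
have -> : rE A x k.+1 = (step s A (rE A x k, rz A x k)).1.
  by rewrite /rE /rz /run iterS; case: (iter _ _ _).
have -> : rz A x k.+1 = (step s A (rE A x k, rz A x k)).2.
  by rewrite /rE /rz /run iterS; case: (iter _ _ _).
exact: step_ok BA fz EA bd zv.
Qed.

Lemma run_inv k : (k <= d)%N ->
  [/\ face s A (rE A x k) (rz A x k), rE A x k \subset A &
    forall ell, (forall k, (k < d)%N -> ev ell (rv A x k) = 0) -> ev ell x != 0 ->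
      ev ell (rz A x k) != 0].
Proof.
elim: k => [|k IH] kd.
  split; [|exact: sub0set|by []].
  by move=> j _; split; [apply: og_pos|rewrite inE].
have [fz EA gz] := IH (ltnW kd).
have [h [c [_ exh c01 -> [_ [f' z']]]]] := run_next kd fz EA gz.
split=> //; first by rewrite subUset EA sub1set andbT; case/and3P: exh.
move=> ell e0 ex; rewrite z' evD e0 // mulr0 addr0 mulf_neq0 ?gz //.
by rewrite invr_neq0 // gt_eqF // subr_gt0; case/andP: c01.
Qed.

Lemma run_step k : (k < d)%N -> exists h c,
  [/\ rh A x k = Some h, exits s A (rv A x k) (rz A x k) h,
     0 <= c < 1, rE A x k.+1 = h |: rE A x k &
     rz A x k = (1 - c) *: rz A x k.+1 + (1 - (1 - c)) *: rv A x k].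
Proof.
move=> kd; have [fz EA gz] := run_inv (ltnW kd).
by have [h [c [e exh c01 eE [z1 _]]]] := run_next kd fz EA gz; exists h, c.
Qed.

Lemma rv_face k : (k <= d)%N -> face s A (rE A x k) (rv A x k).
Proof. by move=> /run_inv[fz _ _]; apply: vert_face fz. Qed.

Definition verts A x := rcons (mkseq (rv A x) d) (rz A x d).

Lemma verts_face u : u \in verts A x -> face s A set0 u.
Proof.
have sub k v : face s A (rE A x k) v -> face s A set0 v.
  by move=> h j jA; have [h0 _] := h j jA; rewrite inE.
rewrite mem_rcons inE => /orP[/eqP ->|/mapP[k]].
  by have [h _ _] := run_inv (leqnn d); apply: sub h.
by rewrite mem_iota add0n => kd ->; apply: (sub k); apply/rv_face/ltnW.
Qed.

Lemma verts_hull (ell : 'rV[R]_d * R) :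
  (forall u, u \in verts A x -> 0 <= ev ell u) -> 0 <= ev ell x.
Proof.
move=> hu; suff main k : (k <= d)%N -> 0 <= ev ell (rz A x (d - k)).
  by have := main d (leqnn _); rewrite subnn.
elim: k => [|k IH] kd.
  by rewrite subn0; apply: hu; rewrite mem_rcons inE eqxx.
have kd' : (d - k.+1 < d)%N by lia.
have [h [c [_ _ /andP[c0 c1] _ ->]]] := run_step kd'.
have e : (d - k.+1).+1 = (d - k)%N by lia.
have h1 := IH (ltnW kd); have : 0 <= ev ell (rv A x (d - k.+1)).
  by apply: hu; rewrite mem_rcons inE; apply/orP; right; apply: map_f; rewrite mem_iota.
by rewrite evD e => h2; rewrite addr_ge0 // mulr_ge0 //; lra.
Qed.

End Run.

Definition splits (j : J) (V : seq 'rV[R]_d) :=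
  has (fun u => ev (f j) u < 0) V && has (fun u => 0 < ev (f j) u) V.

Lemma splits_self A B x j : B \subset A -> bounded_at x B -> generic A x ->
  j \in A -> ~~ splits j (verts A x).
Proof.
move=> BA bd gx jA; apply/negP => /andP[/hasP[u uV hu] /hasP[w wV hw]].
have := verts_face BA bd gx uV jA; have := verts_face BA bd gx wV jA.
rewrite /og; case: ifP => _ [h1 _] [h2 _]; lra.
Qed.

Lemma splits_sep A B x y j : B \subset A -> bounded_at x B -> bounded_at y B ->
  generic A x -> generic A y -> verts A x = verts A y ->
  ev (f j) x < 0 -> 0 < ev (f j) y -> splits j (verts A x).
Proof.
move=> BA bx by_ gx gy e hx hy; apply/andP; split.
  apply: contraLR hx => /hasPn h; rewrite -leNgt.
  by apply: (verts_hull BA bx gx) => u /h; rewrite -leNgt.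
rewrite e; apply: contraLR hy => /hasPn h; rewrite -leNgt -oppr_ge0.
rewrite -evN; apply: (verts_hull BA by_ gy) => u /h.
by rewrite evN -leNgt oppr_ge0.
Qed.

(** The run is reproduced by a basis of [d] constraints for each of the [d] least-norm points,
    together with the [d] constraints met; a minimizer that is kept stays the minimizer. *)
Lemma verts_compress A B x : B \subset A -> bounded_at x B -> generic A x ->
  exists D : {set J}, [/\ D \subset A, (#|D| <= d + d * d)%N &
    forall A', D \subset A' -> A' \subset A -> verts A' x = verts A x].
Proof.
move=> BA bx gx.
have hS (k : 'I_d) : exists S : {set J}, [/\ S \subset A, (#|S| <= d)%N &
    forall A', S \subset A' -> A' \subset A ->
     vert (pos x) A' (rE A x k) = vert (pos x) A (rE A x k)].
  by have [fz _ _] := run_inv BA bx gx (ltnW (ltn_ord k)); apply: vert_basis fz.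
have hh (k : 'I_d) : exists h, rh A x k = Some h /\ h \in A.
  have [h [c [e /and3P[hA _ _] _ _ _]]] := run_step BA bx gx (ltn_ord k).
  by exists h.
have [S SP] := choice hS; have [H HP] := choice hh.
exists (\bigcup_k S k :|: [set H k | k : 'I_d]); split.
- rewrite subUset; apply/andP; split; first by apply/bigcupsP => k _; case: (SP k).
  by apply/subsetP => _ /imsetP[k _ ->]; case: (HP k).
- apply: leq_trans (leq_card_setU _ _) _; rewrite addnC; apply: leq_add.
    by apply: leq_trans (leq_imset_card _ _) _; rewrite card_ord.
  apply: leq_trans (card_bigcup_le _ _) _.
  apply: (@leq_trans (\sum_(k : 'I_d) d)); last by rewrite sum_nat_const card_ord.
  by apply: leq_sum => k _; case: (SP k).
move=> A'; rewrite subUset => /andP[/bigcupsP SA' /subsetP HA'] A'A.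
have HAk (k : 'I_d) : H k \in A' by apply: HA'; apply/imsetP; exists k.
have SA (k : 'I_d) : S k \subset A' by apply: SA'.
have same k : (k <= d)%N -> run A' x k = run A x k.
  elim: k => // k IH kd; rewrite /run !iterS -/(run A x k) -/(run A' x k) IH 1?ltnW //.
  pose k' := Ordinal kd.
  have [_ _ ve] := SP k'; have [he HA] := HP k'.
  have ev' : vert (pos x) A' (rE A x k) = rv A x k by rewrite (ve A').
  have fe : first (exits (pos x) A' (rv A x k) (rz A x k)) = Some (H k').
    have exA := firstP he; have /and3P[hA hv /forall_inP hmin] := exA.
    apply: (first_sub he) => [j /and3P[jA' jv /forall_inP jmin]|].
      apply/and3P; split=> //; first exact: (subsetP A'A).
      apply/forall_inP => i iA; apply/implyP => iv.
      apply: le_trans _ (implyP (hmin _ iA) iv).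
      exact: (implyP (jmin _ (HAk k')) hv).
    apply/and3P; split=> //.
    by apply/forall_inP => i /(subsetP A'A); apply: hmin.
  rewrite /step -/(rE A x k) -/(rz A x k) ev' fe.
  by rewrite -/(rv A x k) -/(rh A x k) he.
congr rcons; last by rewrite /rz same.
rewrite /mkseq; apply/eq_in_map => k; rewrite mem_iota add0n /= => kd.
rewrite /rv /rE same 1?ltnW //.
by have [_ _ ve] := SP (Ordinal kd); apply: ve.
Qed.

End Cells.

(** * Combinatorial codes of cells *)

Section Codes.
Variables (R : realType) (d : nat) (J : finType) (f : J -> 'rV[R]_d * R).
Implicit Types (x y z u v p q : 'rV[R]_d) (A B E s : {set J}).
Local Notation rE := (rE f).
Local Notation rv := (rv f).
Local Notation rz := (rz f).
Local Notation rh := (rh f).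
Local Notation pos := (pos f).
Local Notation verts := (verts f).

Definition flat E p := forall j, j \in E -> ev (f j) p = 0.

Lemma ev_lin (h : 'rV[R]_d * R) (I : finType) (l : I -> R) (x : I -> 'rV[R]_d) :
  \sum_i l i = 0 -> \sum_i l i *: x i = 0 -> \sum_i l i * ev h (x i) = 0.
Proof.
move=> l0 lx0; transitivity (dot h.1 (\sum_i l i *: x i) + h.2 * \sum_i l i).
  rewrite dot_sumr mulr_sumr -big_split; apply: eq_bigr => i _.
  by rewrite dotZr /ev mulrDr /= [h.2 * _]mulrC.
by rewrite l0 lx0 dot0r mulr0 addr0.
Qed.

Section One.
Variables (A B : {set J}) (x : 'rV[R]_d).
Hypotheses (BA : B \subset A) (bd : bounded_at f x B) (gx : generic f A x).

Lemma rE_mono k m : (k + m <= d)%N -> rE A x k \subset rE A x (k + m).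
Proof.
elim: m => [|m IH]; rewrite ?addn0 // addnS => kd.
apply: subset_trans (IH (ltnW kd)) _.
by have [h [c [_ _ _ -> _]]] := run_step BA bd gx kd; apply: subsetUr.
Qed.

Lemma face_flat k p : (k <= d)%N -> face f (pos x) A (rE A x k) p -> flat (rE A x k) p.
Proof.
move=> kd fp j jE; have [_ EA _] := run_inv BA bd gx kd.
exact: face_ev fp (subsetP EA _ jE) jE.
Qed.

Lemma rh_spec k : (k < d)%N -> exists h, [/\ rh A x k = Some h,
  ev (f h) (rv A x k) != 0, h \in A & rE A x k.+1 = h |: rE A x k] /\
  (if h \in pos x then 0 < ev (f h) (rv A x k) else ev (f h) (rv A x k) < 0).
Proof.
move=> kd; have [h [c [e /and3P[hA hv _] _ eE _]]] := run_step BA bd gx kd.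
exists h; move: hv; rewrite /og; case: ifP => _ hv.
  by split=> //; split=> //; rewrite gt_eqF.
have hv' : ev (f h) (rv A x k) < 0 by rewrite -oppr_gt0.
by split=> //; split=> //; rewrite lt_eqF.
Qed.

(** The points [rv A x k] with [p] and [q] are [d + 2] points, hence affinely dependent. The
    functional met at step [k] vanishes at all later ones, at [p] and at [q], but not at [rv A x k];
    used in turn, these functionals kill the coefficients of the [rv] and leave a multiple of p -
    q. *)
Lemma flat_uniq p q : flat (rE A x d) p -> flat (rE A x d) q -> p = q.
Proof.
move=> fp fq; pose pt (i : option (option 'I_d)) :=
  match i with Some (Some k) => rv A x k | Some None => p | None => q end.
have [|l [[i0 li0] l0 lx0]] := affine_dependence pt.
  by rewrite !card_option card_ord.
have lk k : (k <= d)%N -> forall i : 'I_d, (i < k)%N -> l (Some (Some i)) = 0.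
  elim: k => // k IH kd i; rewrite ltnS leq_eqVlt => /orP[/eqP ik|]; last by apply: IH; apply: ltnW.
  have [h [[_ hv hA eE] _]] := rh_spec kd.
  have hE m : (k < m <= d)%N -> h \in rE A x m.
    move=> /andP[km md]; have := @rE_mono k.+1 (m - k.+1).
    rewrite subnKC // => /(_ md)/subsetP; apply.
    by rewrite eE !inE eqxx.
  have := ev_lin (f h) l0 lx0; rewrite (bigD1 (Some (Some i))) //= big1.
    by rewrite addr0 ik => /eqP; rewrite mulf_eq0 (negbTE hv) orbF => /eqP.
  move=> [[j|]|] hj //=.
  - have [jk|] := ltnP j k; first by rewrite IH ?mul0r // ltnW.
    rewrite leq_eqVlt => /orP[/eqP jk|kj].
      by case/eqP: hj; congr (Some (Some _)); apply: val_inj; rewrite /= -jk.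
    have jd := ltnW (ltn_ord j).
    have fj := rv_face BA bd gx jd.
    by rewrite (face_flat jd fj) ?mulr0 // hE // kj.
  - by rewrite fp ?mulr0 // hE // kd leqnn.
  - by rewrite fq ?mulr0 // hE // kd leqnn.
have ls i : l (Some (Some i)) = 0 by apply: (lk d).
move: l0 lx0; rewrite (bigD1 (Some None)) // (bigD1 None) //= big1 ?addr0; last first.
  by move=> [[j|]|].
move=> e; rewrite (bigD1 (Some None)) // (bigD1 None) //= big1 ?addr0; last first.
  by move=> [[j|]|] //= _; rewrite ls scale0r.
have le : l None = - l (Some None) by apply/eqP; rewrite -addr_eq0 addrC e.
rewrite le scaleNr -scalerBr => /eqP; rewrite scaler_eq0 => /orP[/eqP l1|].
  case/negP: li0; apply/eqP; case: i0 => [[i|]|]; rewrite ?ls //.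
  by rewrite le l1 oppr0.
by rewrite subr_eq0 => /eqP.
Qed.
End One.

Section Two.
Variables (A B : {set J}) (x y : 'rV[R]_d).
Hypotheses (BA : B \subset A).
Hypotheses (bx : bounded_at f x B) (gx : generic f A x).
Hypotheses (by_ : bounded_at f y B) (gy : generic f A y).
Hypothesis hxy : forall k, (k < d)%N -> rh A x k = rh A y k.
Hypothesis sxy : forall k h, (k < d)%N -> rh A x k = Some h -> (h \in pos x) = (h \in pos y).

Lemma code_rE k : (k <= d)%N -> rE A x k = rE A y k.
Proof.
elim: k => // k IH kd.
have [h [[hx _ _ ex] _]] := rh_spec BA bx gx kd.
have [h' [[hy _ _ ey] _]] := rh_spec BA by_ gy kd.
by rewrite ex ey IH 1?ltnW //; move: hx; rewrite hxy // hy => -[->].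
Qed.

(* If g separated the two cells, it would vanish on the common final flat and then,
   going up, be a multiple of the facet functional with both signs at once. *)
Lemma code_pos g : g \in A -> g \in pos x -> g \in pos y.
Proof.
move=> gA gx0; apply: contraT => gy0.
have gfx p E : face f (pos x) A E p -> 0 <= ev (f g) p.
  by move=> /(_ g gA)[]; rewrite /og gx0.
have gfy p E : face f (pos y) A E p -> ev (f g) p <= 0.
  by move=> /(_ g gA)[]; rewrite /og (negbTE gy0) oppr_ge0.
have [fzx _ _] := run_inv BA bx gx (leqnn d).
have [fzy _ _] := run_inv BA by_ gy (leqnn d).
have zxL := face_flat BA bx gx (leqnn d) fzx.
have zyL := face_flat BA by_ gy (leqnn d) fzy.
rewrite -code_rE // in zyL.
have zz := flat_uniq BA bx gx zxL zyL.
suff main k : (k <= d)%N -> forall p, flat (rE A x (d - k)) p -> ev (f g) p = 0.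
  have := main d (leqnn _) y; rewrite subnn => e.
  by move: gy0; rewrite inE e ?lexx // => j; rewrite (_ : rE A x 0 = set0) // inE.
elim: k => [|k IH] kd p.
  rewrite subn0 => pL; rewrite (flat_uniq BA bx gx pL zxL).
  by apply/eqP; rewrite eq_le (gfx _ _ fzx) andbT zz (gfy _ _ fzy).
set m := (d - k.+1)%N; have md : (m < d)%N by rewrite /m; lia.
have me : (d - k)%N = m.+1 by rewrite /m; lia.
rewrite {}me in IH; have {}IH := IH (ltnW kd).
have [h [[hx vx hA eE] hpx]] := rh_spec BA bx gx md.
have [h' [[hy vy _ _] hpy]] := rh_spec BA by_ gy md.
have hh : h' = h by move: hx; rewrite hxy // hy => -[].
rewrite {}hh in hy vy hpy; rewrite (sxy md hx) in hpx.
have fx := rv_face BA bx gx (ltnW md); have fy := rv_face BA by_ gy (ltnW md).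
have vxL := face_flat BA bx gx (ltnW md) fx.
have vyL := face_flat BA by_ gy (ltnW md) fy; rewrite -code_rE 1?ltnW // in vyL.
have [fz _ _] := run_inv BA bx gx md.
have zL := face_flat BA bx gx md fz.
set v := rv A x m in vx hpx fx vxL; set w := rv A y m in vy hpy fy vyL.
set z := rz A x m.+1 in fz zL.
clearbody v w z.
have zL' : flat (rE A x m) z by move=> j jE; apply: zL; rewrite eE inE jE orbT.
have zh : ev (f h) z = 0 by apply: zL; rewrite eE !inE eqxx.
have zg : ev (f g) z = 0 by apply: IH.
have evl (e : 'rV[R]_d * R) a q : ev e (q + a *: (z - v)) = ev e q + a * (ev e z - ev e v).
  by rewrite /ev !dotE; ring.
pose lam := ev (f g) v / ev (f h) v.
have prop q : flat (rE A x m) q -> ev (f g) q = lam * ev (f h) q.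
  move=> qL; pose a := ev (f h) q / ev (f h) v.
  have : ev (f g) (q + a *: (z - v)) = 0.
    apply: IH => j; rewrite eE !inE => /orP[/eqP ->|jE].
      by rewrite evl zh sub0r /a mulrN divfK // subrr.
    by rewrite evl qL // vxL // zL' // subrr mulr0 addr0.
  rewrite evl zg sub0r mulrN => /eqP; rewrite subr_eq0 => /eqP ->.
  by rewrite /a /lam; ring.
have gv := gfx _ _ fx; have gw := gfy _ _ fy.
have lam0 : lam = 0.
  rewrite prop // in gv; rewrite prop // in gw.
  apply/eqP; rewrite eq_le; apply/andP; move: hpx hpy; case: ifP => _ hv hw.
    rewrite pmulr_lge0 // in gv; rewrite pmulr_lle0 // in gw.
  by rewrite nmulr_lge0 // in gv; rewrite nmulr_lle0 // in gw.
by move=> pL; rewrite prop // lam0 mul0r.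
Qed.

End Two.

(** Only the [d] constraints met and their sides need to be counted, so [m] constraints have O(m)^d
    cells. Counting the bases of [verts_compress] would give the exponent d + d^2, too many for
    [r ^ d] classes. *)
Lemma code_verts A B x y : B \subset A ->
  bounded_at f x B -> generic f A x -> bounded_at f y B -> generic f A y ->
  (forall k, (k < d)%N -> rh A x k = rh A y k) ->
  (forall k h, (k < d)%N -> rh A x k = Some h -> (h \in pos x) = (h \in pos y)) ->
  verts A x = verts A y.
Proof.
move=> BA bx gx by_ gy hxy sxy.
have hyx k : (k < d)%N -> rh A y k = rh A x k by move=> kd; exact: esym (hxy k kd).
have syx k h : (k < d)%N -> rh A y k = Some h -> (h \in pos y) = (h \in pos x).
  by move=> kd e; exact: esym (sxy k h kd (etrans (hxy k kd) e)).
have pp g : g \in A -> (g \in pos x) = (g \in pos y).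
  move=> gA; apply/idP/idP; first exact: (code_pos BA bx gx by_ gy hxy sxy).
  exact: (code_pos BA by_ gy bx gx hyx syx).
have vE k : (k <= d)%N -> rv A x k = rv A y k.
  move=> kd; rewrite /rv /vert -(code_rE BA bx gx by_ gy hxy kd); apply: mn_eq => z.
  by split=> h j jA; have := h j jA; rewrite /og (pp j jA).
congr rcons.
  rewrite /mkseq; apply/eq_in_map => k; rewrite mem_iota add0n /= => kd.
  by rewrite vE // ltnW.
apply: (flat_uniq BA bx gx).
  by have [fz _ _] := run_inv BA bx gx (leqnn d); apply: (face_flat BA bx gx (leqnn d) fz).
rewrite (code_rE BA bx gx by_ gy hxy (leqnn d)).
by have [fz _ _] := run_inv BA by_ gy (leqnn d); apply: (face_flat BA by_ gy (leqnn d) fz).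
Qed.

End Codes.

(** * Perturbation and backward analysis *)

Section Perturb.
Variables (R : realType) (d : nat).
Implicit Types (x y u : 'rV[R]_d) (h l : 'rV[R]_d * R).

Lemma ev_shift h x u (t : R) : ev h (x + t *: u) = ev h x + t * dot h.1 u.
Proof. by rewrite /ev !dotE; ring. Qed.

Lemma nudge (P : seq ('rV[R]_d * R)) x u : (forall h, h \in P -> 0 < ev h x) ->
  exists2 t0 : R, 0 < t0 & forall t, 0 < t -> t <= t0 -> forall h, h \in P -> 0 < ev h (x + t *: u).
Proof.
elim: P => [|h P IH] hP; first by exists 1.
have [|t0 t00 ht] := IH; first by move=> g gP; apply: hP; rewrite inE gP orbT.
have h0 : 0 < ev h x by apply: hP; rewrite inE eqxx.
pose c := `|dot h.1 u|; have c0 : 0 <= c by apply: normr_ge0.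
pose t1 := ev h x / (2 * (c + 1)).
have t1E : t1 * (2 * (c + 1)) = ev h x by rewrite /t1 divfK // gt_eqF //; lra.
have t10 : 0 < t1 by rewrite divr_gt0 //; lra.
exists (Num.min t0 t1); first by rewrite lt_min t00.
move=> t tp; rewrite le_min => /andP[tt0 tt1] g; rewrite inE => /orP[/eqP ->|]; last exact: ht.
rewrite ev_shift; have : - c <= dot h.1 u by rewrite lerNl ler_normr lexx orbT.
have : t * c <= t1 * c by rewrite ler_wpM2r.
nra.
Qed.

Lemma avoid (P L : seq ('rV[R]_d * R)) x : (forall h, h \in P -> 0 < ev h x) ->
  (forall l, l \in L -> l <> (0, 0)) ->
  exists x', (forall h, h \in P -> 0 < ev h x') /\ (forall l, l \in L -> ev l x' != 0).
Proof.
move=> hP; elim: L => [|l L IH] hL; first by exists x.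
have [|y [yP yL]] := IH; first by move=> g gL; apply: hL; rewrite inE gL orbT.
have [/eqP l0|l0] := boolP (ev l y == 0); last first.
  by exists y; split=> // g; rewrite inE => /orP[/eqP ->|/yL].
have n0 : 0 < nrm l.1.
  rewrite lt_neqAle nrm_ge0 andbT eq_sym; apply/eqP => /nrm_eq0 l1.
  apply: (hL l); first by rewrite inE eqxx.
  by move: l0; rewrite /ev l1 dotC dot0r add0r; case: (l) l1 => a b /= -> ->.
(* Functionals already nonzero at [y] are oriented to be positive there, so that one small move
   keeps them all nonzero. *)
pose sgl (g : 'rV[R]_d * R) := if 0 < ev g y then g else (- g.1, - g.2).
have sglE g z : ev (sgl g) z = if 0 < ev g y then ev g z else - ev g z.
  by rewrite /sgl; case: ifP => // _; apply: evN.
have [|t0 t00 ht] := @nudge (P ++ map sgl L) y l.1.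
  move=> h; rewrite mem_cat => /orP[/yP//|/mapP[g gL ->]].
  rewrite sglE; case: ifP => // /negbT; rewrite -leNgt le_eqVlt (negbTE (yL _ gL)) /=.
  by rewrite oppr_gt0.
have {}ht := ht t0 t00 (lexx _); exists (y + t0 *: l.1); split.
  by move=> h hhP; apply: ht; rewrite mem_cat hhP.
move=> g; rewrite inE => /orP[/eqP ->|gL].
  by rewrite ev_shift l0 add0r mulf_neq0 ?gt_eqF.
have := ht (sgl g); rewrite mem_cat map_f ?orbT // => /(_ isT).
by rewrite sglE; case: ifP => _ h; [rewrite gt_eqF|rewrite lt_eqF // -oppr_gt0].
Qed.

Lemma vanish (v : 'I_d -> 'rV[R]_d) : exists l, l <> (0, 0) /\ forall k, ev l (v k) = 0.
Proof.
pose M : 'M[R]_(d + 1, d) := \matrix_(i, k) lift1 (v k) 0 i.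
have : kermx M != 0.
  rewrite kermx_eq0 /row_free neq_ltn; apply/orP; left.
  by apply: leq_ltn_trans (rank_leq_col M) _; rewrite addn1.
case/rowV0Pn => u /sub_kermxP uM /eqP u0.
have uE : u = row_mx (lsubmx u) (const_mx (rsubmx u 0 0)).
  rewrite -[LHS]hsubmxK; congr row_mx; apply/rowP => i.
  by rewrite [RHS]mxE (ord1 i).
exists (lsubmx u, rsubmx u 0 0); split=> [[e1 e2]|k].
  apply: u0; rewrite uE e1 e2; apply/rowP => i; rewrite !mxE.
  by case: split => j; rewrite !mxE.
rewrite -dot_lift1 -uE; have /rowP/(_ k) := uM; rewrite !mxE => e.
by rewrite -[RHS]e; apply: eq_bigr => i _; rewrite [in RHS]mxE.
Qed.

(** The functional to avoid depends on the run of the perturbed point itself. The circle is broken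
    by treating in advance all [d]-tuples of least-norm points, over all sign patterns, constraint
    sets and equations. Preserving strict signs suffices because [crossed] is strict. *)
Lemma perturb (J : finType) (f : J -> 'rV[R]_d * R) x : exists x',
  (forall j, (0 < ev (f j) x -> 0 < ev (f j) x') /\ (ev (f j) x < 0 -> ev (f j) x' < 0)) /\
  forall A, generic f A x'.
Proof.
pose V (g : {ffun 'I_d -> {set J} * {set J} * {set J}}) k := vert f (g k).1.1 (g k).1.2 (g k).2.
have [ell ellP] := choice (fun g => vanish (V g)).
pose neg j := (- (f j).1, - (f j).2).
have [||x' [xP xL]] := @avoid ([seq f j | j <- enum J & 0 < ev (f j) x] ++
   [seq neg j | j <- enum J & ev (f j) x < 0])
  [seq ell g | g <- enum {: {ffun 'I_d -> {set J} * {set J} * {set J}}}] x.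
- move=> h; rewrite mem_cat => /orP[] /mapP[j]; rewrite mem_filter => /andP[hj _] ->//.
  by rewrite evN oppr_gt0.
- by move=> l /mapP[g _ ->]; case: (ellP g).
exists x'; split=> [j|A].
  split=> hj; first by apply: xP; rewrite mem_cat map_f // mem_filter hj mem_enum.
  by rewrite -oppr_gt0 -evN; apply: xP; rewrite mem_cat orbC map_f // mem_filter hj mem_enum.
pose g := [ffun k : 'I_d => (pos f x', A, rE f A x' k)].
exists (ell g); split=> [k kd|]; last by apply: xL; rewrite map_f // mem_enum.
by have [_ /(_ (Ordinal kd))] := ellP g; rewrite /V ffunE.
Qed.

End Perturb.

(* V A t is the cell of t in the arrangement of A, and spl w V means that w crosses V. *)
Section Backward.
Variables (W T : finType) (X : Type) (V : {set W} -> T -> X) (spl : W -> X -> bool) (D0 : nat).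
Hypothesis self : forall (A : {set W}) t w, w \in A -> ~~ spl w (V A t).
Hypothesis comp : forall (A : {set W}) t, exists D : {set W}, [/\ D \subset A, (#|D| <= D0)%N &
  forall A' : {set W}, D \subset A' -> A' \subset A -> V A' t = V A t].

Definition nspl (A : {set W}) t := #|[set w | spl w (V A t)]|.

(** Deleting [w] from [S] changes the cell of [t] only if [w] is among the [D0] elements that
    determine it, and an unchanged cell is not crossed by a member of [S]. *)
Lemma card_back (S : {set W}) t : (\sum_(w in S) spl w (V (S :\ w) t) <= D0)%N.
Proof.
have [D [DS cD hD]] := comp S t; apply: leq_trans cD.
rewrite -sum1_card (big_setID D) /= (finset.setIidPr DS) [X in (_ + X)%N]big1 ?addn0.
  by apply: leq_sum => w _; case: spl.
move=> w; rewrite inE => /andP[wD wS]; rewrite hD ?subsetDl //.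
  by rewrite (negbTE (self _ wS)).
by rewrite subsetD1 DS.
Qed.

Lemma sum_back m (F : {set W} -> W -> nat) :
  (\sum_(A : {set W} | #|A| == m) \sum_(w | w \notin A) F A w =
   \sum_(S : {set W} | #|S| == m.+1) \sum_(w in S) F (S :\ w) w)%N.
Proof.
rewrite !pair_big_dep /=.
rewrite (reindex_onto (fun p : {set W} * W => (p.1 :\ p.2, p.2)) (fun p => (p.2 |: p.1, p.2))) /=.
  apply: eq_bigl => -[S w] /=; rewrite !inE eqxx /= andbT xpair_eqE eqxx andbT.
  apply/andP/andP => [[/eqP c /eqP e]|[/eqP c wS]].
    have wS : w \in S by rewrite -e !inE eqxx.
    by rewrite (cardsD1 w S) wS c eqxx.
  move: c; rewrite setD1K // eqxx (cardsD1 w S) wS add1n => -[->].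
  by rewrite eqxx.
by move=> [A w] /= /andP[_ wA]; rewrite setU1K.
Qed.

(** Averages over all [m]-subsets. A pair of such a set and an outside element is a set of size
    [m + 1] with a marked element, where [card_back] applies; the two counts compare through
    [mul_bin_left]. *)
Lemma backward m : exists A : {set W}, (#|A| <= m)%N /\
  (m.+1 * \sum_t nspl A t <= D0 * #|T| * #|W|)%N.
Proof.
have [le|lt] := leqP #|W| m.
  exists [set: W]; rewrite cardsT; split=> //; rewrite big1 ?muln0 // => t _.
  by apply/eqP; rewrite cards_eq0; apply/eqP/setP => w; rewrite !inE (negbTE (self _ (in_setT _))).
apply: contrapT => h.
have big (A : {set W}) : #|A| == m -> (D0 * #|T| * #|W| < m.+1 * \sum_t nspl A t)%N.
  move=> /eqP cA; rewrite ltnNge; apply/negP => h'; apply: h; exists A.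
  by rewrite cA.
have nE (A : {set W}) : (\sum_t nspl A t = \sum_(w | w \notin A) \sum_t spl w (V A t))%N.
  rewrite exchange_big /=; apply: eq_bigr => t _; rewrite /nspl -sum1_card.
  rewrite [in LHS](eq_bigl (fun w => spl w (V A t))); last by move=> w; rewrite inE.
  rewrite [RHS](bigID (fun w => spl w (V A t))) /= [X in (_ + X)%N]big1 ?addn0.
    apply: eq_big => [w|w ->//]; rewrite andbC; case: (boolP (spl _ _)) => // s.
    by symmetry; apply: contraL s => /self.
  by move=> w /andP[_ /negbTE ->].
have up : (\sum_(A : {set W} | #|A| == m) \sum_t nspl A t <= 'C(#|W|, m.+1) * (#|T| * D0))%N.
  under eq_bigr do rewrite nE.
  rewrite (sum_back m (fun A w => \sum_t spl w (V A t))%N).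
  rewrite -card_draws -sum1_card big_distrl /= [X in (_ <= X)%N](eq_bigl (fun S : {set W} => #|S| == m.+1));
    last by move=> S; rewrite inE.
  apply: leq_sum => S _; rewrite exchange_big /= mul1n -sum_nat_const.
  by apply: leq_sum => t _; apply: card_back.
have lo : ('C(#|W|, m) * (D0 * #|T| * #|W|).+1 <= m.+1 * \sum_(A : {set W} | #|A| == m) \sum_t nspl A t)%N.
  rewrite -card_draws -sum1_card big_distrl big_distrr /= [X in (X <= _)%N](eq_bigl (fun S : {set W} => #|S| == m));
    last by move=> S; rewrite inE.
  by apply: leq_sum => A /big; rewrite mul1n.
have C0 : (0 < 'C(#|W|, m))%N by rewrite bin_gt0 ltnW.
have := leq_trans lo (leq_mul (leqnn m.+1) up).
rewrite mulnA mul_bin_left => le.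
have : ('C(#|W|, m) * (D0 * #|T| * #|W|).+1 <= 'C(#|W|, m) * (D0 * #|T| * #|W|))%N.
  apply: leq_trans le _; rewrite mulnAC mulnC leq_mul2l; apply/orP; right.
  by rewrite mulnC [(D0 * _)%N]mulnC leq_mul2l leq_subr orbT.
by rewrite leq_pmul2l // ltnn.
Qed.

End Backward.

(** * A large class crossed by few hyperplanes *)

Lemma pigeonhole (T C : finType) (G : {set T}) (code : T -> C) : (0 < #|G|)%N ->
  exists c, (#|G| <= #|C| * #|[set t in G | code t == c]|)%N.
Proof.
rewrite card_gt0 => /set0Pn[t0 _].
have [c _ hc] := @arg_maxP _ _ _ (code t0) xpredT (fun c => #|[set t in G | code t == c]|) isT.
exists c; rewrite -sum1_card (partition_big code xpredT) //=.
rewrite -sum_nat_const; apply: leq_sum => c' _; apply: leq_trans (hc c' isT).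
by rewrite -sum1_card; apply: eq_leq; apply: eq_bigl => t; rewrite inE.
Qed.

Lemma markov_count (T : finType) (g : T -> nat) (b : nat) :
  (\sum_t g t <= b * #|T|)%N -> (#|T| <= 2 * #|[set t | g t <= 2 * b]|)%N.
Proof.
move=> h; have := cardsC [set t | g t <= 2 * b]%N; set G := [set t | _] => e.
have : (#|~: G| * (2 * b).+1 <= b * #|T|)%N.
  apply: leq_trans h; rewrite -sum_nat_const [X in (_ <= X)%N](bigID (mem (~: G))) /=.
  apply: leq_trans (leq_addr _ _); apply: leq_sum => t.
  by rewrite !inE -ltnNge.
by move: e; move: #|G| #|~: G| #|T| => p q n; nia.
Qed.

Section Sparse.
Variables (R : realType) (d : nat).

Definition crossed (T : finType) (x : T -> 'rV[R]_d) (h : 'rV[R]_d * R) (C : {set T}) :=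
  [exists t in C, exists t' in C, (ev h (x t) < 0) && (0 < ev h (x t'))].

Lemma dot_delta i (v : 'rV[R]_d) : dot (delta_mx 0 i) v = v 0 i.
Proof.
rewrite /dot (bigD1 i) //= big1 ?addr0; first by rewrite mxE !eqxx mul1r.
by move=> j ji; rewrite mxE (negbTE ji) andbF mul0r.
Qed.

(* The cells for a random m-subset of W, grouped by their combinatorial code; the
   2d functionals of a large box are added to make the cells bounded. *)
Lemma sparse_class (W T : finType) (f : W -> 'rV[R]_d * R) (x : T -> 'rV[R]_d) m :
  (0 < #|T|)%N -> exists C : {set T},
  (#|T| <= 2 * (2 * (m + 2 * d)) ^ d * #|C|)%N /\
  (m.+1 * #|[set w | crossed x (f w) C]| <= 2 * (d + d * d) * #|W|)%N.
Proof.
move=> T0.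
pose M := \sum_t \sum_i `|x t 0 i| + 1.
have xM t i : `|x t 0 i| < M.
  rewrite /M (bigD1 t) //= (bigD1 i) //=.
  have h1 : 0 <= \sum_(j | j != i) `|x t 0 j| by apply: sumr_ge0.
  have h2 : 0 <= \sum_(t' | t' != t) \sum_j `|x t' 0 j|.
    by apply: sumr_ge0 => t' _; apply: sumr_ge0.
  by rewrite -!addrA ltrDl; lra.
pose box (ib : 'I_d * bool) : 'rV[R]_d * R :=
  (if ib.2 then delta_mx 0 ib.1 else - delta_mx 0 ib.1, M).
have boxE i b z : ev (box (i, b)) z = (if b then z 0 i else - z 0 i) + M.
  by rewrite /ev /box /=; case: b; rewrite ?dotNl dot_delta.
pose J := (W + 'I_d * bool)%type.
pose F (j : J) := match j with inl w => f w | inr ib => box ib end.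
have [x' x'P] := choice (fun t => perturb F (x t)).
pose B : {set J} := [set j | if j is inr _ then true else false].
have bd t : bounded_at F (x' t) B.
  have bpos ib : inr ib \in pos F (x' t).
    rewrite inE; apply: ltW; apply: ((x'P t).1 (inr ib)).1; case: ib => i b.
    rewrite /F boxE; have := xM t i; rewrite ltr_norml => /andP[h1 h2].
    by case: b; lra.
  have ogE i b z : og F (pos F (x' t)) (inr (i, b)) z = (if b then z 0 i else - z 0 i) + M.
    by rewrite /og bpos /F boxE.
  move=> u w uw; have [i ui] : exists i, u 0 i != w 0 i.
    by apply/existsP; apply: contra_notT uw => /existsPn h; apply/rowP => i;
       apply/eqP; have := h i; rewrite negbK.
  have [lt|lt] : u 0 i < w 0 i \/ w 0 i < u 0 i.
      by move: ui; rewrite neq_lt => /orP.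
    by exists (inr (i, false)); rewrite ?inE // !ogE ltrD2r ltrN2.
  by exists (inr (i, true)); rewrite ?inE // !ogE ltrD2r.
pose AA (A : {set W}) : {set J} := [set j | if j is inl w then w \in A else true].
have BA (A : {set W}) : B \subset AA A by apply/subsetP => -[w|ib]; rewrite !inE.
pose V (A : {set W}) t := verts F (AA A) (x' t).
pose spl w V := splits F (inl w) V.
have self (A : {set W}) t w : w \in A -> ~~ spl w (V A t).
  by move=> wA; apply: (splits_self (BA A) (bd t)); [apply: (x'P t).2|rewrite inE].
have comp (A : {set W}) t : exists D : {set W}, [/\ D \subset A, (#|D| <= d + d * d)%N &
    forall A' : {set W}, D \subset A' -> A' \subset A -> V A' t = V A t].
  have [D [DA cD hD]] := verts_compress (BA A) (bd t) ((x'P t).2 (AA A)).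
  exists [set w | inl w \in D]; split.
  - by apply/subsetP => w; rewrite inE => /(subsetP DA); rewrite inE.
  - apply: leq_trans cD; rewrite -(card_imset _ (@inl_inj W ('I_d * bool)%type)).
    by apply: subset_leq_card; apply/subsetP => _ /imsetP[w + ->]; rewrite inE.
  - move=> A' DA' A'A; apply: hD.
      by apply/subsetP => -[w|ib] hj; rewrite inE // (subsetP DA') // inE.
    by apply/subsetP => -[w|ib]; rewrite !inE //; apply: (subsetP A'A).
have [A [cA sA]] := backward self comp m.
(* Points whose cell is crossed at most twice as often as the averaged bound allows: at least half
   of all points. *)
pose G := [set t | m.+1 * nspl V spl A t <= 2 * ((d + d * d) * #|W|)]%N.
have GT : (#|T| <= 2 * #|G|)%N.
  by apply: markov_count; rewrite -big_distrr /= mulnAC.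
have hex t (k : 'I_d) : exists h : J, rh F (AA A) (x' t) k = Some h /\ h \in AA A.
  have [h [[e _ hA _] _]] := rh_spec (BA A) (bd t) ((x'P t).2 (AA A)) (ltn_ord k).
  by exists h.
have [H HP] : exists H : T -> 'I_d -> J, forall t (k : 'I_d),
    rh F (AA A) (x' t) k = Some (H t k) /\ H t k \in AA A.
  by exists (fun t k => projT1 (cid (hex t k))) => t k; case: cid.
pose code t : {ffun 'I_d -> {j : J | j \in AA A} * bool} :=
  [ffun k => (Sub (H t k) (HP t k).2, H t k \in pos F (x' t))].
have G0 : (0 < #|G|)%N by lia.
have [c hc] := pigeonhole code G0.
exists [set t in G | code t == c]; split.
  apply: leq_trans GT _; rewrite -mulnA leq_mul2l /=.
  apply: leq_trans hc _; rewrite leq_mul2r; apply/orP; right.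
  rewrite card_ffun card_ord; apply: expn_mono; rewrite card_prod card_bool mulnC leq_mul2l /=.
  rewrite card_sig; have -> : #|[pred j | j \in AA A]| = #|AA A| by apply: eq_card.
  have -> : AA A = [set inl w | w in A] :|: [set inr ib | ib in [set: 'I_d * bool]].
    apply/setP => -[w|ib]; rewrite !inE.
      rewrite mem_imset ?orbF; last exact: inl_inj.
      by case: (boolP (w \in A)) => //= _; apply/esym/negbTE/negP => /imsetP[].
    by apply/esym/orP; right; apply: imset_f.
  apply: leq_trans (leq_card_setU _ _) _; apply: leq_add.
    by apply: leq_trans (leq_imset_card _ _) cA.
  by apply: leq_trans (leq_imset_card _ _) _; rewrite cardsT card_prod card_ord card_bool mulnC.
set C := [set t in G | _].
have sameV t t' : t \in C -> t' \in C -> V A t = V A t'.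
  rewrite !inE => /andP[_ /eqP ct] /andP[_ /eqP ct'].
  have cE k : H t k = H t' k /\ (H t k \in pos F (x' t)) = (H t' k \in pos F (x' t')).
    have : code t k = code t' k by rewrite ct ct'.
    by rewrite !ffunE => -[e1 e2]; split.
  apply: (code_verts (BA A) (bd t) _ (bd t')); try exact: (x'P _).2.
    move=> k kd; rewrite (HP t (Ordinal kd)).1 (HP t' (Ordinal kd)).1.
    by rewrite (cE (Ordinal kd)).1.
  move=> k h kd; rewrite (HP t (Ordinal kd)).1 => -[<-].
  by rewrite (cE (Ordinal kd)).2 (cE (Ordinal kd)).1.
have [->|/set0Pn[t tC]] := eqVneq C set0.
  rewrite (_ : [set w | _] = set0) ?cards0 ?muln0 //.
  by apply/setP => w; rewrite !inE; apply/negbTE/existsP => -[t]; rewrite inE.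
have : t \in G by move: tC; rewrite inE => /andP[].
rewrite inE -mulnA => le; apply: leq_trans le; rewrite leq_mul2l /=.
apply: subset_leq_card; apply/subsetP => w; rewrite !inE.
case/exists_inP => t1 t1C /exists_inP[t2 t2C /andP[h1 h2]].
rewrite -(sameV t1 t) //; apply: (@splits_sep _ _ _ F _ B (x' t1) (x' t2)) => //.
- exact: (x'P _).2.
- exact: (x'P _).2.
- exact: sameV.
- exact: ((x'P t1).1 (inl w)).2.
- exact: ((x'P t2).1 (inl w)).1.
Qed.

End Sparse.

(** * Partition theorem *)

Section Growth.
Variable R : realType.

Lemma bernoulli_le (y : R) n : 0 <= y -> 1 + n%:R * y <= (1 + y) ^+ n.
Proof.
move=> y0; elim: n => [|n IH]; first by rewrite mul0r addr0 expr0.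
rewrite exprS; apply: le_trans (ler_wpM2l _ IH); last by lra.
have := ler0n R n; rewrite -natr1; nra.
Qed.

Lemma bernoulli_sub (y : R) n : 0 <= y -> y <= 1 -> 1 - n%:R * y <= (1 - y) ^+ n.
Proof.
move=> y0 y1; elim: n => [|n IH]; first by rewrite mul0r subr0 expr0.
rewrite exprS; apply: le_trans (ler_wpM2l _ IH); last by lra.
have := ler0n R n; rewrite -natr1; nra.
Qed.

Lemma expn_succ_le4 u : (0 < u)%N -> (1 + u%:R^-1 : R) ^+ u <= 4.
Proof.
move=> u0; have u0R : 0 < u%:R :> R by rewrite ltr0n.
pose v := uphalf u; pose y : R := u.+1%:R^-1.
have yE : y * u.+1%:R = 1 by rewrite mulVf // pnatr_eq0.
have y0 : 0 < y by rewrite invr_gt0 ltr0n.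
have y1 : y <= 1 by rewrite invf_le1 ?ler1n ?ltr0n.
have inv : (1 + u%:R^-1) * (1 - y) = 1.
  rewrite -natr1 in yE; have uE : u%:R^-1 * u%:R = 1 :> R by rewrite mulVf ?gt_eqF.
  by have : u%:R^-1 * (1 - y * (u%:R + 1)) = 0; [rewrite yE subrr mulr0|move: uE; set w := u%:R^-1; nra].
have hv : v%:R * y <= 2^-1.
  rewrite -(ler_pM2r (_ : 0 < u.+1%:R)) ?ltr0n // -mulrA yE mulr1.
  have : (v.*2 <= u.+1)%N by rewrite /v; lia.
  by rewrite -(ler_nat R) -muln2 natrM; lra.
have h2 : 2^-1 <= (1 - y) ^+ v by apply: le_trans (bernoulli_sub _ (ltW y0) y1); lra.
have h4 : 4^-1 <= (1 - y) ^+ u.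
  apply: (@le_trans _ _ ((1 - y) ^+ (v + v))).
    by rewrite exprD; have : 0 <= (1 - y) ^+ v by [lra]; nra.
  apply: ler_wiXn2l; [lra|lra|by rewrite /v; lia].
have p : 0 <= (1 + u%:R^-1 : R) ^+ u by apply: exprn_ge0; rewrite addr_ge0 // invr_ge0 ltW.
have : (1 + u%:R^-1) ^+ u * (1 - y) ^+ u = 1 by rewrite -exprMn inv expr1n.
nra.
Qed.

Lemma growth_block (K u q : nat) : (0 < u)%N ->
  (1 + K%:R / u%:R : R) ^+ (u * q) <= 4 ^+ (K * q).
Proof.
move=> u0; have u0R : 0 < u%:R^-1 :> R by rewrite invr_gt0 ltr0n.
rewrite !exprM; apply: lerXn2r; rewrite ?nnegrE.
- by apply: exprn_ge0; rewrite addr_ge0 // divr_ge0.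
- by apply: exprn_ge0.
apply: (@le_trans _ _ (((1 + u%:R^-1) ^+ K) ^+ u)).
  apply: lerXn2r; rewrite ?nnegrE ?exprn_ge0 ?addr_ge0 ?divr_ge0 ?invr_ge0 //.
  by apply: bernoulli_le; apply: ltW.
rewrite -exprM mulnC exprM; apply: lerXn2r; rewrite ?nnegrE ?exprn_ge0 ?addr_ge0 ?invr_ge0 //.
exact: expn_succ_le4.
Qed.

Lemma expn_diff d r : (r.+1 ^ d.+1 <= r ^ d.+1 + d.+1 * r.+1 ^ d)%N.
Proof.
elim: d => [|d IH]; first by rewrite !expn1 expn0 muln1 addn1.
have h1 : (r ^ d.+1 <= r.+1 ^ d.+1)%N by apply: expn_mono.
have h2 := leq_mul (leqnn r.+1) IH.
have e : (r.+1 * (d.+1 * r.+1 ^ d) = d.+1 * r.+1 ^ d.+1)%N by rewrite mulnCA -expnS.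
rewrite mulnDr e in h2; rewrite (expnS _ d.+1) (expnS r d.+1).
by move: h1 h2; move: (r ^ d.+1)%N (r.+1 ^ d.+1)%N => X Y; nia.
Qed.

End Growth.

Section Partition.
Variables (R : realType) (d : nat).
Local Notation K := (16 * (d + d * d))%N.

Lemma crossed_sub (T : finType) (x : T -> 'rV[R]_d) h (C C' : {set T}) :
  C' \subset C -> crossed x h C' -> crossed x h C.
Proof.
move=> /subsetP s /exists_inP[t tC /exists_inP[t' t'C hh]].
by apply/exists_inP; exists t; [apply: s|apply/exists_inP; exists t'; [apply: s|]].
Qed.

Lemma crossed_comp (T U : finType) (g : U -> T) (x : T -> 'rV[R]_d) h (C : {set U}) :
  crossed x h (g @: C) = crossed (x \o g) h C.
Proof.
apply/idP/idP => /exists_inP[t tC /exists_inP[t' t'C hh]].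
  case/imsetP: tC t'C hh => u uC -> /imsetP[u' u'C ->] hh.
  by apply/exists_inP; exists u => //; apply/exists_inP; exists u'.
apply/exists_inP; exists (g t); first exact: imset_f.
by apply/exists_inP; exists (g t') => //; apply: imset_f.
Qed.

Lemma subset_of_card (T : finType) (C : {set T}) a : (a <= #|C|)%N ->
  exists2 C' : {set T}, C' \subset C & #|C'| = a.
Proof.
move=> le; exists [set t in take a (enum C)].
  by apply/subsetP => t; rewrite inE => /mem_take; rewrite mem_enum.
rewrite cardsE; have /card_uniqP -> := take_uniq a (enum_uniq C).
by rewrite size_takel // -cardE.
Qed.

Lemma sparse_step (W T : finType) (f : W -> 'rV[R]_d * R) (x : T -> 'rV[R]_d) (S : {set T})
  a i u : (0 < d)%N -> (0 < a)%N -> (0 < i)%N -> (u ^ d <= i)%N -> #|S| = (i * a)%N ->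
  exists C : {set T}, [/\ C \subset S, #|C| = a &
    (u * #|[set w | crossed x (f w) C]| <= K * #|W|)%N].
Proof.
(* For [u < 16 * d] the claim is trivial, as the constant 16 (d + d^2) exceeds [u]. Otherwise m = u
   / 8, rounded down, satisfies 4 (m + 2 d) <= u, so the class given by [sparse_class] has at least
   [a] points. *)
move=> d0 a0 i0 ui cS; have [small|large] := ltnP u (16 * d).
  have [|C CS cC] := @subset_of_card _ S a; first by rewrite cS leq_pmull.
  exists C; split=> //; apply: leq_mul; last exact: max_card.
  by apply: leq_trans (ltnW small) _; rewrite leq_mul2l /= leq_addr.
pose U := {t | t \in S}.
have cU : #|{: U}| = (i * a)%N by rewrite card_sub_set.
have [|C0 [c1 c2]] := @sparse_class R d W U f (x \o val) (u %/ 8).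
  by rewrite cU muln_gt0 i0.
have aC0 : (a <= #|val @: C0|)%N.
  rewrite card_imset; last exact: val_inj.
  rewrite -(leq_pmul2l i0) -cU; apply: leq_trans c1 _; rewrite leq_mul2r; apply/orP; right.
  apply: leq_trans ui.
  have d2 : (2 <= 2 ^ d)%N by rewrite -{1}(expn1 2) leq_exp2l.
  apply: leq_trans (leq_mul d2 (leqnn _)) _; rewrite -expnMn; apply: expn_mono.
  lia.
have [C CC0 cC] := subset_of_card aC0; exists C; split=> //.
  by apply: subset_trans CC0 _; apply/subsetP => _ /imsetP[t _ ->]; apply: valP.
have : (#|[set w | crossed x (f w) C]| <= #|[set w | crossed (x \o val) (f w) C0]|)%N.
  apply: subset_leq_card; apply/subsetP => w; rewrite !inE => h.
  by have := crossed_sub CC0 h; rewrite crossed_comp.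
have : (u <= 8 * (u %/ 8).+1)%N by lia.
move: c2; move: (u %/ 8).+1 #|[set w | crossed x (f w) C]| #|[set w | _]| => v p q h1 h2 h3.
apply: leq_trans (leq_mul h2 h3) _; rewrite -mulnA.
by apply: leq_trans (leq_mul (leqnn 8) h1) _; rewrite !mulnA.
Qed.

Definition ncross (T Q : finType) (x : T -> 'rV[R]_d) (f : Q -> 'rV[R]_d * R)
  (S : {set T}) (cls : T -> nat) k q := (\sum_(i < k) crossed x (f q) [set t in S | cls t == i])%N.

(* The classes are built one by one; the weight 2 ^ e of a functional doubles each
   time it crosses a class. *)
Lemma partition_aux (T Q : finType) (x : T -> 'rV[R]_d) (f : Q -> 'rV[R]_d * R) (g : nat -> nat) a k :
  (0 < d)%N -> (0 < a)%N -> (forall i, (0 < i)%N -> (0 < g i)%N /\ (g i ^ d <= i)%N) ->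
  forall (S : {set T}) (e : Q -> nat), #|S| = (k * a)%N -> exists cls : T -> nat,
  [/\ forall t, t \in S -> (cls t < k)%N,
     forall i, (i < k)%N -> #|[set t in S | cls t == i]| = a &
     \sum_q 2 ^+ (e q + ncross x f S cls k q) <=
     (\sum_q 2 ^+ e q) * \prod_(i < k) (1 + K%:R / (g i.+1)%:R) :> R].
Proof.
move=> d0 a0 hg; elim: k => [|k IH] S e cS.
  exists (fun=> 0%N); split=> // [t tS|].
    by move: cS; rewrite mul0n => /eqP; rewrite cards_eq0 => /eqP S0; rewrite S0 inE in tS.
  rewrite big_ord0 mulr1; apply: ler_sum => q _.
  by rewrite /ncross big_ord0 addn0.
have [gk0 gk] := hg k.+1 (ltn0Sn k).
(* Weights become multiplicities: the functional [q] is repeated [2 ^ e q] times. *)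
pose W := {q : Q & 'I_(2 ^ e q)}.
have cW (P : pred Q) : #|[set w : W | P (tag w)]| = (\sum_(q | P q) 2 ^ e q)%N.
  rewrite -sum1_card (eq_bigl (fun w : W => P (tag w) && true)); last by move=> w; rewrite inE andbT.
  rewrite -(sig_big_dep P (fun _ _ => true) (fun _ _ => 1%N)) /=.
  by apply: eq_bigr => q _; rewrite sum1_card card_ord.
have [C [CS cC hC]] := @sparse_step W T (fun w => f (tag w)) x S a k.+1 (g k.+1)
   d0 a0 (ltn0Sn k) gk cS.
pose e' q := (e q + crossed x (f q) C)%N.
have [|cls [c1 c2 c3]] := IH (S :\: C) e'.
  by rewrite cardsD (finset.setIidPr CS) cS cC mulSn addKn.
pose cls' t := if t \in C then k else cls t.
have clsE i : (i < k)%N -> [set t in S | cls' t == i] = [set t in S :\: C | cls t == i].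
  move=> ik; apply/setP => t; rewrite !inE /cls'; case: (t \in C) => //=.
  by rewrite gtn_eqF // andbF.
have clsk : [set t in S | cls' t == k] = C.
  apply/setP => t; rewrite !inE /cls'; case: (boolP (t \in C)) => tC.
    by rewrite eqxx (subsetP CS).
  case: (boolP (t \in S)) => //= tS; apply/negbTE; rewrite ltn_eqF //.
  by apply: c1; rewrite inE tC.
exists cls'; split.
- move=> t tS; rewrite /cls'; case: ifP => tC //; rewrite ltnS ltnW // c1 //.
  by rewrite inE tC.
- move=> i; rewrite ltnS leq_eqVlt => /orP[/eqP ->|ik]; first by rewrite clsk.
  by rewrite clsE // c2.
have nE q : (e q + ncross x f S cls' k.+1 q = e' q + ncross x f (S :\: C) cls k q)%N.
  rewrite /ncross big_ord_recr /= clsk addnA [in RHS]/e' addnAC; congr (_ + _ + _)%N.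
  by apply: eq_bigr => i _; rewrite clsE.
under eq_bigr do rewrite nE.
apply: le_trans c3 _; rewrite big_ord_recr /= [X in _ <= _ * X]mulrC mulrA.
apply: ler_wpM2r; first by apply: prodr_ge0 => i _; rewrite addr_ge0 // divr_ge0.
have -> : \sum_q 2 ^+ (e' q) = \sum_q 2 ^+ e q + \sum_(q | crossed x (f q) C) 2 ^+ e q :> R.
  rewrite [X in _ + X]big_mkcond -big_split; apply: eq_bigr => q _ /=.
  by rewrite /e'; case: ifP => _; rewrite ?addn0 ?addr0 // addn1 exprS mulr_natl.
have natS (P : pred Q) : \sum_(q | P q) 2 ^+ e q = (#|[set w : W | P (tag w)]|)%:R :> R.
  by rewrite cW natr_sum; apply: eq_bigr => q _; rewrite natrX.
rewrite mulrDr mulr1 lerD2l mulrA ler_pdivlMr ?ltr0n //.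
rewrite natS (natS xpredT) -!natrM ler_nat mulnC.
apply: leq_trans hC _; rewrite mulnC leq_mul2r; apply/orP; right.
by rewrite cardsT.
Qed.

Lemma root_exists n i : (0 < i)%N -> exists u, [/\ (0 < u)%N, (u ^ n.+1 <= i)%N &
  forall v, (v ^ n.+1 <= i)%N -> (v <= u)%N].
Proof.
move=> i0; pose P v := (v ^ n.+1 <= i)%N.
have P1 : exists v, P v by exists 1%N; rewrite /P exp1n.
have bound v : P v -> (v <= i)%N.
  by case: v => // v; apply: leq_trans; rewrite expnS leq_pmulr // expn_gt0.
have := ex_maxnP P1 bound; case=> u Pu umax; exists u; split=> //.
by apply: umax; rewrite /P exp1n.
Qed.

(** An integer form of the estimate that i^(-1/d), summed over i <= r^d, is O(r^(d-1)), with d = n +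
    2. In the block from r^d to (r + 1)^d every root is at least r, and there are at most d (r +
    1)^(d-1) factors. *)
Lemma growth_prod (n K r : nat) (g : nat -> nat) : (0 < r)%N ->
  (forall i, (0 < i)%N -> (0 < g i)%N) ->
  (forall i v, (0 < i)%N -> (v ^ n.+2 <= i)%N -> (v <= g i)%N) ->
  \prod_(i < r ^ n.+2) (1 + K%:R / (g i.+1)%:R) <= 4 ^+ (K * (1 + 2 * n.+2 * r ^ n.+1)) :> R.
Proof.
move=> r0 g0 gmax; elim: r r0 => // r IH _.
have pos i : 0 <= 1 + K%:R / (g i)%:R :> R by rewrite addr_ge0 // divr_ge0.
case: (posnP r) => [->|r0].
  rewrite !exp1n big_ord1; apply: (@le_trans _ _ (1 + K%:R)).
    by rewrite lerD2l ler_pdivrMr ?ltr0n ?g0 // ler_peMr // ler1n g0.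
  apply: (@le_trans _ _ (4 ^+ K)).
    apply: le_trans (_ : (1 + 3) ^+ K <= _); last by rewrite -[1 + 3]/(4%:R).
    by apply: le_trans (bernoulli_le _ _); rewrite // lerD2l ler_peMr // ler1n.
  by apply: ler_weXn2l; [rewrite ler1n|rewrite leq_pmulr].
have le : (r ^ n.+2 <= r.+1 ^ n.+2)%N by apply: expn_mono.
rewrite -(big_mkord xpredT (fun i => 1 + K%:R / (g i.+1)%:R)) (big_cat_nat _ le) //= big_mkord.
have pow (m : nat) : 0 <= 4 ^+ m :> R by apply: exprn_ge0.
apply: (@le_trans _ _ (4 ^+ (K * (1 + 2 * n.+2 * r ^ n.+1)) * 4 ^+ (K * (2 * n.+2 * r.+1 ^ n)))).
  apply: ler_pM; [by apply: prodr_ge0|by apply: prodr_ge0|exact: IH|].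
  apply: le_trans _ (growth_block R K (2 * n.+2 * r.+1 ^ n) r0).
  apply: (@le_trans _ _ ((1 + K%:R / r%:R) ^+ (r.+1 ^ n.+2 - r ^ n.+2))).
    rewrite -prodr_const_nat big_nat [leRHS]big_nat; apply: ler_prod => i /andP[ri _].
    rewrite pos /= lerD2l ler_wpM2l // lef_pV2 ?posrE ?ltr0n ?g0 // ler_nat.
    by apply: gmax => //; apply: leq_trans ri _.
  apply: ler_weXn2l; first by rewrite lerDl divr_ge0.
  rewrite leq_subLR; apply: leq_trans (expn_diff _ _) _; rewrite leq_add2l.
  have : (r.+1 <= r * 2)%N by lia.
  move=> /(leq_mul (leqnn (n.+2 * r.+1 ^ n)%N)); rewrite [(r.+1 ^ n.+1)%N]expnS.
  by move: (r.+1 ^ n)%N => X; nia.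
rewrite -exprD -mulnDr; apply: ler_weXn2l; first by rewrite ler1n.
rewrite leq_mul2l; apply/orP; right; rewrite -addnA leq_add2l -mulnDr leq_mul2l; apply/orP; right.
have : (r ^ n <= r.+1 ^ n)%N by apply: expn_mono.
by rewrite !expnS; move: (r ^ n)%N (r.+1 ^ n)%N => X Y; nia.
Qed.

End Partition.

Section PartitionThm.
Variable R : realType.

(** The total weight starts at most at 2^b and grows by at most the product of [growth_prod]. A
    functional crossing t classes alone weighs 2^t, so logarithms bound t. *)
Lemma partition (n : nat) (T Q : finType) (x : T -> 'rV[R]_n.+2) (f : Q -> 'rV[R]_n.+2 * R) (r a b : nat) :
  (0 < r)%N -> (0 < a)%N -> #|T| = (r ^ n.+2 * a)%N -> (#|Q| <= 2 ^ b)%N ->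
  exists cls : T -> nat,
  [/\ forall t, (cls t < r ^ n.+2)%N,
     forall i, (i < r ^ n.+2)%N -> #|[set t | cls t == i]| = a &
     forall q, (\sum_(i < r ^ n.+2) crossed x (f q) [set t | cls t == i] <=
       b + 2 * (16 * (n.+2 + n.+2 * n.+2)) * (1 + 2 * n.+2 * r ^ n.+1))%N].
Proof.
move=> r0 a0 cT cQ; set K := (16 * _)%N.
have root i : exists u, (0 < i)%N -> [/\ (0 < u)%N, (u ^ n.+2 <= i)%N &
  forall v, (v ^ n.+2 <= i)%N -> (v <= u)%N].
  by case: (posnP i) => [->|/(root_exists n.+1)[u hu]]; [exists 0%N|exists u].
have [g gP] := choice root.
have [||cls [c1 c2 c3]] := @partition_aux R n.+2 T Q x f g a (r ^ n.+2) (ltn0Sn _) a0 _ [set: T] (fun=> 0%N).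
- by move=> i /gP[].
- by rewrite cardsT.
have sE i : [set t in [set: T] | cls t == i] = [set t | cls t == i].
  by apply/setP => t; rewrite !inE.
exists cls; split=> [t|i ir|q]; first by apply: c1.
  by rewrite -sE c2.
have := le_trans c3 (ler_wpM2l _ (growth_prod R K r0 _ _)).
move=> /(_ (sumr_ge0 _ (fun _ _ => exprn_ge0 _ (ler0n _ _)))).
move=> h; have {}h : \sum_q 2 ^+ (0 + ncross x f [set: T] cls (r ^ n.+2) q) <=
  (\sum_(q : Q) 2 ^+ 0) * 4 ^+ (K * (1 + 2 * n.+2 * r ^ n.+1)) :> R.
  by apply: h => [i /gP[]|i v /gP[_ _]] //; apply.
have {}h : 2 ^+ ncross x f [set: T] cls (r ^ n.+2) q <= 2 ^+ (b + 2 * K * (1 + 2 * n.+2 * r ^ n.+1)) :> R.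
  apply: (@le_trans _ _ (\sum_q 2 ^+ (0 + ncross x f [set: T] cls (r ^ n.+2) q))).
    by rewrite (bigD1 q) //= add0n lerDl; apply: sumr_ge0 => i _; apply: exprn_ge0.
  apply: le_trans h _; rewrite exprD; apply: ler_pM.
  - by apply: sumr_ge0 => i _; apply: exprn_ge0.
  - by apply: exprn_ge0.
  - by rewrite expr0 sumr_const -natrX ler_nat.
  - have -> : 4 = 2 ^+ 2 :> R by rewrite -natrX.
    by rewrite -exprM !mulnA lexx.
have := h; rewrite ler_eXn2l ?ltr1n // /ncross.
by under eq_bigr do rewrite sE.
Qed.

End PartitionThm.

Local Close Scope ring_scope.

(** * Packing of halfspace traces *)

Definition sdiff (T : finType) (A B : {set T}) := [set t | (t \in A) != (t \in B)].

Lemma expn_succ_ge m k : (m ^ k.+1 + k.+1 * m ^ k <= m.+1 ^ k.+1)%N.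
Proof.
elim: k => [|k IH]; first by rewrite !expn1 expn0 muln1 addn1.
rewrite [X in (_ <= X)%N]expnS; apply: leq_trans (leq_mul (leqnn m.+1) IH).
by rewrite (expnS m k.+1) [in X in (_ <= X)%N](expnS m k) (expnS m k); move: (m ^ k)%N => X; nia.
Qed.

Lemma expn_double m : (2 * m ^ m.+1 <= m.+1 ^ m.+1)%N.
Proof.
apply: leq_trans (expn_succ_ge m m); rewrite mul2n -addnn leq_add2l expnS.
by rewrite leq_mul2r leqnSn orbT.
Qed.

Lemma card_set_in (T : finType) (U : {set T}) (P : pred T) :
  #|[set p in U | P p]| = (\sum_(p in U) P p)%N.
Proof.
rewrite -sum1_card big_mkcond [RHS]big_mkcond; apply: eq_bigr => p _.
by rewrite inE; case: (p \in U); case: (P p).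
Qed.

Lemma card_sum (T : finType) (U : {set T}) : #|U| = (\sum_p (p \in U))%N.
Proof. by rewrite -sum1_card big_mkcond; apply: eq_bigr => p _; case: (p \in U). Qed.

Lemma distinguish_step (T : finType) (U : {set {set T} * {set T}}) m :
  (forall p, p \in U -> (#|T| < m.+1 * #|sdiff p.1 p.2|)%N) ->
  exists S : {set T}, (#|S| <= 1)%N /\
    (m.+1 * #|[set p in U | [forall t in S, (t \in p.1) == (t \in p.2)]]| <= m * #|U|)%N.
Proof.
move=> hU; have [->|/set0Pn[p0 p0U]] := eqVneq U set0.
  exists set0; rewrite !cards0; split=> //; rewrite (_ : [set p in _ | _] = set0) ?cards0 ?muln0 //.
  by apply/setP => p; rewrite !inE.
suff [t ht] : exists t, (#|U| <= m.+1 * #|[set p in U | t \in sdiff p.1 p.2]|)%N.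
  exists [set t]; rewrite cards1; split=> //.
  have := cardsID [set p | t \in sdiff p.1 p.2] U.
  have -> : U :&: [set p | t \in sdiff p.1 p.2] = [set p in U | t \in sdiff p.1 p.2].
    by apply/setP => p; rewrite !inE.
  have -> : U :\: [set p | t \in sdiff p.1 p.2] =
      [set p in U | [forall t' in [set t], (t' \in p.1) == (t' \in p.2)]].
    apply/setP => p; rewrite !inE negbK andbC; congr (_ && _).
    apply/idP/forall_inP => [h t'|]; first by rewrite inE => /eqP ->.
    by apply; rewrite inE.
  by move: ht; move: #|[set p in U | _]| #|[set p in U | _]| #|U| => a b n; nia.
apply: contrapT => h.
have lt t : (m.+1 * #|[set p in U | t \in sdiff p.1 p.2]| <= #|U|)%N.
  by rewrite leqNgt; apply/negP => h'; apply: h; exists t; apply: ltnW.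
have e : (\sum_t #|[set p in U | t \in sdiff p.1 p.2]| = \sum_(p in U) #|sdiff p.1 p.2|)%N.
  under eq_bigr do rewrite card_set_in.
  by rewrite exchange_big; apply: eq_bigr => p _; rewrite card_sum.
have h1 : (m.+1 * \sum_t #|[set p in U | t \in sdiff p.1 p.2]| <= #|T| * #|U|)%N.
  by rewrite big_distrr /= -sum_nat_const; apply: leq_sum => t _.
have h2 : (#|U| * #|T|.+1 <= m.+1 * \sum_(p in U) #|sdiff p.1 p.2|)%N.
  by rewrite big_distrr /= -sum_nat_const; apply: leq_sum => p /hU.
have U0 : (0 < #|U|)%N by rewrite card_gt0; apply/set0Pn; exists p0.
by move: h1 h2; rewrite e; nia.
Qed.

(* The points of S are chosen greedily: each one distinguishes a fraction 1 / (m + 1)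
   of the pairs not yet distinguished. *)
Lemma distinguish (T : finType) (U : {set {set T} * {set T}}) m N :
  (forall p, p \in U -> (#|T| < m.+1 * #|sdiff p.1 p.2|)%N) ->
  exists S : {set T}, (#|S| <= N)%N /\
    (m.+1 ^ N * #|[set p in U | [forall t in S, (t \in p.1) == (t \in p.2)]]| <= m ^ N * #|U|)%N.
Proof.
move=> hU; elim: N => [|N [S [cS hS]]].
  exists set0; rewrite cards0; split=> //; rewrite leq_mul2l; apply/orP; right.
  by apply: subset_leq_card; apply/subsetP => p; rewrite inE => /andP[].
have [|S' [cS' hS']] := @distinguish_step T
   [set p in U | [forall t in S, (t \in p.1) == (t \in p.2)]] m.
  by move=> p; rewrite inE => /andP[/hU].
exists (S :|: S'); split.
  by apply: leq_trans (leq_card_setU _ _) _; rewrite -addn1 leq_add.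
have -> : [set p in U | [forall t in S :|: S', (t \in p.1) == (t \in p.2)]] =
  [set p in [set p in U | [forall t in S, (t \in p.1) == (t \in p.2)]] |
      [forall t in S', (t \in p.1) == (t \in p.2)]].
  apply/setP => p; rewrite !inE -andbA; congr (_ && _).
  apply/forall_inP/andP => [h|[/forall_inP h1 /forall_inP h2] t].
    by split; apply/forall_inP => t tS; apply: h; rewrite inE tS ?orbT.
  by rewrite inE => /orP[/h1|/h2].
move: hS hS'; move: #|[set p in [set p in U | _] | _]| #|[set p in U | _]| #|U| => a b n h1 h2.
rewrite !expnS -mulnA [(m.+1 ^ N * a)%N]mulnC mulnA.
apply: leq_trans (leq_mul h2 (leqnn _)) _.
by rewrite -!mulnA leq_mul2l [(b * _)%N]mulnC h1 orbT.
Qed.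

(** As (m / (m + 1))^(m + 1) is at most 1/2, a pair can survive 2 b (m + 1) greedy points only if
    there were at least 4^b pairs. *)
Lemma nat_pow_bound m b n : (0 < b)%N -> (0 < n)%N ->
  (m.+1 ^ (m.+1 * (2 * b)) * 1 <= m ^ (m.+1 * (2 * b)) * n)%N -> (2 ^ b * 2 ^ b <= n)%N.
Proof.
move=> b0 n0 h; case: m h => [|m] h.
  by move: h; rewrite exp0n ?muln_gt0 // mul0n muln1 exp1n.
have h1 : (2 ^ (2 * b) * m.+1 ^ (m.+2 * (2 * b)) <= m.+2 ^ (m.+2 * (2 * b)))%N.
  by rewrite (expnM m.+1) (expnM m.+2) -expnMn; apply: expn_mono; apply: expn_double.
rewrite muln1 in h; have := leq_trans h1 h; rewrite mulnC leq_pmul2l ?expn_gt0 //.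
by rewrite mul2n -addnn expnD.
Qed.

Section Packing.
Variables (R : realType) (d : nat).

Lemma traces_restrict (T : finType) (y : T -> 'rV[R]_d) (S : {set T}) (Q : {set {set T}}) :
  Q \subset traces y ->
  (forall A B, A \in Q -> B \in Q -> (forall t, t \in S -> (t \in A) = (t \in B)) -> A = B) ->
  (#|Q| <= (2 * #|S| + 1) ^ d.+1)%N.
Proof.
move=> /subsetP Qt inj; pose U := {t | t \in S}.
have cU : #|{: U}| = #|S| := card_sub_set S.
have := card_traces (fun u : U => y (val u)); rewrite cU; apply: leq_trans.
pose g (A : {set T}) : {set U} := [set u | val u \in A].
have gi : {in Q &, injective g}.
  move=> A B AQ BQ /setP e; apply: inj => // t tS; have := e (Sub t tS).
  by rewrite !inE.
rewrite -(card_in_imset gi); apply: subset_leq_card; apply/subsetP => _ /imsetP[A AQ ->].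
have := Qt _ AQ; rewrite !inE => /asboolP[h e]; apply/asboolP; exists h.
by apply/setP => u; rewrite !inE e inE.
Qed.

(* If a maximal separated set of traces had more than 2 ^ b members, then 2 ^ b of
   them would differ on few points of T, contradicting the trace bound there. *)
Lemma packing (T : finType) (y : T -> 'rV[R]_d) e b : (0 < e)%N ->
  ((2 * (e * (2 * b)) + 1) ^ d.+1 < 2 ^ b)%N ->
  exists Q : {set {set T}}, [/\ Q \subset traces y, (#|Q| <= 2 ^ b)%N &
    forall A, A \in traces y -> exists2 B, B \in Q & (e * #|sdiff A B| <= #|T|)%N].
Proof.
move=> e0 cond.
pose sep (Q : {set {set T}}) := (Q \subset traces y) &&
  [forall A in Q, forall B in Q, (A != B) ==> (#|T| < e * #|sdiff A B|)%N].
have sep0 : sep set0 by rewrite /sep sub0set; apply/forall_inP => A; rewrite inE.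
have [Q /maxsetP[/andP[Qt /forall_inP hQ] Qmax] _] := maxset_exists sep0.
have hQ' A B : A \in Q -> B \in Q -> A != B -> (#|T| < e * #|sdiff A B|)%N.
  by move=> AQ BQ; apply/implyP; move/forall_inP: (hQ _ AQ); apply.
have sdC A B : sdiff A B = sdiff B A by apply/setP => t; rewrite !inE eq_sym.
exists Q; split=> //; last first.
  move=> A At; case: (boolP (A \in Q)) => AQ.
    exists A => //; rewrite (_ : sdiff A A = set0) ?cards0 ?muln0 //.
    by apply/setP => t; rewrite !inE eqxx.
  apply: contrapT => h.
  have far B : B \in Q -> (#|T| < e * #|sdiff A B|)%N.
    by move=> BQ; rewrite ltnNge; apply/negP => h'; apply: h; exists B.
  have := Qmax (A |: Q); rewrite subsetUr => hh.
  have : A |: Q = Q.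
    apply: hh => //; rewrite /sep subUset sub1set At Qt /=.
    apply/forall_inP => B; rewrite !inE => hB; apply/forall_inP => C; rewrite !inE => hC.
    apply/implyP => BC; case/orP: hB hC => [/eqP e1|BQ] /orP[/eqP e2|CQ].
    - by rewrite e1 e2 eqxx in BC.
    - by rewrite e1; apply: far.
    - by rewrite e2 sdC; apply: far.
    - exact: hQ'.
  by move/setP/(_ A); rewrite !inE eqxx (negbTE AQ).
rewrite leqNgt; apply/negP => big.
have [Q' Q'Q cQ'] := subset_of_card (ltnW big).
have b0 : (0 < b)%N by case: (b) cond => //; rewrite !muln0 add0n exp1n.
case: e e0 cond hQ' {sep sep0 hQ Qmax} => // m _ cond hQ'.
(* Without the diagonal there are strictly fewer than 4^b ordered pairs, just below the bound of
   [nat_pow_bound]. *)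
pose U := [set p : {set T} * {set T} | [&& p.1 \in Q', p.2 \in Q' & p.1 != p.2]].
have [|S [cS hS]] := @distinguish T U m (m.+1 * (2 * b)).
  by move=> p; rewrite inE => /and3P[p1 p2 p12]; apply: hQ' => //; apply: (subsetP Q'Q).
have : (#|Q'| <= (2 * #|S| + 1) ^ d.+1)%N.
  apply: traces_restrict (subset_trans Q'Q Qt) _ => A B AQ BQ AB; apply/eqP; apply: contraT => nAB.
  have : (0 < #|[set p in U | [forall t in S, (t \in p.1) == (t \in p.2)]]|)%N.
    rewrite card_gt0; apply/set0Pn; exists (A, B); rewrite !inE AQ BQ nAB /=.
    by apply/forall_inP => t /AB ->.
  move=> p; have U0 : (0 < #|U|)%N.
    by rewrite card_gt0; apply/set0Pn; exists (A, B); rewrite !inE AQ BQ nAB.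
  have := nat_pow_bound b0 U0 (leq_trans (leq_mul (leqnn _) p) hS).
  rewrite leqNgt => /negP[]; rewrite -cQ'.
  have : (#|U| < #|setX Q' Q'|)%N.
    apply: proper_card; apply/properP; split.
      by apply/subsetP => q; rewrite !inE => /and3P[-> ->].
    by exists (A, A); rewrite !inE ?AQ // eqxx andbF.
  by rewrite cardsX.
rewrite cQ' leqNgt => /negP[]; apply: leq_ltn_trans cond; apply: expn_mono.
by rewrite leq_add2r leq_mul2l cS.
Qed.

End Packing.

(** * Weak nets: one level of the recursion *)

Section WeakNets.
Variable R : realType.

(* Weak (1 / y)-nets of size N for point multisets, given as indexed families. *)
Definition wnet (d y N : nat) := forall (T : finType) (x : T -> 'rV[R]_d), (0 < #|T|)%N ->
  exists L : seq 'rV[R]_d, (size L <= N)%N /\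
    forall K : 'rV[R]_d -> Prop, convex K -> closed K ->
      (#|T| <= y * #|[set t | `[< K (x t) >]]|)%N -> exists2 z, z \in L & K z.

Lemma wnet1 d : wnet d 1 1.
Proof.
move=> T x T0; have /card_gt0P[t _] := T0.
exists [:: x t]; split=> // K _ _; rewrite mul1n => le; exists (x t); rewrite ?inE //.
have /setP/(_ t) : [set t | `[< K (x t) >]] = [set: T].
  by apply/eqP; rewrite eqEcard subsetT cardsT.
by rewrite !inE => /asboolP.
Qed.

Lemma wnet_leN d y N N' : (N <= N')%N -> wnet d y N -> wnet d y N'.
Proof.
move=> le h T x T0; have [L [sL hL]] := h T x T0; exists L; split=> //.
exact: leq_trans sL le.
Qed.

Lemma wnet_ley d y y' N : (y <= y')%N -> wnet d y' N -> wnet d y N.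
Proof.
move=> le h T x T0; have [L [sL hL]] := h T x T0; exists L; split=> // K cK clK hK.
by apply: hL => //; apply: leq_trans hK _; rewrite leq_mul2r le orbT.
Qed.

Lemma centerpoint (d : nat) (T : finType) (x : T -> 'rV[R]_d) (S : {set T}) : exists c,
  forall h, (0 < ev h c)%R -> (#|S| <= d.+1 * #|[set t in S | (0 < ev h (x t))%R]|)%N.
Proof.
have [->|S0] := eqVneq S set0; first by exists 0%R => h _; rewrite cards0.
by have [N [_ hN]] := centers x; have [c _ hc] := hN _ S0; exists c.
Qed.

Lemma card_classes (T : finType) (cls : T -> nat) k (P : pred T) :
  (forall t, cls t < k)%N -> (#|[set t | P t]| = \sum_(i < k) #|[set t | P t && (cls t == i)]|)%N.
Proof.
move=> ck; rewrite card_sum; under [RHS]eq_bigr do rewrite card_sum.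
rewrite exchange_big; apply: eq_bigr => t _ /=; rewrite inE.
rewrite (bigD1 (Ordinal (ck t))) //= inE eqxx andbT big1 ?addn0 // => i it.
rewrite inE; apply/eqP; rewrite eqb0; apply: contraNN it => /andP[_ /eqP e].
by apply/eqP/val_inj.
Qed.

Lemma wnet_on (d y N : nat) (T : finType) (x : T -> 'rV[R]_d) (S : {set T}) : wnet d y N -> (0 < #|S|)%N ->
  exists L : seq 'rV[R]_d, (size L <= N)%N /\
    forall K : 'rV[R]_d -> Prop, convex K -> closed K ->
      (#|S| <= y * #|[set t in S | `[< K (x t) >]]|)%N -> exists2 z, z \in L & K z.
Proof.
move=> hw S0; pose U := {t | t \in S}.
have cU : #|{: U}| = #|S| := card_sub_set S.
have [|L [sL hL]] := hw U (x \o val); first by rewrite cU.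
exists L; split=> // K cK clK le; apply: hL => //; rewrite cU; apply: leq_trans le _.
rewrite leq_mul2l; apply/orP; right.
have -> : [set t in S | `[< K (x t) >]] = [set val u | u in [set u : U | `[< K ((x \o val) u) >]]].
  apply/setP => t; rewrite !inE; apply/andP/imsetP => [[tS Kt]|[u + ->]].
    by exists (Sub t tS); rewrite ?inE.
  by rewrite inE; split=> //; apply: valP.
exact: leq_imset_card.
Qed.

Section OneLevel.
Variables (n r y y' N' : nat).
Local Notation d := (n.+2).
Local Notation b := (r ^ n.+1)%N.
Local Notation K0 := (16 * (d + d * d))%N.
Local Notation C3 := (2 + 2 * K0 + 4 * d * K0)%N.
Local Notation e := (2 * y * d.+1 * r)%N.
Hypotheses (r0 : (0 < r)%N) (y0 : (0 < y)%N).
Hypothesis cond : ((2 * (e * (2 * b)) + 1) ^ d.+1 < 2 ^ b)%N.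
Hypothesis yy' : (2 * y * d.+1 * C3 < y' * r)%N.
Hypothesis hw : wnet d y' N'.

(** Testing all hyperplanes would bring the logarithm of their number of traces, hence [#|T|], into
    the crossing bound. A packing of 2^b traces, b = r^(d-1), costs no more than the main term. The
    separating hyperplane is replaced by a nearby trace, whose errors, at most 1 / e of all points,
    spoil at most [b] classes. *)
Lemma one_level : wnet d y (((2 * r ^ d + 1) ^ d.+1 + 1) ^ d + r ^ d * N').
Proof.
(* With [r ^ d] copies of each point all classes can have exactly [#|T|] elements. *)
move=> T x T0; pose T1 := (T * 'I_(r ^ d))%type; pose x1 (t : T1) := x t.1.
pose a := #|T|.
have cT1 : #|{: T1}| = (r ^ d * a)%N by rewrite card_prod card_ord mulnC.
have rd0 : (0 < r ^ d)%N by rewrite expn_gt0 r0.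
have e0 : (0 < e)%N by rewrite !muln_gt0 y0.
have [Q [Qt cQ hQ]] := packing x1 e0 cond.
pose QT := {A : {set T1} | A \in Q}.
have hmar (A : QT) : exists h, forall i, if i \in val A then (ev h (x1 i) <= -1)%R else (1 <= ev h (x1 i))%R.
  by apply: trace_margin; apply: (subsetP Qt); apply: valP.
have [f fP] := choice hmar.
have cQT : (#|{: QT}| <= 2 ^ b)%N.
  by rewrite card_sub_set.
have [cls [c1 c2 c3]] := partition x1 f r0 T0 cT1 cQT.
pose X (i : 'I_(r ^ d)) := [set t | cls t == i].
have cX i : #|X i| = a by apply: c2.
have [c hc'] := choice (fun i => centerpoint x1 (X i)).
have hc i h : (0 < ev h (c i))%R -> (a <= d.+1 * #|[set t in X i | (0 < ev h (x1 t))%R]|)%N.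
  by move=> /hc'; rewrite cX.
have [N0 [sN0 hN0]] := centers c; rewrite card_ord in sN0.
have hL i : exists L : seq 'rV[R]_d, (size L <= N')%N /\
    forall K : 'rV[R]_d -> Prop, convex K -> closed K ->
      (a <= y' * #|[set t in X i | `[< K (x1 t) >]]|)%N -> exists2 z, z \in L & K z.
  by rewrite -(cX i); apply: wnet_on hw _; rewrite cX.
have [L LP] := choice hL.
exists (N0 ++ flatten [seq L i | i <- enum 'I_(r ^ d)]); split.
  rewrite size_cat leq_add // size_flatten /shape -map_comp sumnE big_map.
  apply: (@leq_trans (\sum_(i <- enum 'I_(r ^ d)) N')).
    by apply: leq_sum => i _; case: (LP i).
  by rewrite big_const_seq count_predT -cardE card_ord iter_addn_0 mulnC.
move=> K cK clK hK; apply: contrapT => miss.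
have missL i : (y' * #|[set t in X i | `[< K (x1 t) >]]| < a)%N.
  rewrite ltnNge; apply/negP => h; apply: miss.
  have [_ /(_ K cK clK h)[z zL Kz]] := LP i; exists z => //.
  rewrite mem_cat; apply/orP; right; apply/flattenP; exists (L i) => //.
  by apply: map_f; rewrite mem_enum.
pose k i := #|[set t in X i | `[< K (x1 t) >]]|.
have sumk : (r ^ d * a <= y * \sum_i k i)%N.
  have -> : (\sum_i k i = r ^ d * #|[set t | `[< K (x t) >]]|)%N.
    transitivity #|[set t : T1 | `[< K (x1 t) >]]|.
      rewrite (card_classes _ c1); apply: eq_bigr => i _; apply: eq_card => t.
      by rewrite !inE andbC.
    have -> : [set t : T1 | `[< K (x1 t) >]] = setX [set t | `[< K (x t) >]] [set: 'I_(r ^ d)].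
      by apply/setP => t; rewrite !inE andbT.
    by rewrite cardsX cardsT card_ord mulnC.
  by rewrite mulnCA leq_mul2l hK orbT.
(* Classes outside [I] hold at most r^d a / (2 y) points of [K] in all, half of what is
   guaranteed. *)
pose I := [set i | a <= 2 * y * k i]%N.
have sumI : (r ^ d * a <= 2 * y * \sum_(i in I) k i)%N.
  have : (\sum_(i | i \notin I) 2 * y * k i <= r ^ d * a)%N.
    apply: (@leq_trans (\sum_(i < r ^ d) a)); last by rewrite sum_nat_const card_ord.
    rewrite [leqRHS](bigID (mem I)) /=; apply: leq_trans (leq_addl _ _).
    by apply: leq_sum => i; rewrite inE -ltnNge => /ltnW.
  rewrite -big_distrr /=; move: sumk; rewrite (bigID (mem I)) /=.
  move: (\sum_(i in I) k i)%N (\sum_(i | i \notin I) k i)%N (r ^ d * a)%N => p q m.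
  by nia.
have cI : (y' * r ^ d <= 2 * y * #|I|)%N.
  rewrite -(leq_pmul2r T0) -/a -mulnA; apply: leq_trans (leq_mul (leqnn y') sumI) _.
  rewrite mulnCA -[leqRHS]mulnA leq_mul2l; apply/orP; right.
  rewrite big_distrr /= -sum_nat_const; apply: leq_sum => i _.
  exact: ltnW (missL i).
have I0 : I != set0.
  rewrite -card_gt0; move: cI; case: #|I| => //; rewrite muln0 leqn0 muln_eq0 (gtn_eqF rd0) orbF.
  by move=> /eqP y'0; move: yy'; rewrite y'0 mul0n.
have [z zN0 hz] := hN0 I I0.
have nKz : ~ K z by move=> Kz; apply: miss; exists z => //; rewrite mem_cat zN0.
have [h [hz0 hK0]] := separation cK clK nKz.
have cJ := hz h hz0; pose J := [set i in I | (0 < ev h (c i))%R].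
rewrite -/J in cJ.
have [B BQ hB] := hQ _ (tr_traces x1 h).
pose B' : QT := Sub B BQ.
pose cr i := crossed x1 (f B') (X i).
(* An uncrossed class lies on one side of the test trace [B]. If it lies in [B], its points beyond
   [h], a share of 1 / (d + 1) by the choice of [c i], are errors; if it avoids [B], its points of
   [K] are. *)
have key i : i \in J -> ~~ cr i -> (a <= 2 * y * d.+1 * #|[set t in X i | t \in sdiff (tr x1 h) B]|)%N.
  rewrite !inE => /andP[iI hci] ncr.
  have side : (X i \subset B) || [disjoint X i & B].
    apply: contraNT ncr; rewrite negb_or => /andP[/subsetPn[t tX tB] /pred0Pn[t' /= /andP[t'X t'B]]].
    apply/exists_inP; exists t' => //; apply/exists_inP; exists t => //.
    have := fP B' t; have := fP B' t'; rewrite /= (negbTE tB) t'B => h1 h2.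
    by apply/andP; split; lra.
  case/orP: side => side.
    apply: leq_trans (hc _ _ hci) _.
    apply: (@leq_trans (d.+1 * #|[set t in X i | t \in sdiff (tr x1 h) B]|)).
      rewrite leq_mul2l /=; apply: subset_leq_card; apply/subsetP => t; rewrite !inE.
      move=> /andP[tX ht]; rewrite tX /= leNgt ht /=.
      by have := subsetP side t; rewrite inE => /(_ tX) ->.
    by rewrite leq_mul2r; apply/orP; right; rewrite leq_pmull // muln_gt0 y0.
  apply: leq_trans iI _.
  apply: (@leq_trans (2 * y * #|[set t in X i | t \in sdiff (tr x1 h) B]|)).
    rewrite leq_mul2l; apply/orP; right; apply: subset_leq_card; apply/subsetP => t; rewrite !inE.
    move=> /andP[tX /asboolP Kt]; rewrite tX /= hK0 //.
    by rewrite (disjointFr side) // inE.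
  by rewrite leq_mul2r; apply/orP; right; rewrite leq_pmulr.
have sd : (\sum_i #|[set t in X i | t \in sdiff (tr x1 h) B]| = #|sdiff (tr x1 h) B|)%N.
  have -> : sdiff (tr x1 h) B = [set t | t \in sdiff (tr x1 h) B] by apply/setP => t; rewrite !inE.
  rewrite (card_classes _ c1); apply: eq_bigr => i _; apply: eq_card => t.
  by rewrite !inE andbC.
have unc : (#|[set i in J | ~~ cr i]| <= b)%N.
  have h1 : (#|[set i in J | ~~ cr i]| * a <= 2 * y * d.+1 * #|sdiff (tr x1 h) B|)%N.
    rewrite -sd big_distrr /= -sum_nat_const [leqRHS](bigID (fun i => i \in [set i in J | ~~ cr i])) /=.
    apply: leq_trans (leq_addr _ _); apply: leq_sum => i; rewrite inE => /andP[]; exact: key.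
  have h2 := leq_mul (leqnn r) h1.
  have : (r * (#|[set i in J | ~~ cr i]| * a) <= r ^ d * a)%N.
    by rewrite -cT1; apply: leq_trans h2 _; apply: leq_trans hB; rewrite mulnA [(r * _)%N]mulnC.
  by rewrite mulnA leq_pmul2r // [leqRHS]expnS leq_pmul2l.
have crs : (#|[set i in J | cr i]| <= b + 2 * K0 * (1 + 2 * d * b))%N.
  apply: leq_trans (c3 B'); rewrite card_sum; apply: leq_sum => i _.
  by rewrite inE; case: (i \in J) => //=; case: (cr i).
have cJ2 : (#|J| <= C3 * b)%N.
  have -> : #|J| = (#|[set i in J | cr i]| + #|[set i in J | ~~ cr i]|)%N.
    rewrite -(cardsID [set i | cr i] J); congr (_ + _)%N; apply: eq_card => i; rewrite !inE //.
    by rewrite andbC.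
  apply: leq_trans (leq_add crs unc) _.
  have b1 : (0 < b)%N by rewrite expn_gt0 r0.
  by move: b1; move: (b)%N K0 => bb kk; nia.
have := leq_trans cI (leq_mul (leqnn (2 * y)) (leq_trans cJ (leq_mul (leqnn _) cJ2))).
rewrite expnS; have := yy'; have b1 : (0 < b)%N by rewrite expn_gt0 r0.
rewrite -(ltn_pmul2r b1) => lt.
by rewrite mulnA leqNgt !mulnA; rewrite !mulnA in lt; rewrite lt.
Qed.

End OneLevel.
End WeakNets.

(** * Weak nets in the plane *)

Section Plane.
Variable R : realType.

Lemma quantile (U : finType) (S : {set U}) (v : U -> R) c : (0 < c <= #|S|)%N ->
  exists q, (c <= #|[set u in S | (v u <= q)%R]|)%N /\ (#|[set u in S | (v u < q)%R]| < c)%N.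
Proof.
move=> /andP[c0 cS].
pose P u := (u \in S) && (c <= #|[set u' in S | (v u' <= v u)%R]|)%N.
have S0 : (0 < #|S|)%N by apply: leq_trans cS.
have [u0 u0S] : exists u, u \in S by apply/set0Pn; rewrite -card_gt0.
have [um umS hum] := @arg_maxP _ _ _ u0 (fun u => u \in S) v u0S.
have Pm : P um.
  rewrite /P umS; apply: leq_trans cS _; apply: subset_leq_card; apply/subsetP => u uS.
  by rewrite inE uS; apply: hum.
have [q /andP[qS qc] hq] := @arg_minP _ _ _ um P v Pm.
exists (v q); split=> //; rewrite ltnNge; apply/negP => h.
have [u1] : exists u, u \in [set u in S | (v u < v q)%R].
  by apply/set0Pn; rewrite -card_gt0; apply: leq_trans h.
move=> u1S; have [w + hw] := @arg_maxP _ _ _ u1 (fun u => u \in [set u in S | (v u < v q)%R]) v u1S.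
rewrite /= inE => /andP[wS wq].
have : P w.
  rewrite /P wS; apply: leq_trans h _; apply: subset_leq_card; apply/subsetP => u uS.
  by rewrite inE; apply/andP; split; [move: uS; rewrite inE => /andP[]|apply: hw].
by move/hq; rewrite leNgt wq.
Qed.

(** Greedy from the left: take the [c]-th smallest value [q]. An interval with [c] points that meets
    the values up to [q] must contain [q], and each choice uses up [c] points. *)
Lemma line_net (U : finType) (v : U -> R) (c Y : nat) (S : {set U}) : (0 < c)%N ->
  (#|S| <= Y * c)%N -> exists L : seq R, (size L <= Y)%N /\
  forall P : R -> Prop, (forall a b x, P a -> P b -> (a <= x)%R -> (x <= b)%R -> P x) ->
    (c <= #|[set u in S | `[< P (v u) >]]|)%N -> exists2 z, z \in L & P z.
Proof.
move=> c0; elim: Y S => [|Y IH] S cS.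
  exists [::]; split=> // P _ h; have : (0 < #|S|)%N.
    apply: leq_trans c0 (leq_trans h _); apply: subset_leq_card.
    by apply/subsetP => u; rewrite inE => /andP[].
  by move: cS; rewrite mul0n leqn0 => /eqP ->.
have [lt|ge] := ltnP #|S| c.
  exists [::]; split=> // P _ h; exfalso; move: lt; rewrite ltnNge => /negP[].
  apply: leq_trans h _; apply: subset_leq_card.
  by apply/subsetP => u; rewrite inE => /andP[].
have [|q [q1 q2]] := @quantile U S v c; first by rewrite c0.
have [|L [sL hL]] := IH [set u in S | (q < v u)%R].
  rewrite -(leq_add2l c) -mulSn; apply: leq_trans cS.
  rewrite -(cardsID [set u | (v u <= q)%R] S); apply: leq_add.
    by apply: leq_trans q1 _; apply: eq_leq; apply: eq_card => u; rewrite !inE.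
  by apply: eq_leq; apply: eq_card => u; rewrite !inE -ltNge andbC.
exists (q :: L); split=> // P cP h.
have [[u [uS Pu uq]]|no] := pselect (exists u, [/\ u \in S, P (v u) & (v u <= q)%R]).
  exists q; first by rewrite inE eqxx.
  have [w [wP wq]] : exists w, P (v w) /\ (q <= v w)%R.
    apply: contrapT => no; move: q2; rewrite ltnNge => /negP[]; apply: leq_trans h _.
    apply: subset_leq_card; apply/subsetP => w; rewrite !inE => /andP[wS /asboolP wP].
    by rewrite wS ltNge; apply/negP => wq; apply: no; exists w.
  exact: (cP _ _ _ Pu wP).
have [|z zL Pz] := hL P cP; last by exists z => //; rewrite inE zL orbT.
apply: leq_trans h _; apply: subset_leq_card; apply/subsetP => u; rewrite !inE.
move=> /andP[uS uP]; rewrite uS uP ltNge /= andbT; apply/negP => uq.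
by apply: no; exists u; split=> //; apply/asboolP.
Qed.

Definition mk2 (a b : R) : 'rV[R]_2 := \row_i (if i == ord0 then a else b).

Lemma mk2K (z : 'rV[R]_2) : mk2 (z 0%R ord0) (z 0%R ord_max) = z.
Proof.
apply/rowP => i; rewrite mxE; case: eqP => [->//|ni]; congr (z _ _).
by apply: val_inj; move: ni; case: i => [[|[|i]] hi] //= ni; case: ni; apply: val_inj.
Qed.

Lemma between (a b t : R) : (a <= t)%R -> (t <= b)%R ->
  exists s : R, [/\ (0 <= s)%R, (s <= 1)%R & (s * a + (1 - s) * b = t)%R].
Proof.
move=> hp hq; have [e|ne] := eqVneq a b.
  exists 0%R; split; rewrite ?ler01 // mul0r subr0 mul1r add0r; apply/eqP.
  by rewrite eq_le hq andbT -e.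
have ab : (0 < b - a)%R by rewrite subr_gt0 lt_neqAle ne (le_trans hp hq).
exists ((b - t) / (b - a))%R; split.
- by apply: divr_ge0; [rewrite subr_ge0|apply: ltW].
- by rewrite ler_pdivrMr // mul1r lerD2l lerN2.
- by field; rewrite gt_eqF.
Qed.

(** One half holds fewer than m / y' <= 8 m / (5 y) points of a set that has at least 2 m / y, so
    the other holds more than 2 m / (5 y) >= m / (4 y'). *)
Lemma half_count (m y y' k0 k1 : nat) : (0 < y)%N -> (5 * y <= 8 * y')%N ->
  (2 * m <= y * (k0 + k1))%N -> (y' * k1 < m)%N -> (m <= 4 * y' * k0)%N.
Proof.
move=> y0 h1 h2 h3; rewrite -(leq_pmul2l y0).
have := leq_mul (leqnn y') h2; have := leq_mul (leqnn y) (ltnW h3).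
have := leq_mul (leqnn m) h1; nia.
Qed.

Lemma line_point (p q : 'rV[R]_2) (t : R) : (p 0 ord0 <= t)%R -> (t <= q 0 ord0)%R ->
  exists v, forall K : 'rV[R]_2 -> Prop, convex K -> K p -> K q -> K (mk2 t v).
Proof.
move=> hp hq; have [s [s0 s1 st]] := between hp hq; exists ((s *: p + (1 - s) *: q) 0%R ord_max)%R => K cK Kp Kq.
suff -> : mk2 t ((s *: p + (1 - s) *: q) 0 ord_max)%R = (s *: p + (1 - s) *: q)%R by apply: cK.
by rewrite -[RHS]mk2K; congr mk2; rewrite !mxE -st.
Qed.

Lemma split_half (T : finType) (v : T -> R) m : #|T| = m.*2 -> (0 < m)%N ->
  exists (S : {set T}) (t : R), [/\ #|S| = m, #|~: S| = m, forall i, i \in S -> (v i <= t)%R &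
    forall i, i \notin S -> (t <= v i)%R].
Proof.
move=> cT m0; have [|t [t1 t2]] := @quantile T [set: T] v m.
  by rewrite m0 cardsT cT -addnn leq_addr.
pose A := [set i | (v i < t)%R]; pose B := [set i | (v i == t)].
have cA : (#|A| < m)%N.
  by apply: leq_trans t2; rewrite ltnS; apply: subset_leq_card; apply/subsetP => i; rewrite !inE.
have [|B' B'B cB'] := @subset_of_card _ B (m - #|A|).
  rewrite leq_subLR; apply: leq_trans t1 _; apply: leq_trans (leq_card_setU A B).
  by apply: subset_leq_card; apply/subsetP => i; rewrite !inE /= le_eqVlt orbC.
have dis : [disjoint A & B'].
  rewrite -setI_eq0; apply/eqP/setP => i; rewrite !inE; apply/negbTE/negP => /andP[it iB].
  by have := subsetP B'B _ iB; rewrite inE => /eqP e; rewrite e ltxx in it.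
have cS : #|A :|: B'| = m.
  by rewrite cardsU (eqP (_ : A :&: B' == set0)) ?setI_eq0 // cards0 subn0 cB' subnKC // ltnW.
exists (A :|: B'), t; split=> //.
- by have := cardsC (A :|: B'); rewrite cS cT -addnn => /addnI.
- move=> i; rewrite !inE => /orP[/ltW//|/(subsetP B'B)]; rewrite inE => /eqP ->; exact: lexx.
- by move=> i; rewrite !inE negb_or -leNgt => /andP[].
Qed.

(* A convex set missed by the nets of both halves has many points on each side of the
   vertical line, so a one-dimensional net of the crossings of all segments joining
   the halves hits it. *)
Lemma wnet2_halve (y y' N : nat) : (0 < y)%N -> (5 * y <= 8 * y')%N -> wnet R 2 y' N ->
  wnet R 2 y (2 * N + 16 * y' ^ 2).
Proof.
move=> y0 yy' hw T x T0; pose m := #|T|.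
pose T1 := (T * bool)%type; pose x1 (t : T1) := x t.1.
have cT1 : #|{: T1}| = m.*2 by rewrite card_prod card_bool muln2.
have [S [t [cS cS' hS hS']]] := split_half (fun i => x1 i 0%R ord0) cT1 T0.
have [|L0 [sL0 hL0]] := wnet_on x1 hw (_ : (0 < #|S|)%N); first by rewrite cS.
have [|L1 [sL1 hL1]] := wnet_on x1 hw (_ : (0 < #|~: S|)%N); first by rewrite cS'.
pose U := (T1 * T1)%type; pose SU : {set U} := setX S (~: S).
have hv (u : U) : exists v, u \in SU -> forall K : 'rV[R]_2 -> Prop, convex K ->
    K (x1 u.1) -> K (x1 u.2) -> K (mk2 t v).
  case: (boolP (u \in SU)) => [|_]; last by exists 0%R.
  rewrite !inE => /andP[u1 u2]; have [v hv] := line_point (hS _ u1) (hS' _ u2).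
  by exists v.
have [v vP] := choice hv.
pose Y := (16 * y' ^ 2)%N.
have cSU : #|SU| = (m * m)%N by rewrite cardsX cS cS'.
(* The quotient rounded up; rounding down could give 0. *)
pose c := ((m * m) %/ Y + ((m * m) %% Y != 0))%N.
have y'0 : (0 < y')%N by lia.
have Y0 : (0 < Y)%N by rewrite muln_gt0 expn_gt0 y'0.
have mc : (m * m <= Y * c)%N.
  rewrite {1}(divn_eq (m * m) Y) mulnC /c mulnDr leq_add2l.
  by case: eqP => [->//|_]; rewrite muln1 ltnW // ltn_pmod.
have cmin k : (m * m <= Y * k)%N -> (c <= k)%N.
  move=> le; rewrite /c; case: eqP => [e|ne].
    by rewrite addn0 -(leq_pmul2l Y0) mulnC; apply: leq_trans le; apply: leq_trunc_div.
  rewrite addn1 -(ltn_pmul2l Y0) mulnC; apply: leq_trans le.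
  rewrite {2}(divn_eq (m * m) Y) -addn1 leq_add2l lt0n; exact/eqP.
have c0 : (0 < c)%N.
  rewrite lt0n; apply/eqP => e; move: mc; rewrite e muln0 leqn0 muln_eq0 orbb => /eqP mm.
  by move: T0; rewrite -/m mm.
have [|L [sL hL]] := @line_net U v c Y SU c0; first by rewrite cSU.
exists (L0 ++ L1 ++ [seq mk2 t z | z <- L]); split.
  by rewrite !size_cat size_map mul2n -addnn -addnA !leq_add.
move=> K cK clK hK; apply: contrapT => miss.
pose k0 := #|[set i in S | `[< K (x1 i) >]]|; pose k1 := #|[set i in ~: S | `[< K (x1 i) >]]|.
have kk : (2 * m <= y * (k0 + k1))%N.
  have -> : (k0 + k1 = #|[set i : T1 | `[< K (x1 i) >]]|)%N.
    rewrite -(cardsID S [set i : T1 | `[< K (x1 i) >]]); congr (_ + _)%N.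
      by apply: eq_card => i; rewrite !inE andbC.
    by apply: eq_card => i; rewrite !inE andbC.
  have -> : [set i : T1 | `[< K (x1 i) >]] = setX [set t | `[< K (x t) >]] [set: bool].
    by apply/setP => i; rewrite !inE andbT.
  by rewrite cardsX cardsT card_bool mulnA mulnC leq_mul2r hK orbT.
have h0 : (y' * k0 < m)%N.
  rewrite ltnNge; apply/negP; rewrite -{1}cS => h; apply: miss.
  by have [z zL Kz] := hL0 K cK clK h; exists z => //; rewrite mem_cat zL.
have h1 : (y' * k1 < m)%N.
  rewrite ltnNge; apply/negP; rewrite -{1}cS' => h; apply: miss.
  by have [z zL Kz] := hL1 K cK clK h; exists z => //; rewrite !mem_cat zL orbT.
have q0 : (m <= 4 * y' * k0)%N by apply: (half_count y0 yy' kk h1).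
have q1 : (m <= 4 * y' * k1)%N by apply: (half_count y0 yy' _ h0); rewrite [(k1 + k0)%N]addnC.
have [||r r1 r2] := hL (fun r => K (mk2 t r)).
- move=> a b z Ka Kb az zb.
  have [s [s0 s1 <-]] := between az zb.
  suff -> : mk2 t (s * a + (1 - s) * b)%R = (s *: mk2 t a + (1 - s) *: mk2 t b)%R by apply: cK.
  by apply/rowP => i; rewrite !mxE; case: eqP => _ //; ring.
- apply: cmin; apply: leq_trans (leq_mul q0 q1) _.
  have -> : (4 * y' * k0 * (4 * y' * k1) = Y * (k0 * k1))%N by rewrite /Y; ring.
  rewrite leq_mul2l; apply/orP; right.
  rewrite -cardsX; apply: subset_leq_card; apply/subsetP => u; rewrite !inE.
  move=> /andP[/andP[u1 /asboolP K1] /andP[u2 /asboolP K2]].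
  by rewrite u1 u2 /=; apply/asboolP; apply: vP => //; rewrite !inE u1.
- by apply: miss; exists (mk2 t r) => //; rewrite !mem_cat map_f ?orbT.
Qed.

End Plane.

(** * Recursive bounds on weak nets *)

Lemma pow_le_exp2 k r : (0 < k)%N -> ((2 * k) ^ 2 <= r)%N -> (r ^ k <= 2 ^ r)%N.
Proof.
move=> k0 kr; pose q := (r %/ (2 * k))%N.
have q1 : (r <= q.+1 * (2 * k))%N by apply: ltnW; rewrite ltn_ceil // muln_gt0.
have q2 : (r <= q.+1 ^ 2)%N.
  have : (r * r <= q.+1 ^ 2 * r)%N.
    apply: leq_trans (leq_mul (leqnn _) kr); rewrite -expnMn -mulnn.
    exact: leq_mul.
  case: (posnP r) => [->//|r0]; by rewrite leq_pmul2r.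
apply: leq_trans (expn_mono k q2) _; rewrite -expnM.
apply: (@leq_trans ((2 ^ q) ^ (2 * k))); first by apply: expn_mono; apply: ltn_expl.
by rewrite -expnM leq_exp2l // leq_trunc_div.
Qed.

Lemma poly_exp a k : exists r0, forall r, (r0 <= r)%N -> (a * r ^ k < 2 ^ r)%N.
Proof.
exists (a.+1 + (2 * k.+1) ^ 2)%N => r hr.
have r1 : (a.+1 <= r)%N by apply: leq_trans hr; apply: leq_addr.
apply: leq_trans (pow_le_exp2 (ltn0Sn k) _); last by apply: leq_trans hr; apply: leq_addl.
rewrite expnS; apply: leq_trans (leq_mul r1 (leqnn _)).
by rewrite ltn_mul2r ltnSn expn_gt0 andbT; apply/orP; left; apply: leq_trans r1.
Qed.

Lemma cond_holds n : exists r0, forall r y, (r0 <= r)%N -> (y <= r.+1 ^ (n.+2 * n.+3))%N ->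
  ((2 * ((2 * y * n.+3 * r) * (2 * r ^ n.+1)) + 1) ^ n.+3 < 2 ^ r ^ n.+1)%N.
Proof.
pose D := (n.+2 * n.+3)%N; pose c := ((9 * n.+3 * 2 ^ D) ^ n.+3)%N; pose k := ((D + 1 + n.+1) * n.+3)%N.
have [r0 hr0] := poly_exp c k; exists r0.+1 => r y hr hy.
have r1 : (0 < r)%N by apply: leq_trans hr.
apply: (@leq_ltn_trans (c * r ^ k)); last first.
  apply: leq_trans (hr0 r (ltnW hr)) _; rewrite leq_exp2l // expnS leq_pmulr // expn_gt0 r1 //.
rewrite /c /k [(r ^ (_ * _))%N]expnM -expnMn; apply: expn_mono.
have h1 : (r.+1 ^ D <= 2 ^ D * r ^ D)%N by rewrite -expnMn; apply: expn_mono; lia.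
have h2 := leq_trans hy h1.
have h3 : (0 < 2 ^ D * r ^ D)%N by rewrite muln_gt0 !expn_gt0 r1.
have h4 : (0 < r ^ n.+1)%N by rewrite expn_gt0 r1.
rewrite !expnD expn1; move: h2 h3 h4.
move: (2 ^ D)%N (r ^ D)%N (r ^ n.+1)%N => p q s h2 h3 h4.
apply: (@leq_trans (8 * (p * q) * n.+3 * r * s + 1)).
  rewrite leq_add2r.
  have -> : (2 * (2 * y * n.+3 * r * (2 * s)) = (8 * y) * (n.+3 * r * s))%N by ring.
  have -> : (8 * (p * q) * n.+3 * r * s = (8 * (p * q)) * (n.+3 * r * s))%N by ring.
  by rewrite leq_mul2r leq_mul2l h2 !orbT.
have -> : (9 * n.+3 * p * (q * r * s) = 8 * (p * q) * n.+3 * r * s + (p * q) * (n.+3 * r * s))%N by ring.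
by rewrite leq_add2l !muln_gt0 h4 r1 -muln_gt0 h3.
Qed.

Lemma base_bound n r : (0 < r)%N ->
  (((2 * r ^ n.+2 + 1) ^ n.+3 + 1) ^ n.+2 <= (2 * 3 ^ n.+3) ^ n.+2 * (r ^ (n.+2 * n.+3)) ^ n.+2)%N.
Proof.
move=> r0; rewrite -expnMn; apply: expn_mono.
have h : (0 < r ^ n.+2)%N by rewrite expn_gt0 r0.
have h1 : (2 * r ^ n.+2 + 1 <= 3 * r ^ n.+2)%N by lia.
apply: leq_trans (leq_add (expn_mono n.+3 h1) (leqnn _)) _.
rewrite expnMn -expnM -mulnA mul2n -addnn leq_add2l muln_gt0 !expn_gt0 r0 //.
Qed.

Definition crossK (d : nat) : nat := 16 * (d + d * d).
(** One level turns [y] into about [lossC d * y / r]: the factor 2 comes from the classes of [I],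
    [d.+1] from the center, and the rest bounds crossed and spoiled classes in units of r^(d-1). *)
Definition lossC (d : nat) : nat := 2 * d.+1 * (2 + 2 * crossK d + 4 * d * crossK d).

Section Recursion.
Variables (R : realType) (n : nat).
Local Notation d := (n.+2).
Local Notation D := (n.+2 * n.+3)%N.

(** One level with [r] so large that y' = 1, where a single point is a net. This supplies the
    initial values of both recursions. *)
Lemma wnet_base y : exists N, wnet R d y N.
Proof.
have [r0 hr0] := cond_holds n; pose r := (r0 + lossC d * y + y).+1.
have [->|y0] := posnP y.
  by exists 0%N => T x T0; exists [::]; split=> // K _ _; rewrite mul0n leqNgt T0.
eexists; apply: (@one_level R n r y 1 1) => //; last exact: wnet1.
  apply: hr0; first by rewrite /r; lia.
  apply: (@leq_trans r.+1); first by rewrite /r; lia.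
  by rewrite -{1}(expn1 r.+1) leq_exp2l.
rewrite mul1n /r; have -> : (2 * y * n.+3 * (2 + 2 * (16 * (d + d * d)) + 4 * d * (16 * (d + d * d))) = lossC d * y)%N.
  by rewrite /lossC /crossK; ring.
lia.
Qed.

Lemma wnet_rec : exists y0, forall y, (y0 <= y)%N -> exists r, [/\ (0 < r)%N, (r ^ D <= y)%N,
  (y < r.+1 ^ D)%N & forall N', wnet R d ((lossC d * y) %/ r + 1) N' ->
    wnet R d y ((2 * 3 ^ n.+3) ^ d * y ^ d + r ^ d * N')].
Proof.
have [r0 hr0] := cond_holds n; exists (r0 ^ D).+1 => y hy.
have y0 : (0 < y)%N by apply: leq_trans hy.
(* [r] is the integer part of y^(1/D), so the centers, O(r^(D d)) in number, cost O(y^d). *)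
have [r [r1 r2 r3]] := @root_exists (n.+2 * n.+3).-1 y y0.
rewrite prednK // in r2 r3.
have r4 : (y < r.+1 ^ D)%N by rewrite ltnNge; apply/negP => /r3; rewrite ltnn.
exists r; split=> // N' hN'.
apply: (@wnet_leN R d y (((2 * r ^ d + 1) ^ d.+1 + 1) ^ d + r ^ d * N')).
  rewrite leq_add2r; apply: leq_trans (base_bound n r1) _.
  by rewrite leq_mul2l; apply/orP; right; apply: expn_mono.
apply: one_level hN' => //.
  by apply: hr0; [apply: r3; apply: ltnW|apply: ltnW].
rewrite addn1; have -> : (2 * y * n.+3 * (2 + 2 * (16 * (d + d * d)) + 4 * d * (16 * (d + d * d))) = lossC d * y)%N.
  by rewrite /lossC /crossK; ring.
exact: ltn_ceil.
Qed.

End Recursion.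

Lemma lossC_le n : (2 * lossC n.+2 <= n.+2 ^ 15)%N.
Proof.
have h : (2 ^ 11 <= n.+2 ^ 11)%N by apply: expn_mono.
have -> : (n.+2 ^ 15 = n.+2 ^ 11 * n.+2 ^ 4)%N by rewrite -expnD.
apply: leq_trans (leq_mul h (leqnn _)).
rewrite /lossC /crossK !expnS expn0 !muln1; nia.
Qed.

Lemma wnet2_bound (R : realType) : exists A, forall y, (0 < y)%N -> wnet R 2 y (A * y ^ 2).
Proof.
have [B hB] := wnet_base R 0 20.
(* For y > 20 the recursion has y' <= 17 y / 25. As 2 (17/25)^2 = 578/625, the new term 16 y'^2 is
   absorbed once 47 A >= 16 * 289, whence 100. *)
have [A hA BA] : exists2 A, (100 <= A)%N & (B <= A)%N by exists (B + 100)%N; [apply: leq_addl|apply: leq_addr].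
exists A; elim/ltn_ind => y IH y0.
have [le|gt] := leqP y 20.
  apply: wnet_leN (wnet_ley le hB).
  by rewrite -(muln1 B) leq_mul // expn_gt0 y0.
pose y' := ((5 * y) %/ 8).+1.
have y'1 : (y' < y)%N by rewrite /y'; lia.
have := wnet2_halve y0 _ (IH y' y'1 (ltn0Sn _)).
move=> /(_ ltac:(rewrite /y'; lia)); apply: wnet_leN.
have h : (25 * y' <= 17 * y)%N by rewrite /y'; lia.
have h2 : (625 * y' ^ 2 <= 289 * y ^ 2)%N.
  have := leq_mul h h; rewrite mulnACA [leqRHS]mulnACA !mulnn.
  by move: (y' ^ 2)%N (y ^ 2)%N => p q; lia.
move: h2; move: (y' ^ 2)%N (y ^ 2)%N => p q h2.
have := leq_mul (leqnn A) h2; have := leq_mul hA (leqnn q); move: h2.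
rewrite mulnCA [(A * (289 * q))%N]mulnCA.
by move: (A * p)%N (A * q)%N => Ap Aq; lia.
Qed.

Local Open Scope ring_scope.

(** * A popular point *)

Lemma superset_of_card (T : finType) (A : {set T}) p : (#|A| <= p)%N -> (p <= #|T|)%N ->
  exists2 B : {set T}, A \subset B & #|B| = p.
Proof.
move=> Ap pT; have [|C CA cC] := @subset_of_card _ (~: A) (p - #|A|).
  by rewrite leq_subLR cardsC.
exists (A :|: C); first exact: subsetUl.
rewrite cardsU (_ : A :&: C = set0) ?cards0 ?subn0 ?cC ?subnKC //.
apply/setP => t; rewrite !inE; apply/negbTE/negP => /andP[tA /(subsetP CA)].
by rewrite inE tA.
Qed.

Section Sampling.
Variables (R : realType) (I : finType) (M : I -> R) (p : nat).
Hypotheses (M0 : forall i, 0 <= M i).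
Local Notation W := (\sum_i M i).
Local Notation sample := {ffun 'I_p -> I}.
Implicit Types (s : sample) (i j : 'I_p) (a : I).

Definition wt s : R := \prod_i M (s i).

Definition upd s i a : sample := [ffun j => if j == i then a else s j].

Lemma wt_ge0 s : 0 <= wt s.
Proof. exact: prodr_ge0. Qed.

Lemma sum_wt : \sum_s wt s = W ^+ p.
Proof.
by rewrite -(bigA_distr_bigA (fun (_ : 'I_p) a => M a)) big_const_ord iter_mulr_1.
Qed.

Lemma wt_upd s i a : wt (upd s i a) * M (s i) = wt s * M a.
Proof.
rewrite /wt (bigD1 i) //= [in RHS](bigD1 i) //= ffunE eqxx.
rewrite (eq_bigr (fun j => M (s j))) => [|j ji]; last by rewrite ffunE (negbTE ji).
by ring.
Qed.

(* Exchanging the i-th entry with a fresh independent draw preserves the weights. *)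
Lemma resample i (g : sample -> R) (phi : sample -> I -> R) (beta : R) :
  0 < W -> (forall s, 0 <= g s) ->
  (forall s a, g (upd s i a) = g s) -> (forall s a b, phi (upd s i a) b = phi s b) ->
  (forall s, \sum_a M a * phi s a <= beta * W) ->
  \sum_s wt s * (g s * phi s (s i)) <= beta * \sum_s wt s * g s.
Proof.
move=> W0 g0 gi phii hb; rewrite -(ler_pM2l W0).
have -> : W * \sum_s wt s * (g s * phi s (s i)) =
    \sum_s \sum_a wt s * M a * (g s * phi s (s i)).
  rewrite mulr_sumr; apply: eq_bigr => s _; rewrite mulr_suml.
  by apply: eq_bigr => a _; ring.
rewrite pair_bigA /= (reindex_onto (fun q : sample * I => (upd q.1 i q.2, q.1 i))
   (fun q : sample * I => (upd q.1 i q.2, q.1 i))) /=; last first.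
  move=> [s a] _ /=; rewrite ffunE eqxx; congr (_, _); apply/ffunP => j; rewrite !ffunE.
  by case: eqP => [->|].
rewrite (eq_bigl xpredT); last first.
  move=> [s a] /=; rewrite ffunE eqxx xpair_eqE eqxx andbT; apply/eqP/ffunP => j; rewrite !ffunE.
  by case: eqP => [->|].
rewrite -(pair_bigA _ (fun s a => wt (upd s i a) * M (s i) * (g (upd s i a) * phi (upd s i a) (upd s i a i)))) /=.
rewrite mulrCA mulr_sumr mulr_sumr; apply: ler_sum => s _.
apply: (@le_trans _ _ (wt s * g s * \sum_a M a * phi s a)).
  rewrite mulr_sumr le_eqVlt; apply/orP; left; apply/eqP; apply: eq_bigr => a _.
  by rewrite wt_upd gi phii ffunE eqxx; ring.
apply: (@le_trans _ _ (wt s * g s * (beta * W))).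
  by rewrite ler_wpM2l // mulr_ge0 // wt_ge0.
by rewrite le_eqVlt; apply/orP; left; apply/eqP; ring.
Qed.

(** Independence: [phi] does not look at the positions in [E], so these are redrawn one after
    another, each contributing a factor [beta]. *)
Lemma sum_pow (beta : R) (E : {set 'I_p}) (phi : sample -> I -> R) :
  0 < W -> 0 <= beta -> (forall s a, 0 <= phi s a) ->
  (forall i s a b, i \in E -> phi (upd s i a) b = phi s b) ->
  (forall s, \sum_a M a * phi s a <= beta * W) ->
  \sum_s wt s * \prod_(i in E) phi s (s i) <= beta ^+ #|E| * W ^+ p.
Proof.
move=> W0 b0 phi0 hE hb; have [n cE] : exists n, #|E| = n by exists #|E|.
elim: n E cE hE => [|n IH] E cE hE.
  rewrite cE expr0 mul1r -sum_wt; apply: ler_sum => s _.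
  by rewrite (cards0_eq cE) big_set0 mulr1.
have [i iE] : exists i, i \in E by apply/set0Pn; rewrite -card_gt0 cE.
have cE' : #|E :\ i| = n by move: cE; rewrite (cardsD1 i E) iE => -[].
have hE' j s a b : j \in E :\ i -> phi (upd s j a) b = phi s b.
  by rewrite inE => /andP[_ jE]; apply: hE.
have := IH _ cE' hE'; rewrite cE cE' => IH'.
rewrite exprS -mulrA; apply: le_trans (ler_wpM2l b0 IH').
under eq_bigr do rewrite (big_setD1 i iE) /= mulrC.
under eq_bigr do rewrite mulrC [phi _ _ * _]mulrC.
apply: (@resample i (fun s => \prod_(j in E :\ i) phi s (s j)) phi beta) => //.
- by move=> s; apply: prodr_ge0.
- move=> s a; apply: eq_bigr => j; rewrite !inE => /andP[ji jE].
  by rewrite hE // ffunE (negbTE ji).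
- by move=> s a b; apply: hE.
Qed.

End Sampling.

Section Popular.
Variables (R : realType) (d : nat) (I : finType) (F : I -> 'rV[R]_d -> Prop).
Variables (p q k y : nat) (M : I -> R).
Hypothesis cF : forall i, convex (F i).
Hypothesis clF : forall i, closed (F i).
Hypothesis pq : forall A : {set I}, #|A| = p -> exists B : {set I},
  [/\ B \subset A, #|B| = q & exists z, forall i, i \in B -> F i z].
Hypothesis pI : (p <= #|I|)%N.
Hypotheses (M0 : forall i, 0 <= M i) (M1 : forall i, M i <= 1).
Local Notation W := (\sum_i M i).
Local Notation c := (q %/ (2 * d.+1))%N.
Hypotheses (dq : (d < q)%N) (qp : (q <= p)%N) (kE : k = (q - c)%N) (y0 : (0 < y)%N).
Hypothesis heavy : 4 * d.+1%:R * p%:R ^+ 2 <= q%:R * W.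
Hypothesis ybig : (2 * ('C(p, k) * 'C(k, d)) < y ^ (k - d))%N.
Local Notation sample := {ffun 'I_p -> I}.
Implicit Types (s : sample).

Let vtx (D : {set 'I_p}) s := mn (fun z => forall i, i \in D -> F (s i) z).
Let hit z a : R := if `[< F a z >] then 1 else 0.

Lemma W_gt0 : 0 < W.
Proof.
have p0 : (0 < p)%N by apply: leq_trans qp; apply: leq_trans dq.
have : 0 < q%:R * W.
  by apply: lt_le_trans heavy; rewrite !mulr_gt0 ?exprn_gt0 ?ltr0n.
by rewrite pmulr_rgt0 // ltr0n (leq_trans _ dq).
Qed.

Lemma kd : (d < k)%N.
Proof.
rewrite kE; have h := leq_trunc_div q (2 * d.+1).
have : (c * (2 * d.+1) <= q)%N by [].
by move: (c) => cc; nia.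
Qed.

Definition image s : {set I} := [set s i | i : 'I_p].

(** Markov's inequality for the number of ordered pairs of equal entries. By the cap [M i <= 1] two
    positions agree with probability at most 1 / W, so the mean is at most p^2 / W, and [heavy]
    makes this at most half of q / (2 (d + 1)). *)
Lemma few_collisions : \sum_(s | (p - #|image s| > c)%N) wt M s <= W ^+ p / 2.
Proof.
have W0 := W_gt0.
have pairs i j : i != j -> \sum_(s : sample) wt M s * (s i == s j)%:R <= W^-1 * W ^+ p.
  move=> ij; have := @resample R I M p M0 i (fun=> 1) (fun s a => (a == s j)%:R) W^-1 W0.
  rewrite -(sum_wt M p) => h; under eq_bigr do rewrite -[(_ == _)%:R]mul1r.
  have -> : \sum_(s : sample) wt M s = \sum_(s : sample) wt M s * 1 by apply: eq_bigr => s _; rewrite mulr1.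
  apply: h => //.
  - by move=> s a b; rewrite ffunE [j == i]eq_sym (negbTE ij).
  - move=> s; rewrite mulVf ?gt_eqF // (bigD1 (s j)) //= eqxx mulr1 big1 ?addr0 //.
    by move=> a /negbTE ->; rewrite mulr0.
pose coll s : R := \sum_i \sum_(j | j != i) (s i == s j)%:R.
have coll0 s : 0 <= coll s by apply: sumr_ge0 => i _; apply: sumr_ge0.
have WW : 0 <= W^-1 * W ^+ p by rewrite mulr_ge0 ?invr_ge0 ?exprn_ge0 // ltW.
have collE : \sum_(s : sample) wt M s * coll s <= p%:R ^+ 2 * (W^-1 * W ^+ p).
  under eq_bigr do rewrite mulr_sumr.
  rewrite exchange_big /= expr2 -mulrA.
  apply: (@le_trans _ _ (\sum_(i < p) p%:R * (W^-1 * W ^+ p))); last first.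
    by rewrite sumr_const card_ord -[leLHS]mulr_natl.
  apply: ler_sum => i _; under eq_bigr do rewrite mulr_sumr.
  rewrite exchange_big /=; apply: (@le_trans _ _ (\sum_(j < p) W^-1 * W ^+ p)); last first.
    by rewrite sumr_const card_ord -[leLHS]mulr_natl.
  rewrite big_mkcond; apply: ler_sum => j _; case: ifP => // ji.
  by apply: pairs; rewrite eq_sym.
have pc s : (p - #|image s|)%:R <= coll s.
  pose rep a := [pick i | s i == a].
  have repS a j : rep a = Some j -> s j = a.
    by rewrite /rep; case: pickP => // j' /eqP sj' [<-].
  pose P := [set i | rep (s i) == Some i].
  have cP : #|P| = #|image s|.
    rewrite -(card_in_imset (_ : {in P &, injective s})); last first.
      move=> i j; rewrite !inE => /eqP ri /eqP rj e; apply: Some_inj.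
      by rewrite -ri -rj e.
    apply: eq_card => a; apply/imsetP/imsetP => -[i _ ->]; first by exists i.
    case e : (rep (s i)) => [j|]; last first.
      by move: e; rewrite /rep; case: pickP => // /(_ i); rewrite eqxx.
    by exists j; [rewrite inE (repS _ _ e) e|rewrite (repS _ _ e)].
  have -> : (p - #|image s|)%:R = \sum_(i in ~: P) 1 :> R.
    rewrite -cP sumr_const -[RHS]mulr_natl mulr1; congr _%:R.
    by have := cardsC P; rewrite card_ord; lia.
  rewrite /coll [leRHS](bigID (fun i => i \in ~: P)) /= -[leLHS]addr0; apply: lerD; last first.
    by apply: sumr_ge0 => i _; apply: sumr_ge0.
  apply: ler_sum => i; rewrite !inE /rep; case: pickP => [j /eqP sj|/(_ i)]; last by rewrite eqxx.
  move=> ne; have ji : j != i by apply: contraNneq ne => ->.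
  by rewrite (bigD1 j) //= sj eqxx lerDl; apply: sumr_ge0.
have q0 : 0 < q%:R :> R by rewrite ltr0n (leq_trans _ dq).
pose t : R := q%:R / (2 * d.+1%:R).
have t0 : 0 < t by rewrite divr_gt0 // mulr_gt0 // ltr0n.
have h1 : t * \sum_(s | (p - #|image s| > c)%N) wt M s <= p%:R ^+ 2 * (W^-1 * W ^+ p).
  apply: le_trans collE; rewrite mulr_sumr [leRHS](bigID (fun s => (p - #|image s| > c)%N)) /=.
  rewrite -[leLHS]addr0; apply: lerD; last first.
    by apply: sumr_ge0 => s _; apply: mulr_ge0; [apply: wt_ge0|apply: coll0].
  apply: ler_sum => s hs; rewrite mulrC; apply: ler_wpM2l; first exact: wt_ge0.
  apply: le_trans (pc s).
  rewrite ler_pdivrMr ?mulr_gt0 ?ltr0n // -!natrM ler_nat.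
  by apply: ltnW; rewrite -ltn_divLR ?muln_gt0.
rewrite -(ler_pM2l t0); apply: le_trans h1 _.
have Wp : 0 < W ^+ p by apply: exprn_gt0.
have e0 : 0 < 2 * d.+1%:R :> R by rewrite mulr_gt0 // ltr0n.
have tE : t * (2 * d.+1%:R) = q%:R by rewrite /t divfK // gt_eqF.
suff h2 : p%:R ^+ 2 * W^-1 <= t / 2.
  have -> : t * (W ^+ p / 2) = t / 2 * W ^+ p by ring.
  by rewrite mulrA ler_pM2r.
rewrite ler_pdivrMr // -(ler_pM2l e0).
have -> : 2 * d.+1%:R * (t / 2 * W) = 2^-1 * (q%:R * W) by rewrite -tE; ring.
rewrite ler_pdivlMl //; apply: le_trans heavy; rewrite le_eqVlt; apply/orP; left; apply/eqP; ring.
Qed.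

Lemma convex_cap (s : sample) (D : {set 'I_p}) : convex (fun z => forall i, i \in D -> F (s i) z).
Proof. by move=> x z t hx hz t0 t1 i iD; apply: cF; [apply: hx|apply: hz| |]. Qed.

(* The sample has k sets with a common point, of which at most d determine the point
   of least norm common to all k. *)
Lemma good_sample s : (p - #|image s| <= c)%N -> exists B D : {set 'I_p},
  [/\ #|B| = k, D \subset B, #|D| = d & forall i, i \in B -> F (s i) (vtx D s)].
Proof.
move=> hs; have ip : (#|image s| <= p)%N.
  by apply: leq_trans (leq_imset_card _ _) _; rewrite -[leqRHS](card_ord p) max_card.
(* The sampled sets are completed to [p] distinct ones. At most [c] of the [q] sets with a common
   point are completions, which leaves [k = q - c] sampled ones. *)
have [A imA cA] := superset_of_card ip pI.
have [C [CA cC [z hz]]] := pq cA.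
have hCI : (k <= #|C :&: image s|)%N.
  have h1 : (#|C :\: image s| <= p - #|image s|)%N.
    apply: (@leq_trans #|A :\: image s|); first by apply: subset_leq_card; apply: setSD.
    by rewrite cardsD (finset.setIidPr imA) cA.
  by have := cardsID (image s) C; rewrite kE cC; lia.
have hpos a : a \in image s -> exists i, s i = a by case/imsetP => i _ ->; exists i.
have [i0 _] : exists i : 'I_p, true.
  by have : (0 < p)%N by [apply: leq_trans qp; apply: leq_trans dq]; case: (p) => // n _; exists ord0.
pose pos a := if [pick i | s i == a] is Some i then i else i0.
have posP a : a \in image s -> s (pos a) = a.
  case/hpos => i si; rewrite /pos; case: pickP => [j /eqP //|/(_ i)]; by rewrite si eqxx.
have [|B BC cB] := @subset_of_card _ (pos @: (C :&: image s)) k.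
  rewrite card_in_imset // => a b; rewrite !inE => /andP[_ ai] /andP[_ bi] e.
  by rewrite -(posP _ ai) -(posP _ bi) e.
have Bz i : i \in B -> F (s i) z.
  by move=> /(subsetP BC)/imsetP[a]; rewrite inE => /andP[aC ai] ->; rewrite posP //; apply: hz.
pose G (u : {i | i \in B}) := F (s (val u)).
have cG u : convex (G u) by apply: cF.
have clG u : closed (G u) by apply: clF.
have [S [cS hS]] := mn_basis cG clG (ex_intro _ z (fun u => Bz _ (valP u))).
have SB : val @: S \subset B by apply/subsetP => _ /imsetP[u _ ->]; apply: valP.
have cS' : (#|val @: S| <= d)%N by apply: leq_trans (leq_imset_card _ _) cS.
have [D' D'B cD'] : exists2 D' : {set 'I_p}, D' \subset B :\: (val @: S) & #|D'| = (d - #|val @: S|)%N.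
  by apply: subset_of_card; rewrite cardsD (finset.setIidPr SB) cB leq_sub2r // ltnW // kd.
exists B, (val @: S :|: D'); split=> //.
- by rewrite subUset SB (subset_trans D'B) // subsetDl.
- rewrite cardsU (_ : _ :&: _ = set0) ?cards0 ?subn0 ?cD' ?subnKC //.
  apply/setP => i; rewrite !inE; apply/negbTE/negP => /andP[iS /(subsetP D'B)].
  by rewrite inE iS.
have e : vtx (val @: S :|: D') s = mn (fun z => forall u, G u z).
  apply: hS.
  - by move=> w hw u uS; apply: hw; rewrite inE imset_f.
  - move=> w hw i; rewrite inE => iD.
    have iB : i \in B.
      by case/orP: iD => [/(subsetP SB)//|/(subsetP D'B)]; rewrite inE => /andP[].
    exact: (hw (Sub i iB)).
  - exact: convex_cap.
rewrite e => i iB; have [mC _] := mn_cap cG clG (ex_intro _ z (fun u => Bz _ (valP u))).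
exact: (mC (Sub i iB)).
Qed.

Lemma popular : exists z, W <= y%:R * \sum_(i | `[< F i z >]) M i.
Proof.
apply: contrapT => no; have W0 := W_gt0.
have yR : 0 < y%:R :> R by rewrite ltr0n.
have light z : \sum_a M a * hit z a <= y%:R^-1 * W.
  rewrite ler_pdivlMl // ltW // ltNge; apply/negP => h; apply: no; exists z.
  suff -> : \sum_(a | `[< F a z >]) M a = \sum_a M a * hit z a by [].
  rewrite big_mkcond; apply: eq_bigr => a _.
  by rewrite /hit; case: ifP => _; rewrite ?mulr1 ?mulr0.
have hit0 z a : 0 <= hit z a by rewrite /hit; case: ifP.
have term (B D : {set 'I_p}) : D \subset B -> #|B| = k -> #|D| = d ->
    \sum_(s : sample) wt M s * \prod_(i in B :\: D) hit (vtx D s) (s i) <= y%:R^-1 ^+ (k - d) * W ^+ p.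
  move=> DB cB cD; have <- : #|B :\: D| = (k - d)%N by rewrite cardsD (finset.setIidPr DB) cB cD.
  apply: (@sum_pow R I M p M0 y%:R^-1 (B :\: D) (fun s => hit (vtx D s))) => //.
    by rewrite invr_ge0 ltW.
  move=> i s a b; rewrite inE => /andP[iD _]; congr (hit _ b); apply: mn_eq => z.
  by split=> h j jD; have := h j jD; rewrite ffunE; case: eqP => // ji; move: iD; rewrite -ji jD.
(* Union bound over the [k] positions [B] and the [d] positions [D] among them: the entries in [D]
   fix the point, and each other entry of [B] contains it with probability at most 1 / y. *)
pose BD := [set bd : {set 'I_p} * {set 'I_p} | [&& #|bd.1| == k, bd.2 \subset bd.1 & #|bd.2| == d]].
have cBD : #|BD| = ('C(p, k) * 'C(k, d))%N.
  rewrite -sum1_card (eq_bigl (fun bd : {set 'I_p} * {set 'I_p} =>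
     (bd.1 \in [set B : {set 'I_p} | #|B| == k]) &&
     (bd.2 \in [set D : {set 'I_p} | D \subset bd.1 & #|D| == d]))); last first.
    by move=> bd; rewrite !inE.
  rewrite -(pair_big_dep (fun B => B \in [set B : {set 'I_p} | #|B| == k])
    (fun B D => D \in [set D : {set 'I_p} | D \subset B & #|D| == d]) (fun _ _ => 1%N)) /=.
  rewrite (eq_bigr (fun=> 'C(k, d))) => [|B]; last first.
    by rewrite inE => /eqP cB; rewrite sum1_card cards_draws cB.
  by rewrite sum_nat_const card_draws card_ord.
have half : W ^+ p / 2 <= \sum_(s | (p - #|image s| <= c)%N) wt M s.
  have := few_collisions; rewrite -(sum_wt M p) [X in _ <= X / 2 -> _](bigID (fun s => (p - #|image s| <= c)%N)) /=.
  rewrite [X in X / 2 <= _](bigID (fun s : sample => (p - #|image s| <= c)%N)) /=.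
  under eq_bigl do rewrite ltnNge.
  lra.
have up : \sum_(s | (p - #|image s| <= c)%N) wt M s <=
   ('C(p, k) * 'C(k, d))%:R * (y%:R^-1 ^+ (k - d) * W ^+ p).
  rewrite -cBD -sum1_card natr_sum mulr_suml.
  apply: (@le_trans _ _ (\sum_(bd in BD) \sum_(s : sample)
     wt M s * \prod_(i in bd.1 :\: bd.2) hit (vtx bd.2 s) (s i))); last first.
    apply: ler_sum => bd; rewrite inE mul1r => /and3P[/eqP cB DB /eqP cD].
    exact: term.
  rewrite exchange_big /= big_mkcond; apply: ler_sum => s _; case: ifP => hs; last first.
    apply: sumr_ge0 => bd _; apply: mulr_ge0; first exact: wt_ge0.
    by apply: prodr_ge0.
  have [B [D [cB DB cD hB]]] := good_sample hs.
  rewrite (bigD1 (B, D)) /=; last by rewrite inE /= cB DB cD !eqxx.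
  rewrite big1 ?mulr1 ?lerDl => [|i]; last first.
    by rewrite inE => /andP[_ iB]; rewrite /hit (asboolT (hB _ iB)).
  apply: sumr_ge0 => bd _; apply: mulr_ge0; first exact: wt_ge0.
  by apply: prodr_ge0.
have := le_trans half up; rewrite mulrA mulrC -[X in X <= _]mulrC mulrC ler_pM2r ?exprn_gt0 //.
rewrite exprVn ler_pdivlMr ?exprn_gt0 // ler_pdivrMl // -natrX -natrM ler_nat.
by rewrite leqNgt ybig.
Qed.

End Popular.

(** * From the (p, q)-property to a finite transversal *)

Section Hinge.
Variable R : realType.

(** Quadratic on [0, 1] and linear beyond: [slope], half the derivative, stays in [0, 1] as weights
    must, and the second-order error of a step [h] is at most [h ^+ 2]. *)
Definition hinge (u : R) : R := if u <= 0 then 0 else if u <= 1 then u ^+ 2 else 2 * u - 1.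
Definition slope (u : R) : R := if u <= 0 then 0 else if u <= 1 then u else 1.

Lemma hinge_ge0 u : 0 <= hinge u.
Proof.
rewrite /hinge; case: (leP u 0) => // u0; case: (leP u 1) => u1; [exact: sqr_ge0|lra].
Qed.

Lemma slope_ge0 u : 0 <= slope u.
Proof. by rewrite /slope; case: (leP u 0) => // u0; case: (leP u 1) => // _; apply: ltW. Qed.

Lemma slope_le1 u : slope u <= 1.
Proof. by rewrite /slope; case: (leP u 0) => // u0; case: (leP u 1). Qed.

Lemma hinge_step u h : hinge (u - h) <= hinge u - 2 * slope u * h + h ^+ 2.
Proof.
rewrite /hinge /slope !expr2; case: (leP u 0) => u0; case: (leP (u - h) 0) => v0;
  try (case: (leP u 1) => u1); try (case: (leP (u - h) 1) => v1); nra.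
Qed.

Variables (d : nat) (I : finType) (F : I -> 'rV[R]_d -> Prop) (y : nat) (theta : R).
Hypotheses (y0 : (0 < y)%N) (theta0 : 0 < theta) (I0 : (0 < #|I|)%N).
Hypothesis pop : forall M : I -> R, (forall i, 0 <= M i) -> (forall i, M i <= 1) ->
  theta <= \sum_i M i -> exists z, \sum_i M i <= y%:R * \sum_(i | `[< F i z >]) M i.

Definition hits (xs : seq 'rV[R]_d) i := count (fun z => `[< F i z >]) xs.

(* Gradient descent on a smoothed hinge potential of the excess hit counts. *)
Lemma many_hits : exists xs : seq 'rV[R]_d,
  (#|[set i | (2 * y * hits xs i <= size xs)%N]|)%:R <= theta.
Proof.
have yR : 0 < y%:R :> R by rewrite ltr0n.
have N0 : 0 < #|I|%:R :> R by rewrite ltr0n.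
(* With this step size the first-order gain is at least 2 [del] and the second-order loss g^2 #|I|
   equals [del], so the potential drops by [del] each time. *)
pose g : R := theta / (2 * y%:R * #|I|%:R).
have g0 : 0 < g by rewrite divr_gt0 // !mulr_gt0.
have gE : g * (2 * y%:R * #|I|%:R) = theta by rewrite /g divfK // gt_eqF // !mulr_gt0.
(* A set with too few hits has excess at least 1 and hence slope 1, so a total slope below [theta]
   leaves fewer than [theta] such sets. *)
pose ex xs i : R := 1 - g * ((hits xs i)%:R - (size xs)%:R / (2 * y%:R)).
pose M xs i := slope (ex xs i); pose Phi xs := \sum_i hinge (ex xs i).
pose del : R := g * theta / (2 * y%:R).
have del0 : 0 < del by apply: divr_gt0; apply: mulr_gt0.
suff [xs hxs] : exists xs, \sum_i M xs i < theta.
  exists xs; apply: ltW; apply: le_lt_trans hxs.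
  rewrite -sum1_card natr_sum big_mkcond; apply: ler_sum => i _; rewrite inE.
  case: ifP => hi; last exact: slope_ge0.
  have : 1 <= ex xs i.
    rewrite /ex lerBrDr gerDl pmulr_rle0 // subr_le0 ler_pdivlMr ?mulr_gt0 //.
    by rewrite -!natrM ler_nat mulnC.
  by rewrite /M /slope => h; case: (leP (ex xs i) 0) => h0; [lra|case: (leP (ex xs i) 1) => h1 //; lra].
apply: contrapT => no.
have step n : exists xs, size xs = n /\ Phi xs <= #|I|%:R - n%:R * del.
  elim: n => [|n [xs [sx hx]]].
    exists [::]; split=> //; rewrite mul0r subr0 /Phi -sum1_card natr_sum; apply: ler_sum => i _.
    by rewrite /ex /= mul0r subrr mulr0 subr0 /hinge ler10 lexx expr1n.
  have big : theta <= \sum_i M xs i by rewrite leNgt; apply/negP => h; apply: no; exists xs.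
  have [z hz] := pop (fun i => slope_ge0 _) (fun i => slope_le1 _) big.
  exists (z :: xs); split; first by rewrite /= sx.
  pose D i : R := (if `[< F i z >] then 1 else 0) - (2 * y%:R)^-1.
  have exE i : ex (z :: xs) i = ex xs i - g * D i.
    rewrite /ex /D /hits /= natrD -[(size xs).+1%:R]natr1.
    have -> : (`[< F i z >])%:R = (if `[< F i z >] then 1 else 0) :> R by case: (`[< F i z >]).
    by move: (if _ then _ else _) (2 * y%:R)^-1 (count _ xs)%:R => b w a; ring.
  have D1 i : (g * D i) ^+ 2 <= g ^+ 2.
    rewrite exprMn ler_piMr ?sqr_ge0 // /D expr2.
    have i0 : 0 < (2 * y%:R)^-1 :> R by rewrite invr_gt0 mulr_gt0.
    have i1 : (2 * y%:R)^-1 <= 1 :> R.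
      by rewrite invf_le1 ?mulr_gt0 // -natrM ler1n muln_gt0.
    by case: ifP => _; nra.
  have : Phi (z :: xs) <= \sum_i (hinge (ex xs i) - 2 * M xs i * (g * D i) + g ^+ 2).
    apply: ler_sum => i _; rewrite exE; apply: le_trans (hinge_step _ _) _.
    by rewrite lerD2l.
  rewrite big_split /= big_split /= sumr_const -[_ *+ #|_|]mulr_natr => h1.
  have e : \sum_i - (2 * M xs i * (g * D i)) =
     - (2 * g) * (\sum_(i | `[< F i z >]) M xs i - (2 * y%:R)^-1 * \sum_i M xs i).
    rewrite [X in _ * (X - _)]big_mkcond [_^-1 * _]mulr_sumr -sumrB mulr_sumr.
    apply: eq_bigr => i _; rewrite /D.
    by case: ifP => _; ring.
  have h2 : (2 * y%:R)^-1 * theta <= \sum_(i | `[< F i z >]) M xs i - (2 * y%:R)^-1 * \sum_i M xs i.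
    have : y%:R^-1 * \sum_i M xs i <= \sum_(i | `[< F i z >]) M xs i by rewrite ler_pdivrMl.
    have -> : y%:R^-1 = 2 * (2 * y%:R)^-1 :> R by rewrite invfM mulrA divff ?mul1r ?pnatr_eq0.
    have : (2 * y%:R)^-1 * theta <= (2 * y%:R)^-1 * \sum_i M xs i.
      by rewrite ler_wpM2l // invr_ge0 mulr_ge0 // ltW.
    rewrite -mulrA; move: (_ * \sum_i M xs i) (_ * theta) => a b; lra.
  have h3 : 2 * g * ((2 * y%:R)^-1 * theta) <=
     2 * g * (\sum_(i | `[< F i z >]) M xs i - (2 * y%:R)^-1 * \sum_i M xs i).
    by rewrite ler_wpM2l // mulr_ge0 // ltW.
  have h4 : 2 * g * ((2 * y%:R)^-1 * theta) = 2 * del by rewrite /del; ring.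
  have h5 : g ^+ 2 * #|I|%:R = del.
    rewrite /del -gE expr2; have yn : y%:R != 0 :> R by rewrite gt_eqF.
    by field.
  apply: le_trans h1 _; rewrite e -[n.+1%:R]natr1.
  rewrite (_ : #|xpredT| = #|I|) // h5; rewrite h4 in h3.
  rewrite mulNr [(_ + 1) * del]mulrDl [1 * del]mul1r; move: h3 hx; rewrite -/(Phi xs).
  move: (2 * g * _) (n%:R * del) (Phi xs) => s nd ph h3 hx; lra.
have [n hn] : exists n : nat, #|I|%:R < n%:R * del.
  exists (Num.bound (#|I|%:R / del)); rewrite -ltr_pdivrMr //.
  by apply: archi_boundP; rewrite divr_ge0 // ltW.
have [xs [_ h]] := step n.
have : 0 <= Phi xs by apply: sumr_ge0 => i _; apply: hinge_ge0.
by rewrite leNgt (le_lt_trans h) // subr_lt0.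
Qed.

End Hinge.

(** * Piercing a finite family *)

Section Pierce.
Variables (R : realType) (d : nat) (I : finType) (F : I -> 'rV[R]_d -> Prop) (p q : nat).
Hypothesis pq : forall A : {set I}, #|A| = p -> exists B : {set I},
  [/\ B \subset A, #|B| = q & exists z, forall i, i \in B -> F i z].
Hypotheses (pI : (p <= #|I|)%N) (qp : (q <= p)%N) (q0 : (0 < q)%N).
Hypothesis neF : forall i, exists z, F i z.

Lemma pierce_each (S : {set I}) : exists L : seq 'rV[R]_d, (size L <= #|S|)%N /\
  forall i, i \in S -> exists2 z, z \in L & F i z.
Proof.
have [z zF] := choice neF; exists [seq z i | i <- enum S]; rewrite size_map -cardE.
by split=> // i iS; exists (z i) => //; apply: map_f; rewrite mem_enum.
Qed.

(** Fewer than [p] remaining sets are completed to [p] members; one point pierces [q] of these, and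
    at most [p - q] sets are left, which get a point each. This keeps the coefficient of [p - q]
    equal to 1. *)
Lemma pierce (S : {set I}) : exists L : seq 'rV[R]_d, (size L <= #|S| %/ q + (1 + (p - q)))%N /\
  forall i, i \in S -> exists2 z, z \in L & F i z.
Proof.
have [n] := ubnP #|S|; elim: n S => // n IH S; rewrite ltnS => cS.
have [le|lt] := leqP p #|S|.
  have [A AS cA] := subset_of_card le; have [B [BA cB [z hz]]] := pq cA.
  have cSB : #|S :\: B| = (#|S| - q)%N by rewrite cardsD (finset.setIidPr (subset_trans BA AS)) cB.
  have qS : (q <= #|S|)%N by apply: leq_trans qp le.
  have [|L [sL hL]] := IH (S :\: B).
    by rewrite cSB; apply: leq_trans cS; rewrite ltn_subrL q0 (leq_trans q0 qS).
  exists (z :: L); split.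
    rewrite /=; apply: leq_ltn_trans sL _; rewrite ltn_add2r cSB.
    by rewrite -[in X in (_ < X)%N](subnK qS) divnDr // divnn q0 addn1.
  move=> i iS; case: (boolP (i \in B)) => iB; first by exists z; [rewrite inE eqxx|apply: hz].
  by have [|w wL Fw] := hL i; [rewrite inE iB|exists w => //; rewrite inE wL orbT].
have [A SA cA] := superset_of_card (ltnW lt) pI; have [B [BA cB [z hz]]] := pq cA.
have [L [sL hL]] := pierce_each (S :\: B).
exists (z :: L); split.
  rewrite /= add1n addnS ltnS; apply: leq_trans sL (leq_trans _ (leq_addl _ _)).
  by rewrite -cB -cA -[X in (_ <= _ - X)%N](_ : #|A :&: B| = _) -?cardsD;
    [apply: subset_leq_card; apply: setSD|rewrite (finset.setIidPr BA)].
move=> i iS; case: (boolP (i \in B)) => iB; first by exists z; [rewrite inE eqxx|apply: hz].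
by have [|w wL Fw] := hL i; [rewrite inE iB|exists w => //; rewrite inE wL orbT].
Qed.

Hypothesis cF : forall i, convex (F i).
Hypothesis clF : forall i, closed (F i).
Variables (y N : nat).
Local Notation k := (q - q %/ (2 * d.+1))%N.
Hypotheses (dq : (d < q)%N) (y0 : (0 < y)%N).
Hypothesis ybig : (2 * ('C(p, k) * 'C(k, d)) < y ^ (k - d))%N.
Hypothesis net : wnet R d (2 * y) N.

Lemma finite_transversal : exists L : seq 'rV[R]_d,
  (q ^ 2 * size L <= 4 * d.+1 * p ^ 2 + q ^ 2 * (1 + (p - q) + N))%N /\
  forall i, exists2 z, z \in L & F i z.
Proof.
have qR : 0 < q%:R :> R by rewrite ltr0n.
have p0 : (0 < p)%N by apply: leq_trans qp.
pose theta : R := 4 * d.+1%:R * p%:R ^+ 2 / q%:R.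
have th0 : 0 < theta by rewrite divr_gt0 // !mulr_gt0 ?exprn_gt0 ?ltr0n.
have I0 : (0 < #|I|)%N by apply: leq_trans pI.
have [|xs hxs] := @many_hits R d I F y theta y0 th0 I0.
  move=> M M0 M1 hM; apply: (@popular R d I F p q k y M) => //.
  by move: hM; rewrite /theta ler_pdivrMr // [_ * q%:R]mulrC.
set S := [set i | _] in hxs.
have cS : (#|S| * q <= 4 * d.+1 * p ^ 2)%N.
  by move: hxs; rewrite /theta ler_pdivlMr // -(ler_nat R) !natrM expr2.
have [L1 [sL1 hL1]] := pierce S.
have [L2 [sL2 hL2]] : exists L2 : seq 'rV[R]_d, (size L2 <= N)%N /\
    forall i, i \notin S -> exists2 z, z \in L2 & F i z.
  have [n0|n0] := posnP (size xs).
    by exists [::]; split=> // i; rewrite inE n0 (size0nil n0) /hits /= muln0.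
  have [|L [sL hL]] := net (tnth (in_tuple xs)); first by rewrite card_ord.
  exists L; split=> // i; rewrite inE -ltnNge => hi; apply: hL => //.
  rewrite card_ord; apply: ltnW; apply: leq_trans hi _; rewrite leq_mul2l; apply/orP; right.
  rewrite /hits -[X in (count _ X <= _)%N](_ : [seq tnth (in_tuple xs) t | t <- enum 'I_(size xs)] = xs); last first.
    by rewrite map_tnth_enum.
  by rewrite count_map -size_filter cardE enumT /enum_mem; apply: eq_leq;
    congr size; apply: eq_filter => t; rewrite /= inE.
exists (L1 ++ L2); split.
  rewrite size_cat; apply: leq_trans (leq_mul (leqnn _) (leq_add sL1 sL2)) _.
  rewrite -addnA mulnDr [(_ * (1 + _ + N))%N]mulnDr -[(q ^ 2 * (1 + (p - q)) + _)%N]mulnDr.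
  rewrite leq_add2r; apply: leq_trans cS; rewrite -mulnn -mulnA [(q * (_ * _))%N]mulnC leq_mul2r.
  by apply/orP; right; rewrite mulnC leq_trunc_div.
move=> i; case: (boolP (i \in S)) => iS.
  by have [z zL Fz] := hL1 i iS; exists z => //; rewrite mem_cat zL.
by have [z zL Fz] := hL2 i iS; exists z => //; rewrite mem_cat zL orbT.
Qed.

End Pierce.

Local Close Scope ring_scope.

(** * Choice of y *)

Lemma bin_le_pow2 n m : ('C(n, m) <= 2 ^ n)%N.
Proof.
rewrite -[n in 'C(n, m)]card_ord -card_draws.
apply: leq_trans (max_card _) _; rewrite -cardsT -powersetT card_powerset cardsT card_ord //.
Qed.

Lemma ffact_le n m : (n ^_ m <= n ^ m)%N.
Proof.
elim: m => [|m IH]; first by rewrite ffactn0.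
by rewrite ffactnSr expnSr leq_mul // leq_subr.
Qed.

Lemma ffact_ge n m k : (k + m <= n.+1)%N -> (k ^ m <= n ^_ m)%N.
Proof.
elim: m => [|m IH] h; first by rewrite ffactn0.
by rewrite ffactnSr expnSr leq_mul ?IH //; lia.
Qed.

Lemma pow_le_fact k : (k ^ k <= 4 ^ k * k`!)%N.
Proof.
apply: (@leq_trans ('C(k + k, k) * k`!)); last first.
  by rewrite leq_mul2r (leq_trans (bin_le_pow2 _ _)) ?orbT // addnn -mul2n expnM.
by rewrite bin_ffact; apply: ffact_ge; lia.
Qed.

(** The base collects 16^k from the two binomials, 4^k against the factor 2, and 4^(d k) for p^d.
    The exponent passes from k to k - d, as k <= (d + 1) (k - d). *)
Definition netL (d : nat) : nat := (64 * 4 ^ d) ^ d.+1.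

(* C(p, k) is at most (8 p / q)^k, C(k, d) at most 2^k, and p^d at most 4^(d k). *)
Lemma ybig_ok d p q y k : k = (q - q %/ (2 * d.+1))%N -> (d < q)%N -> (q <= p)%N ->
  (p <= 2 ^ q)%N -> (netL d * p <= y * q)%N ->
  (2 * ('C(p, k) * 'C(k, d)) < y ^ (k - d))%N.
Proof.
move=> kE dq qp p2 hy.
have hc : (q %/ (2 * d.+1) * (2 * d.+1) <= q)%N by apply: leq_trunc_div.
have kq : (k <= q)%N by rewrite kE; apply: leq_subr.
have k2 : (q <= 2 * k)%N by rewrite kE; move: hc; move: (q %/ _)%N => c; nia.
have dk : (d < k)%N by rewrite kE; move: hc; move: (q %/ _)%N => c; nia.
have kd : (k <= d.+1 * (k - d))%N.
  have := subnKC (ltnW dk); have : (0 < k - d)%N by rewrite subn_gt0.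
  by move: (k - d)%N => e e0 <-; nia.
have q0 : (0 < q)%N by apply: leq_trans dq.
have p0 : (0 < p)%N by apply: leq_trans qp.
have b1 : ('C(p, k) * q ^ k <= 8 ^ k * p ^ k)%N.
  apply: (@leq_trans ('C(p, k) * (2 ^ k * (4 ^ k * k`!)))).
    rewrite leq_mul2l; apply/orP; right; apply: leq_trans (expn_mono k k2) _.
    by rewrite expnMn leq_mul2l pow_le_fact orbT.
  have -> : ('C(p, k) * (2 ^ k * (4 ^ k * k`!)) = (2 * 4) ^ k * ('C(p, k) * k`!))%N.
    by rewrite expnMn; ring.
  rewrite leq_mul2l; apply/orP; right.
  by rewrite bin_ffact ffact_le.
have b2 : ('C(k, d) <= 2 ^ k)%N by apply: bin_le_pow2.
have qk0 : (0 < q ^ k)%N by rewrite expn_gt0 q0.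
rewrite -(ltn_pmul2r qk0).
have kk : k = ((k - d) + d)%N by rewrite subnK // ltnW.
have pd : (p ^ d <= 4 ^ (d * k))%N.
  apply: leq_trans (expn_mono d p2) _; rewrite -expnM (_ : 4 = 2 ^ 2)%N // -expnM.
  by rewrite leq_exp2l //; nia.
have key : (2 * (16 ^ k * p ^ d) < netL d ^ (k - d))%N.
  apply: (@leq_trans ((64 * 4 ^ d) ^ k)); last first.
    by rewrite /netL -expnM leq_exp2l // (leq_trans _ (leq_pmulr _ _)) // expn_gt0.
  rewrite expnMn -expnM (_ : 64 = 4 * 16)%N // expnMn.
  apply: (@leq_trans (3 * (16 ^ k * 4 ^ (d * k)))).
    apply: (@leq_ltn_trans (2 * (16 ^ k * 4 ^ (d * k)))).
      by rewrite leq_mul2l leq_mul2l pd !orbT.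
    by rewrite ltn_pmul2r // muln_gt0 !expn_gt0.
  rewrite -mulnA leq_mul2r; apply/orP; right.
  by apply: (@leq_trans (4 ^ 1)) => //; rewrite leq_exp2l //; apply: leq_trans dk.
apply: (@leq_ltn_trans (2 * (16 ^ k * p ^ d) * p ^ (k - d))).
  have -> : (2 * ('C(p, k) * 'C(k, d)) * q ^ k = 2 * ('C(k, d) * ('C(p, k) * q ^ k)))%N by ring.
  rewrite -mulnA leq_mul2l /=; apply: leq_trans (leq_mul b2 b1) _.
  by rewrite mulnA -expnMn -mulnA -expnD addnC -kk.
apply: (@leq_trans (netL d ^ (k - d) * p ^ (k - d))).
  by rewrite ltn_pmul2r // expn_gt0 p0.
rewrite -expnMn; apply: leq_trans (expn_mono (k - d) hy) _.
by rewrite expnMn leq_mul2l leq_pexp2l ?leq_subr ?orbT.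
Qed.

End ConvexGeometry.

Module HadwigerDebrunner.

From Stdlib Require Import Lra List.
From mathcomp Require Import boolp classical_sets filter reals Rstruct.
From mathcomp Require Import all_boot all_order all_algebra zify.
Import Defs ConvexGeometry.

Set Implicit Arguments.
Unset Strict Implicit.
Unset Printing Implicit Defensive.

Import Order.TTheory GRing.Theory Num.Theory.
Local Close Scope ring_scope.
Local Open Scope R_scope.

(** * Solving the recursion *)

Lemma INR_expn a k : INR (a ^ k)%N = INR a ^ k.
Proof. by elim: k => [//|k IH]; rewrite expnS -multE mult_INR IH. Qed.

Lemma INR_muln a b : INR (a * b)%N = INR a * INR b.
Proof. by rewrite -multE mult_INR. Qed.

Lemma INR_addn a b : INR (a + b)%N = INR a + INR b.
Proof. by rewrite -plusE plus_INR. Qed.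

Lemma INR_leq a b : (a <= b)%N -> INR a <= INR b.
Proof. by move=> /ssrnat.leP; apply: le_INR. Qed.

Lemma INR_ltn a b : (a < b)%N -> INR a < INR b.
Proof. by move=> /ssrnat.ltP; apply: lt_INR. Qed.

Lemma ln_le' x y : 0 < x -> x <= y -> ln x <= ln y.
Proof. by move=> x0 [lt|->]; [left; apply: ln_increasing|right]. Qed.

Lemma ln_ge0 x : 1 <= x -> 0 <= ln x.
Proof. by move=> x1; rewrite -ln_1; apply: ln_le'; lra. Qed.

Lemma ln_pow' x k : 0 < x -> ln (x ^ k) = INR k * ln x.
Proof.
move=> x0; elim: k => [|k IH]; first by rewrite /= ln_1 Rmult_0_l.
by rewrite S_INR -tech_pow_Rmult ln_mult // ?IH; [ring|apply: pow_lt].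
Qed.

Lemma exp_le' x y : x <= y -> exp x <= exp y.
Proof. by move=> [lt|->]; [left; apply: exp_increasing|right]. Qed.

Lemma Rpower_ge1 x e : 1 <= x -> 0 <= e -> 1 <= Rpower x e.
Proof.
move=> x1 e0; rewrite /Rpower -{1}exp_0; apply: exp_le'; apply: Rmult_le_pos => //.
by apply: ln_ge0; lra.
Qed.

(** From y < (2 r)^D follows y' <= 4 C y^(1 - 1/D); half of the gain in the logarithm pays for 4
    C. *)
Lemma contraction (D C y r y' : nat) : (0 < D)%N -> (0 < C)%N -> (0 < r)%N -> (0 < y')%N ->
  (r * y' <= 2 * C * y)%N -> (y < r.+1 ^ D)%N -> (0 < y)%N ->
  1 <= ln (INR y) -> 2 * INR D * ln (4 * INR C) <= ln (INR y) ->
  ln (INR y') <= ln (INR y) * (1 - / (2 * INR D)).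
Proof.
move=> D0 C0 r0 y'0 h1 h2 y0 h3 h4.
have D0' : 1 <= INR D by apply: (INR_leq D0).
have C0' : 1 <= INR C by apply: (INR_leq C0).
have r0' : 1 <= INR r by apply: (INR_leq r0).
have y0' : 1 <= INR y by apply: (INR_leq y0).
have y'0' : 1 <= INR y' by apply: (INR_leq y'0).
have e1 : INR r * INR y' <= 2 * INR C * INR y.
  by have := INR_leq h1; rewrite !INR_muln /=; lra.
have e2 : ln (INR r) + ln (INR y') <= ln (2 * INR C) + ln (INR y).
  rewrite -!ln_mult; try lra; apply: ln_le'; last by lra.
  by apply: Rmult_lt_0_compat; lra.
have e3 : ln (INR y) <= INR D * (ln (INR r) + ln 2).
  rewrite -ln_mult; try lra; rewrite -ln_pow'; last by lra.
  apply: ln_le'; first by lra.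
  have := INR_ltn h2; rewrite INR_expn S_INR => h; left; apply: Rlt_le_trans h _.
  by apply: pow_incr; lra.
have e4 : ln (4 * INR C) = ln 2 + ln (2 * INR C).
  by rewrite -ln_mult; try lra; congr ln; lra.
rewrite e4 in h4.
have iD : 0 < / (2 * INR D) by apply: Rinv_0_lt_compat; lra.
have iE : / (2 * INR D) * (2 * INR D) = 1 by field; lra.
apply: (Rmult_le_reg_r (2 * INR D)); first by lra.
have -> : ln (INR y) * (1 - / (2 * INR D)) * (2 * INR D) = ln (INR y) * (2 * INR D) - ln (INR y).
  by field; lra.
have : INR D * (ln (INR r) + ln (INR y')) <= INR D * (ln (2 * INR C) + ln (INR y)).
  by apply: Rmult_le_compat_l; lra.
lra.
Qed.

Section Asymptotics.
Variables (P : nat -> nat -> Prop) (d D C c1 y0 : nat) (E : R).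
Hypothesis P_ex : forall y, exists N, P y N.
Hypothesis P_mono : forall y y' N, (y <= y')%N -> P y' N -> P y N.
Hypothesis P_rec : forall y, (y0 <= y)%N -> exists r, [/\ (0 < r)%N, (r ^ D <= y)%N,
    (y < r.+1 ^ D)%N & forall N', P ((C * y) %/ r + 1)%N N' -> P y (c1 * y ^ d + r ^ d * N')%N].
Hypotheses (D0 : (0 < D)%N) (C0 : (0 < C)%N) (E0 : 0 <= E).
Hypothesis E_large : (2 * INR C) ^ d * exp (- (E / (4 * INR D))) <= / 2.

(** Since 1 + ln y' <= (1 - 1/(4 D)) (1 + ln y), the power [E] gains exp (- E / (4 D)), which by
    [E_large] turns the loss (2 C)^d into 1/2; the other half of [A] absorbs c1 y^d. *)
Lemma asymptotics : exists A, 0 < A /\ forall y, (0 < y)%N -> exists N, P y N /\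
  INR N <= A * INR y ^ d * Rpower (1 + ln (INR y)) E.
Proof.
have D0' : 1 <= INR D by apply: (INR_leq D0).
have C0' : 1 <= INR C by apply: (INR_leq C0).
have [y1 hy1] := INR_unbounded (exp (Rmax 1 (2 * INR D * ln (4 * INR C)))).
pose y2 := (y0 + y1)%N; have [N2 hN2] := P_ex y2.
pose A := 1 + INR N2 + 2 * INR c1.
have N20 := pos_INR N2; have c10 := pos_INR c1.
exists A; split; first by rewrite /A; lra.
elim/ltn_ind => y IH yp.
have yp' : 1 <= INR y by apply: (INR_leq yp).
have lny0 : 0 <= ln (INR y) by apply: ln_ge0; lra.
have L1 : 1 <= Rpower (1 + ln (INR y)) E by apply: Rpower_ge1; lra.
have yd1 : 1 <= INR y ^ d by apply: pow_R1_Rle.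
have [le|gt] := leqP y y2.
  exists N2; split; first exact: P_mono le hN2.
  have : 1 <= INR y ^ d * Rpower (1 + ln (INR y)) E by nra.
  have : INR N2 <= A by rewrite /A; lra.
  rewrite Rmult_assoc => le1 le2; apply: Rle_trans le1 _.
  by rewrite -{1}(Rmult_1_r A); apply: Rmult_le_compat_l; [rewrite /A; lra|exact: le2].
have [r [r0 rD1 rD2 hr]] := P_rec (ltnW (leq_ltn_trans (leq_addr y1 y0) gt)).
pose y' := ((C * y) %/ r + 1)%N.
have y'0 : (0 < y')%N by rewrite /y' addn1.
have ry : (r <= y)%N by apply: leq_trans rD1; rewrite -{1}(expn1 r) leq_pexp2l.
have ryC : (r <= C * y)%N by apply: leq_trans ry _; rewrite leq_pmull.
have rym : (r * y' <= 2 * C * y)%N.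
  rewrite /y' mulnDr muln1 -mulnA mul2n -addnn leq_add // mulnC; exact: leq_trunc_div.
have big : Rmax 1 (2 * INR D * ln (4 * INR C)) <= ln (INR y).
  rewrite -[X in X <= _]ln_exp; apply: ln_le'; first exact: exp_pos.
  by apply: Rlt_le; apply: Rlt_le_trans hy1 _; apply: INR_leq; apply: leq_trans (leq_addl y0 y1) (ltnW gt).
have b1 := Rle_trans _ _ _ (Rmax_l _ _) big; have b2 := Rle_trans _ _ _ (Rmax_r _ _) big.
have con := contraction D0 C0 r0 y'0 rym rD2 yp b1 b2.
have iD : 0 < / (2 * INR D) by apply: Rinv_0_lt_compat; lra.
have y'1 : 1 <= INR y' by apply: (INR_leq y'0).
have lny'0 : 0 <= ln (INR y') by apply: ln_ge0; lra.
have y'y : (y' < y)%N.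
  rewrite ltnNge; apply/negP => /INR_leq h.
  have : ln (INR y) <= ln (INR y') by apply: ln_le'; lra.
  nra.
have [N' [PN' hN']] := IH y' y'y y'0.
exists (c1 * y ^ d + r ^ d * N')%N; split; first exact: hr.
rewrite INR_addn !INR_muln !INR_expn.
set L := Rpower (1 + ln (INR y)) E in L1 *; set L' := Rpower (1 + ln (INR y')) E in hN'.
have LL : L' <= exp (- (E / (4 * INR D))) * L.
  rewrite /L /L' /Rpower -exp_plus; apply: exp_le'.
  have -> : - (E / (4 * INR D)) + E * ln (1 + ln (INR y)) = E * (- / (4 * INR D) + ln (1 + ln (INR y))).
    by field; lra.
  apply: Rmult_le_compat_l => //.
  rewrite -{1}(ln_exp (- / (4 * INR D))) -ln_mult; [|exact: exp_pos|lra].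
  apply: ln_le'; first by lra.
  have h4 : / (2 * INR D) = 2 * / (4 * INR D) by field; lra.
  have i4 : 0 < / (4 * INR D) by apply: Rinv_0_lt_compat; lra.
  have := exp_ineq1_le (- / (4 * INR D)) => ex.
  apply: (@Rle_trans _ ((1 + - / (4 * INR D)) * (1 + ln (INR y)))).
    by rewrite h4 in con; nra.
  by apply: Rmult_le_compat_r; lra.
have L'0 : 0 < L' by apply: exp_pos.
have rd0 : 0 <= INR r ^ d by apply: pow_le; apply: pos_INR.
have y'd0 : 0 <= INR y' ^ d by apply: pow_le; apply: pos_INR.
have A0 : 0 < A by rewrite /A; lra.
have s1 : INR r ^ d * INR N' <= INR r ^ d * (A * INR y' ^ d * L') by apply: Rmult_le_compat_l.
have s2 : INR r ^ d * INR y' ^ d <= (2 * INR C) ^ d * INR y ^ d.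
  rewrite -!Rpow_mult_distr; apply: pow_incr; split.
    by apply: Rmult_le_pos; apply: pos_INR.
  by have := INR_leq rym; rewrite !INR_muln /=; lra.
have s3 : INR r ^ d * (A * INR y' ^ d * L') <= A * ((2 * INR C) ^ d * INR y ^ d * L').
  have -> : INR r ^ d * (A * INR y' ^ d * L') = A * (INR r ^ d * INR y' ^ d * L') by ring.
  by apply: Rmult_le_compat_l; [lra|apply: Rmult_le_compat_r; lra].
have s4 : (2 * INR C) ^ d * INR y ^ d * L' <= INR y ^ d * (/ 2 * L).
  have q : 0 <= (2 * INR C) ^ d by apply: pow_le; lra.
  apply: (@Rle_trans _ (INR y ^ d * ((2 * INR C) ^ d * exp (- (E / (4 * INR D))) * L))).
    have -> : (2 * INR C) ^ d * INR y ^ d * L' = INR y ^ d * ((2 * INR C) ^ d * L') by ring.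
    apply: Rmult_le_compat_l; first by lra.
    by rewrite Rmult_assoc; apply: Rmult_le_compat_l.
  apply: Rmult_le_compat_l; first by lra.
  by apply: Rmult_le_compat_r; lra.
have s5 : A * ((2 * INR C) ^ d * INR y ^ d * L') <= A * (INR y ^ d * (/ 2 * L)).
  by apply: Rmult_le_compat_l; lra.
have s6 : INR c1 * INR y ^ d <= / 2 * A * INR y ^ d.
  by apply: Rmult_le_compat_r; [lra|rewrite /A; lra].
have s7 : / 2 * A * INR y ^ d <= / 2 * A * INR y ^ d * L.
  rewrite -{1}(Rmult_1_r (/ 2 * A * INR y ^ d)); apply: Rmult_le_compat_l => //.
  by apply: Rmult_le_pos; lra.
have -> : A * INR y ^ d * L = / 2 * A * INR y ^ d * L + A * (INR y ^ d * (/ 2 * L)) by field.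
lra.
Qed.

End Asymptotics.

(** * Compactness and coordinates *)

Section Compactness.
Variable d : nat.
Implicit Types (K V : pset d) (x y z : Defs.point d).

(** [K] is covered by the complements of the closed sup-norm balls of radius 1 / (n + 1) around
    [y]. *)
Lemma compact_compl K y : compact_set K -> ~ K y ->
  exists eps, 0 < eps /\ forall z, (forall i, Rabs (z i - y i) < eps) -> ~ K z.
Proof.
move=> cK nKy; pose W n z := exists i, / INR n.+1 < Rabs (z i - y i).
have oW n : Defs.open_set (W n).
  move=> z [i hi]; exists (Rabs (z i - y i) - / INR n.+1); split; first by lra.
  move=> w hw; exists i; have := hw i; have := Rabs_triang_inv (z i - y i) (z i - w i).
  have -> : z i - y i - (z i - w i) = w i - y i by ring.
  by rewrite (Rabs_minus_sym (z i) (w i)); lra.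
have [z Kz|l hl] := cK nat W oW.
  have [i zi] : exists i, z i <> y i.
    by apply: contrapT => h; apply: nKy; suff <- : z = y by [];
       apply/funext => i; apply: contrapT => hi; apply: h; exists i.
  have p : 0 < Rabs (z i - y i) by apply: Rabs_pos_lt; lra.
  have [n [hn n0]] := archimed_cor1 _ p; exists n, i.
  apply: Rlt_trans hn; apply: Rinv_lt_contravar; last by rewrite S_INR; lra.
  by apply: Rmult_lt_0_compat; apply: lt_0_INR => //; lia.
pose N := fold_right Nat.max 0%nat l.
have leN n : In n l -> (n <= N)%coq_nat.
  rewrite /N; elim: l {hl N} => //= a l IH [->|/IH]; first exact: Nat.le_max_l.
  by move=> h; apply: Nat.le_trans h _; apply: Nat.le_max_r.
have N1 : 0 < INR N.+1 by apply: lt_0_INR; lia.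
exists (/ INR N.+1); split; first exact: Rinv_0_lt_compat.
move=> z hz /hl[n [/leN nl [i hi]]].
have : / INR N.+1 <= / INR n.+1.
  by apply: Rinv_le_contravar; [apply: lt_0_INR; lia|apply: le_INR; lia].
have := hz i; lra.
Qed.

Lemma open_compl K : compact_set K -> Defs.open_set (fun z => ~ K z).
Proof. by move=> cK y nKy; apply: compact_compl. Qed.

Variables (F : Defs.family d) (B : nat).
Hypothesis cF : forall K, F K -> compact_set K.
Hypothesis fin : forall l, (forall K, In K l -> F K) ->
  exists T, (length T <= B)%coq_nat /\ forall K, In K l -> exists x, In x T /\ K x.

(* Ultralimit, along an ultrafilter on the finite subfamilies, of their transversals. *)
Lemma compact_transversal : exists T, (length T <= B)%coq_nat /\ transversal T F.
Proof.
pose good (l : list (pset d)) := forall K, In K l -> F K.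
have fin' l : exists T, good l -> (length T <= B)%coq_nat /\
    forall K, In K l -> exists x, In x T /\ K x.
  by case: (pselect (good l)) => [/fin[T hT]|n]; [exists T|exists nil].
have [tl tlP] := choice fin'.
pose x0 : Defs.point d := fun _ => 0.
pose t l j := List.nth j (tl l) x0.
pose FF : set_system (list (pset d)) := fun A => exists l0, good l0 /\
  forall l, good l -> incl l0 l -> A l.
have pF : ProperFilter FF.
  split; first by case=> l0 [g0 h]; exact: (h l0 g0 (incl_refl _)).
  split.
  - by exists nil; split.
  - move=> P Q [l1 [g1 h1]] [l2 [g2 h2]]; exists (l1 ++ l2)%list; split.
      by move=> K hK; case: (in_app_or _ _ _ hK) => h; [exact: (g1 K h)|exact: (g2 K h)].
    move=> l gl hl; split; [apply: h1 => //|apply: h2 => //] => K hK; apply: hl;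
      apply: in_or_app; [left|right]; exact: hK.
  - by move=> P Q PQ [l0 [g0 h0]]; exists l0; split=> // l gl hl; apply/PQ/h0.
have [U [uU FU]] := ultraFilterLemma pF.
have pU : ProperFilter U by apply: ultra_proper.
have UC (P : set (list (pset d))) : ~ U P -> U (fun l => ~ P l).
  by move=> nP; case: (in_ultra_setVsetC P uU).
have UN (P : set (list (pset d))) : U P -> U (fun l => ~ P l) -> False.
  by move=> h1 h2; have [l [p /(_ p)]] := filter_ex (filterI h1 h2).
have Uin K : F K -> U (fun l => good l /\ In K l).
  move=> FK; apply: FU; exists (K :: nil)%list; split.
    by move=> K' [<-|//].
  by move=> l gl hl; split=> //; apply: hl; left.
have claim1 K : F K -> exists j, (j < B)%coq_nat /\ U (fun l => K (t l j)).
  move=> FK; apply: contrapT => no.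
  have all n : (n <= B)%coq_nat -> U (fun l => forall j, (j < n)%coq_nat -> ~ K (t l j)).
    elim: n => [|n IH] hn; first by apply: filterS (Uin K FK) => l _ j; lia.
    have h1 := IH ltac:(lia).
    have h2 : U (fun l => ~ K (t l n)) by apply: UC => h; apply: no; exists n.
    apply: filterS (filterI h1 h2) => l [a1 a2] j hj.
    by case: (PeanoNat.Nat.eq_dec j n) => [->//|jn]; apply: a1; lia.
  have [l [[gl Kl] hl]] := filter_ex (filterI (Uin K FK) (all B (Nat.le_refl _))).
  have [len /(_ K Kl)[x [xT Kx]]] := tlP l gl.
  have [j [hj jx]] := In_nth _ _ x0 xT; apply: (hl j); first by lia.
  by rewrite /t jx.
(* Otherwise open sets that the [j]-th points almost never enter would cover [K]; by compactness
   finitely many of them do, though the [j]-th points almost always lie in [K]. *)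
have claim2 K j : F K -> U (fun l => K (t l j)) ->
    exists x, K x /\ forall V, Defs.open_set V -> V x -> U (fun l => V (t l j)).
  move=> FK UK; apply: contrapT => no.
  pose J := {V : pset d | Defs.open_set V /\ ~ U (fun l => V (t l j))}.
  have [||li hli] := cF FK (I := J) (U := fun i => proj1_sig i).
  - by case=> V [oV ?].
  - move=> x Kx; apply: contrapT => h; apply: no; exists x; split=> // V oV Vx.
    apply: contrapT => nV; apply: h; exists (exist _ V (conj oV nV)); exact: Vx.
  have all : U (fun l => forall i : J, In i li -> ~ proj1_sig i (t l j)).
    elim: li {hli} => [|i li IH]; first by apply: filterS UK => l _ i [].
    have h2 : U (fun l => ~ proj1_sig i (t l j)) by case: i => V [oV nV]; apply: UC.
    by apply: filterS (filterI IH h2) => l [a1 a2] i' [<-|/a1].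
  have [l [Kl hl]] := filter_ex (filterI UK all).
  by have [i [il Vi]] := hli _ Kl; apply: (hl i il).
(* One limit serves all sets: if it were outside [K], the open complement of [K] would contain
   almost all [j]-th points. *)
have claim3 j : exists x, forall K, F K -> U (fun l => K (t l j)) -> K x.
  case: (pselect (exists K, F K /\ U (fun l => K (t l j)))) => [[K0 [FK0 UK0]]|no]; last first.
    by exists x0 => K FK UK; case: no; exists K.
  have [x [_ hx]] := claim2 K0 j FK0 UK0; exists x => K FK UK; apply: contrapT => nK.
  exact: UN UK (hx _ (open_compl (cF FK)) nK).
have [xj hxj] := choice claim3.
exists (List.map xj (List.seq 0 B)); split; first by rewrite length_map length_seq.
move=> K FK; have [j [jB UK]] := claim1 K FK; exists (xj j); split.
  by apply: in_map; apply/in_seq; lia.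
exact: hxj UK.
Qed.

End Compactness.

(** * Points as functions and as row vectors *)

Section Bridge.
Variable d : nat.

Definition f2o (i : Fin.t d) : 'I_d := Ordinal (introT ssrnat.ltP (proj2_sig (Fin.to_nat i))).
Definition o2f (i : 'I_d) : Fin.t d := Fin.of_nat_lt (elimT ssrnat.ltP (ltn_ord i)).

Lemma f2oK i : o2f (f2o i) = i.
Proof.
rewrite -[RHS]Fin.of_nat_to_nat_inv /o2f; exact: Fin.of_nat_ext.
Qed.

Definition toP (v : 'rV[R]_d) : Defs.point d := fun i => v ord0 (f2o i).
Definition toV (x : Defs.point d) : 'rV[R]_d := (\row_i x (o2f i))%R.

Lemma toVK x : toP (toV x) = x.
Proof. by apply/funext => i; rewrite /toP mxE f2oK. Qed.

Definition lift_set (K : pset d) (v : 'rV[R]_d) : Prop := K (toP v).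

Lemma lift_convex K : convex_set K -> convex (lift_set K).
Proof.
move=> cK x y t Kx Ky /RleP t0 /RleP t1; rewrite /lift_set.
suff -> : toP (t *: x + (1 - t) *: y)%R = (fun i => t * toP x i + (1 - t) * toP y i) by apply: cK.
by apply/funext => i; rewrite /toP !mxE.
Qed.

Lemma lift_closed K : compact_set K -> closed (lift_set K).
Proof.
move=> cK v hv; apply: contrapT => nK; have [eps [e0 he]] := compact_compl cK nK.
have e2 : (0 < eps * eps :> R)%R by apply/RltP; apply: Rmult_lt_0_compat.
have [w Kw hw] := hv _ e2; apply: (he (toP w)) => // i.
have := le_lt_trans (nrm_coord (w - v)%R (f2o i)) hw.
rewrite !mxE expr2 => /RltP; rewrite -/(toP w i) -/(toP v i) => h.
have h' : Rsqr (toP w i - toP v i) < Rsqr eps by [].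
by have := Rsqr_lt_abs_0 _ _ h'; rewrite (Rabs_pos_eq eps); lra.
Qed.

End Bridge.

(** * The bounds *)

Lemma In_mem (I : eqType) (s : seq I) x : List.In x s <-> x \in s.
Proof.
elim: s => //= a s IH; rewrite inE; split=> [[->|/IH ->]|/orP[/eqP ->|/IH]].
- by rewrite eqxx.
- by rewrite orbT.
- by left.
- by right.
Qed.

Lemma NoDup_map_uniq (I : eqType) (T : Type) (G : I -> T) (s : seq I) :
  injective G -> uniq s -> NoDup (List.map G s).
Proof.
move=> iG; elim: s => [|a s IH] /=; first by constructor.
move=> /andP[nas us]; constructor; last exact: IH.
by case/in_map_iff => b [/iG -> /In_mem bs]; move/negP: nas.
Qed.

(** * Reduction to weak nets *)

Section Reduction.
Variables (d p q y N : nat).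
Hypotheses (dq : (d < q)%N) (qp : (q <= p)%N) (p2 : (p <= 2 ^ q)%N).
Hypotheses (hy : (netL d * p <= y * q)%N) (y0 : (0 < y)%N).
Hypothesis net : wnet R d (2 * y) N.

Definition HDbound : nat := (4 * d.+1 * p ^ 2 + q ^ 2 * (1 + (p - q) + N)) %/ q ^ 2.

Lemma finite_family (l : list (pset d)) : NoDup l -> (p <= length l)%coq_nat ->
  (forall K, List.In K l -> [/\ compact_set K, convex_set K & exists x, K x]) ->
  (forall l1, length l1 = p -> NoDup l1 -> incl l1 l -> exists l', length l' = q /\ NoDup l' /\ incl l' l1 /\
     exists x : Defs.point d, forall K, List.In K l' -> K x) ->
  exists T, (length T <= HDbound)%coq_nat /\ forall K, List.In K l -> exists x, List.In x T /\ K x.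
Proof.
move=> ul pl hl hpq; pose I := 'I_(length l); pose G (i : I) := List.nth i l (fun _ => True).
have Gl i : List.In (G i) l by apply: nth_In; apply/ssrnat.ltP.
have iG : injective G.
  move=> i j e; apply/val_inj.
  by apply: (proj1 (NoDup_nth l (fun _ => True)) ul) e; apply/ssrnat.ltP; apply: ltn_ord.
pose Fs i := lift_set (G i).
have cF i : convex (Fs i) by apply: lift_convex; case: (hl _ (Gl i)).
have clF i : closed (Fs i) by apply: lift_closed; case: (hl _ (Gl i)).
have neF i : exists v, Fs i v.
  by have [_ _ [x Kx]] := hl _ (Gl i); exists (toV x); rewrite /Fs /lift_set toVK.
have len s : length (List.map G s) = size s by rewrite length_map.
have pqF (A : {set I}) : #|A| = p -> exists B : {set I},
    [/\ B \subset A, #|B| = q & exists z, forall i, i \in B -> Fs i z].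
  move=> cA; have [||| l' [ql [ul' [l'A [x hx]]]]] := hpq (List.map G (enum A)).
  - by rewrite len -cardE.
  - exact: NoDup_map_uniq (enum_uniq _).
  - by move=> K /in_map_iff[i [<- _]].
  pose B := [set i in A | `[< List.In (G i) l' >]].
  exists B; split.
  - by apply/subsetP => i; rewrite inE => /andP[].
  - rewrite -ql cardE -len; apply: Nat.le_antisymm; apply: NoDup_incl_length => //.
    + exact: NoDup_map_uniq (enum_uniq _).
    + by move=> K /in_map_iff[i [<- /In_mem]]; rewrite mem_enum inE => /andP[_ /asboolP].
    + move=> K Kl'; have /in_map_iff[i [e /In_mem iA]] := l'A _ Kl'.
      apply/in_map_iff; exists i; split=> //; apply/In_mem.
      by move: iA; rewrite !mem_enum inE => ->; apply/asboolP; rewrite e.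
  - exists (toV x) => i; rewrite inE => /andP[_ /asboolP hi].
    by rewrite /Fs /lift_set toVK; apply: hx.
have pI : (p <= #|I|)%N by rewrite card_ord; apply/ssrnat.leP.
have q0 : (0 < q)%N by apply: leq_ltn_trans dq.
have [L [sL hL]] := finite_transversal pqF pI qp q0 neF cF clF dq y0
  (ybig_ok (erefl _) dq qp p2 hy) net.
exists (List.map (@toP d) L); split.
  rewrite length_map; apply/ssrnat.leP; rewrite /HDbound leq_divRL ?expn_gt0 ?q0 //.
  by rewrite mulnC.
move=> K Kl; have [n [hn e]] := In_nth _ _ (fun _ => True) Kl.
have [z zL Kz] := hL (Ordinal (introT ssrnat.ltP hn)).
exists (toP z); split; first by apply: in_map; apply/In_mem.
by rewrite -e.
Qed.

Lemma nodup_list (T : Type) (l0 l : list T) : NoDup l0 -> exists l', [/\ NoDup l', incl l0 l' &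
  forall x, List.In x l' <-> List.In x l0 \/ List.In x l].
Proof.
move=> u0; elim: l => [|a l [l' [ul' il' hl']]].
  by exists l0; split=> // x; rewrite /=; tauto.
case: (pselect (List.In a l')) => [al|nal].
  exists l'; split=> // x /=; rewrite hl'; split; first tauto.
  by case; [tauto|case=> [<-|]; [exact/hl'|tauto]].
exists (a :: l')%list; split; first by constructor.
  by move=> x /il' h; right.
by move=> x /=; rewrite hl'; tauto.
Qed.

Lemma HD_of_net : HD_le d p q (INR HDbound).
Proof.
move=> F hF [[l0 [len0 [u0 F0]]] [neF hpq]].
have [||T [lT tT]] := @compact_transversal d F HDbound.
- by move=> K /hF[].
(* The [p] members supplied by the (p, q)-property are adjoined, so that the finite subfamily has at
   least [p] members. *)
- move=> l Fl; have [l' [ul' il' hl']] := nodup_list l u0.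
  have Fl' K : List.In K l' -> F K by move/hl' => [/F0|/Fl].
  have [|||T [lT hT]] := @finite_family l' ul'.
  + by rewrite -len0; apply: NoDup_incl_length.
  + by move=> K /Fl' FK; have [h1 h2] := hF K FK; split=> //; apply: neF.
  + by move=> l1 len1 u1 i1; apply: hpq => // K /i1/Fl'.
  by exists T; split=> // K Kl; apply: hT; apply/hl'; right.
by exists T; split=> //; apply: le_INR.
Qed.

End Reduction.

Lemma HDbound_le d p q N : (0 < q)%N -> (q <= p)%N ->
  INR (HDbound d p q N) <= INR p - INR q + (1 + 4 * INR d.+1 * (INR p / INR q) ^ 2) + INR N.
Proof.
move=> q0 qp; have qR : 0 < INR q by apply: lt_0_INR; apply/ssrnat.ltP.
have h : (HDbound d p q N * q ^ 2 <= 4 * d.+1 * p ^ 2 + q ^ 2 * (1 + (p - q) + N))%N by apply: leq_trunc_div.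
have := INR_leq h; rewrite INR_muln INR_addn !(INR_expn, INR_muln) !INR_addn.
have -> : INR (p - q)%N = INR p - INR q by rewrite -minusE minus_INR //; apply/ssrnat.leP.
have -> : INR 4 = 4 by rewrite /=; lra.
have -> : INR 1 = 1 by [].
move=> h'; have q2 : 0 < INR q ^ 2 by apply: pow_lt.
apply: (Rmult_le_reg_r (INR q ^ 2)) => //; apply: Rle_trans h' _; right; field; lra.
Qed.

Lemma ln2_bounds : / 2 < ln 2 <= 1.
Proof.
split; first exact: ln_lt_2.
by rewrite -[X in _ <= X]ln_exp; apply: ln_le'; have := exp_ineq1_le 1; lra.
Qed.

Definition expo (d : nat) : R := 128 * INR d ^ 3 * log2 (INR d).

Lemma expo_ge0 d : (2 <= d)%N -> 0 <= expo d.
Proof.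
move=> d2; have dR := INR_leq d2; rewrite /= in dR.
have [l1 l2] := ln2_bounds.
apply: Rmult_le_pos; first by apply: Rmult_le_pos; [lra|apply: pow_le; lra].
apply: Rmult_le_pos; first by apply: ln_ge0; lra.
by left; apply: Rinv_0_lt_compat; lra.
Qed.

(** Here D = d (d + 1) <= 2 d^2, so E / (4 D) is at least 16 d ln d, while (2 C)^d is at most exp
    (15 d ln d) by [lossC_le]. The remaining d ln d exceeds ln 2; this accounts for 128. *)
Lemma expo_large n : (2 * INR (lossC n.+2)) ^ n.+2 *
  exp (- (expo n.+2 / (4 * INR (n.+2 * n.+3)%N))) <= / 2.
Proof.
have [l1 l2] := ln2_bounds; set x := INR n.+2.
have x2 : 2 <= x by rewrite /x !S_INR; have := pos_INR n; lra.
have lx : ln 2 <= ln x by apply: ln_le'; lra.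
have c15 : 2 * INR (lossC n.+2) <= x ^ 15.
  by have := INR_leq (lossC_le n); rewrite INR_muln INR_expn.
have lx0 : 0 < ln x by lra.
apply: (@Rle_trans _ (exp (15 * x * ln x) * exp (- (16 * x * ln x)))).
  apply: Rmult_le_compat; first by apply: pow_le; have := pos_INR (lossC n.+2); lra.
  - by left; apply: exp_pos.
  - apply: (@Rle_trans _ ((x ^ 15) ^ n.+2)).
      by apply: pow_incr; split=> //; have := pos_INR (lossC n.+2); lra.
    rewrite -[(x ^ 15) ^ n.+2]exp_ln; last by apply: pow_lt; apply: pow_lt; lra.
    rewrite ln_pow'; last by apply: pow_lt; lra.
    rewrite ln_pow'; last by lra.
    by rewrite -/x; apply: exp_le'; right; rewrite /=; ring.
  - apply: exp_le'; apply: Ropp_le_contravar.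
    rewrite INR_muln -/x (_ : INR n.+3 = x + 1); last by rewrite /x S_INR.
    rewrite /expo /log2 -/x.
    have iz : 1 <= / ln 2 by rewrite -{1}Rinv_1; apply: Rinv_le_contravar; lra.
    have -> : 128 * x ^ 3 * (ln x / ln 2) / (4 * (x * (x + 1))) = (32 * x * ln x) * (/ ln 2) * (x / (x + 1)).
      by field; lra.
    have h1 : / 2 <= x / (x + 1).
      apply: (Rmult_le_reg_r (x + 1)); first by lra.
      by rewrite /Rdiv Rmult_assoc Rinv_l; lra.
    have p0 : 0 <= 32 * x * ln x by apply: Rmult_le_pos; lra.
    apply: (@Rle_trans _ (32 * x * ln x * 1 * / 2)); first by lra.
    by apply: Rmult_le_compat; [lra|lra|apply: Rmult_le_compat_l|].
rewrite -exp_plus; have -> : / 2 = exp (- ln 2) by rewrite exp_Ropp exp_ln; lra.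
by apply: exp_le'; nra.
Qed.

Lemma wnet_asymptotic n : exists A, 0 < A /\ forall y, (0 < y)%N -> exists N,
  wnet R n.+2 y N /\ INR N <= A * INR y ^ n.+2 * Rpower (1 + ln (INR y)) (expo n.+2).
Proof.
have [y0 hy0] := wnet_rec R n.
apply: (@asymptotics _ n.+2 (n.+2 * n.+3) (lossC n.+2) ((2 * 3 ^ n.+3) ^ n.+2) y0); try done.
- exact: wnet_base.
- by move=> y y' N; apply: wnet_ley.
- exact: expo_ge0.
- exact: expo_large.
Qed.

Lemma le_pow2_of_log p q : (0 < p)%N -> log2 (INR p) <= INR q -> (p <= 2 ^ q)%N.
Proof.
move=> p0 h; have [l1 l2] := ln2_bounds.
have pR : 0 < INR p by apply: lt_0_INR; apply/ssrnat.ltP.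
have : INR p <= INR (2 ^ q).
  rewrite INR_expn -(exp_ln _ pR) -[X in _ <= X]exp_ln; last by apply: pow_lt; rewrite /=; lra.
  apply: exp_le'; rewrite ln_pow'; last by rewrite /=; lra.
  have -> : INR 2 = 2 by rewrite /=; lra.
  have -> : ln (INR p) = log2 (INR p) * ln 2 by rewrite /log2; field; lra.
  by apply: Rmult_le_compat_r; lra.
by move=> /INR_le /ssrnat.leP.
Qed.

Lemma netL_gt0 d : (0 < netL d)%N.
Proof. by rewrite /netL expn_gt0 muln_gt0 expn_gt0. Qed.

Lemma net_scale d p q : (0 < q)%N -> (q <= p)%N -> exists y,
  [/\ (0 < y)%N, (netL d * p <= y * q)%N & INR (2 * y) <= 4 * INR (netL d) * (INR p / INR q)].
Proof.
move=> q0 qp; exists ((netL d * p) %/ q + 1)%N; rewrite addn1; split=> //.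
  by apply: ltnW; apply: ltn_ceil.
have qR : 0 < INR q by apply: lt_0_INR; apply/ssrnat.ltP.
have L1 := netL_gt0 d.
apply: (Rmult_le_reg_r (INR q)) => //.
have -> : 4 * INR (netL d) * (INR p / INR q) * INR q = INR (4 * (netL d * p)).
  by rewrite !INR_muln (_ : INR 4 = 4); [field; lra|rewrite /=; lra].
rewrite -INR_muln; apply: INR_leq; rewrite -mulnA (_ : 4 = 2 * 2)%N // -mulnA leq_mul2l /= mulSn mul2n -addnn.
by rewrite leq_add ?leq_trunc_div // (leq_trans qp) // leq_pmull.
Qed.

Lemma HD_le_mono d p q s s' : s <= s' -> HD_le d p q s -> HD_le d p q s'.
Proof. by move=> ss h F hF hpq; have [T [tT lT]] := h F hF hpq; exists T; split=> //; lra. Qed.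

Lemma ratio_ge1 p q : (0 < q)%N -> (q <= p)%N -> 1 <= INR p / INR q.
Proof.
move=> q0 qp; have qR : 0 < INR q by apply: lt_0_INR; apply/ssrnat.ltP.
apply: (Rmult_le_reg_r (INR q)) => //; rewrite /Rdiv Rmult_assoc Rinv_l; last by lra.
by rewrite Rmult_1_l Rmult_1_r; apply: INR_leq.
Qed.

Lemma bound_space n : exists C, 0 < C /\ forall p q, (n.+2 < q)%N -> (q <= p)%N ->
  log2 (INR p) <= INR q ->
  HD_le n.+2 p q (INR p - INR q + C * (INR p / INR q) ^ n.+2 * Rpower (Llog p q) (expo n.+2)).
Proof.
have [A [A0 hA]] := wnet_asymptotic n; set d := n.+2 in hA *.
have d2 : (2 <= d)%N by []; clearbody d; clear n.
(* [Bc] is large enough that 1 + ln (2 y) <= Bc L for L = [Llog p q], given 2 y <= 4 La p / q. *)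
pose La := INR (netL d); pose Bc := 2 + ln (4 * La); pose E := expo d.
have La1 : 1 <= La by apply: (@INR_leq 1); apply: netL_gt0.
have lLa : 0 <= ln (4 * La) by apply: ln_ge0; lra.
have Bc1 : 1 <= Bc by rewrite /Bc; lra.
have E0 : 0 <= E by apply: expo_ge0.
have d0 := pos_INR d.+1.
have La0 : 0 < (4 * La) ^ d by apply: pow_lt; lra.
have RB : 1 <= Rpower Bc E by apply: Rpower_ge1.
exists (1 + 4 * INR d.+1 + A * (4 * La) ^ d * Rpower Bc E); split.
  have : 0 < A * (4 * La) ^ d * Rpower Bc E by apply: Rmult_lt_0_compat; [apply: Rmult_lt_0_compat|lra].
  lra.
move=> p q dq qp hlog; have q0 : (0 < q)%N by apply: leq_ltn_trans dq.
have p2 : (p <= 2 ^ q)%N by apply: le_pow2_of_log => //; apply: leq_trans qp.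
have [y [y0 hy hy2]] := net_scale d q0 qp.
have [N [net hN]] := hA (2 * y)%N ltac:(by rewrite muln_gt0).
apply: HD_le_mono (HD_of_net dq qp p2 hy y0 net).
apply: Rle_trans (HDbound_le d N q0 qp) _.
set X := INR p / INR q in hy2 *; have X1 : 1 <= X by apply: ratio_ge1.
set L := Llog p q; have L1 : 1 <= L by apply: Rmax_l.
have RL : 1 <= Rpower L E by apply: Rpower_ge1.
have [l1 l2] := ln2_bounds.
have lX0 : 0 <= ln X by apply: ln_ge0; lra.
have lX : ln X <= L.
  apply: Rle_trans (Rmax_r _ _); rewrite /log2 -/X /Rdiv -{1}(Rmult_1_r (ln X)).
  by apply: Rmult_le_compat_l => //; rewrite -{1}Rinv_1; apply: Rinv_le_contravar; lra.
have yR : 1 <= INR (2 * y) by apply: (@INR_leq 1); rewrite muln_gt0.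
have s1 : INR (2 * y) ^ d <= (4 * La) ^ d * X ^ d.
  by rewrite -Rpow_mult_distr; apply: pow_incr; split; [lra|exact: hy2].
have s2 : 1 + ln (INR (2 * y)) <= Bc * L.
  have : ln (INR (2 * y)) <= ln (4 * La) + ln X.
    by rewrite -ln_mult; try lra; apply: ln_le'; [lra|exact: hy2].
  have : ln (4 * La) * 1 <= ln (4 * La) * L by apply: Rmult_le_compat_l.
  rewrite /Bc; lra.
have ly0 : 0 <= ln (INR (2 * y)) by apply: ln_ge0; lra.
have s3 : Rpower (1 + ln (INR (2 * y))) E <= Rpower Bc E * Rpower L E.
  rewrite Rpower_mult_distr; [|lra|lra]; apply: Rle_Rpower_l => //; split; [lra|exact: s2].
have s4 : INR N <= A * (4 * La) ^ d * Rpower Bc E * (X ^ d * Rpower L E).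
  apply: Rle_trans hN _.
  have -> : A * (4 * La) ^ d * Rpower Bc E * (X ^ d * Rpower L E) =
     A * ((4 * La) ^ d * X ^ d) * (Rpower Bc E * Rpower L E) by ring.
  have y1 : 0 <= INR (2 * y) ^ d by apply: pow_le; lra.
  apply: Rmult_le_compat => //; first by apply: Rmult_le_pos; [lra|exact: y1].
    by left; apply: exp_pos.
  by apply: Rmult_le_compat_l; lra.
have Xd : X ^ 2 <= X ^ d by apply: Rle_pow => //; apply/ssrnat.leP.
have X21 : 1 <= X ^ 2 by apply: pow_R1_Rle.
have s5 : X ^ 2 <= X ^ d * Rpower L E.
  by rewrite -(Rmult_1_r (X ^ 2)); apply: Rmult_le_compat; lra.
have s6 : 1 + 4 * INR d.+1 * X ^ 2 <= (1 + 4 * INR d.+1) * (X ^ d * Rpower L E).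
  have : 4 * INR d.+1 * X ^ 2 <= 4 * INR d.+1 * (X ^ d * Rpower L E) by apply: Rmult_le_compat_l; lra.
  lra.
rewrite -/E; lra.
Qed.

Lemma bound_plane : exists C, 0 < C /\ forall p q, (2 < q)%N -> (q <= p)%N ->
  log2 (INR p) <= INR q ->
  HD_le 2 p q (INR p - INR q + C * (INR p / INR q) ^ 2 * Llog p q ^ 2).
Proof.
have [A hA] := wnet2_bound R; pose La := INR (netL 2).
have A0 := pos_INR A; have La0 : 0 <= La by apply: pos_INR.
have C0 : 0 <= INR A * (4 * La) ^ 2 by apply: Rmult_le_pos => //; apply: pow_le; lra.
(* 13 is the constant 1 + 4 (d + 1) of [HDbound_le] at d = 2; the rest comes from the net. *)
exists (13 + INR A * (4 * La) ^ 2); split; first lra.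
move=> p q dq qp hlog; have q0 : (0 < q)%N by apply: leq_ltn_trans dq.
have p2 : (p <= 2 ^ q)%N by apply: le_pow2_of_log => //; apply: leq_trans qp.
have [y [y0 hy hy2]] := net_scale 2 q0 qp.
have net := hA (2 * y)%N ltac:(by rewrite muln_gt0).
apply: HD_le_mono (HD_of_net dq qp p2 hy y0 net).
apply: Rle_trans (HDbound_le 2 _ q0 qp) _; rewrite INR_muln INR_expn.
set X := INR p / INR q in hy2 *; have X1 : 1 <= X by apply: ratio_ge1.
have L1 : 1 <= Llog p q ^ 2 by apply: pow_R1_Rle; apply: Rmax_l.
have X21 : 1 <= X ^ 2 by apply: pow_R1_Rle.
have s1 : INR (2 * y) ^ 2 <= (4 * La) ^ 2 * X ^ 2.
  by rewrite -Rpow_mult_distr; apply: pow_incr; split; [exact: pos_INR|exact: hy2].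
have s2 : INR A * INR (2 * y) ^ 2 <= INR A * ((4 * La) ^ 2 * X ^ 2) by apply: Rmult_le_compat_l.
have s3 : (13 + INR A * (4 * La) ^ 2) * X ^ 2 <= (13 + INR A * (4 * La) ^ 2) * X ^ 2 * Llog p q ^ 2.
  rewrite -{1}(Rmult_1_r ((13 + INR A * (4 * La) ^ 2) * X ^ 2)).
  by apply: Rmult_le_compat_l => //; apply: Rmult_le_pos; lra.
have -> : INR 3 = 3 by rewrite /=; lra.
lra.
Qed.

Lemma HD_bounds : exists c : R, 0 < c /\
  exists C : nat -> R, (forall d : nat, (2 <= d)%coq_nat -> 0 < C d) /\
  forall d p q : nat,
    (2 <= d)%coq_nat -> (d < q)%coq_nat -> (q <= p)%coq_nat -> log2 (INR p) <= INR q ->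
    ((3 <= d)%coq_nat ->
       HD_le d p q (INR p - INR q + C d * (INR p / INR q) ^ d *
                    Rpower (Llog p q) (c * INR d ^ 3 * log2 (INR d)))) /\
    (d = 2%N ->
       HD_le 2 p q (INR p - INR q + C 2%N * (INR p / INR q) ^ 2 * (Llog p q) ^ 2)).
Proof.
exists 128; split; first by lra.
have [C2 [C20 hC2]] := bound_plane.
have [Cs CsP] := choice bound_space.
exists (fun d : nat => if d == 2%N then C2 else Cs d.-2); split.
  by move=> d _; case: ifP => _ //; case: (CsP d.-2).
move=> d p q /ssrnat.leP d2 /ssrnat.ltP dq /ssrnat.leP qp hlog; split.
  move=> /ssrnat.leP d3; case: d d2 dq d3 => [|[|[|n]]] // _ dq _.
  exact: (CsP n.+1).2.
move=> e; subst d; exact: hC2.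
Qed.

End HadwigerDebrunner.

Theorem theorem1p3 :
  exists c : R, 0 < c /\
  exists C : nat -> R, (forall d : nat, (2 <= d)%nat -> 0 < C d) /\
  forall d p q : nat,
    (2 <= d)%nat -> (d < q)%nat -> (q <= p)%nat -> log2 (INR p) <= INR q ->
    ((3 <= d)%nat ->
       HD_le d p q (INR p - INR q + C d * (INR p / INR q) ^ d *
                    Rpower (Llog p q) (c * INR d ^ 3 * log2 (INR d)))) /\
    (d = 2%nat ->
       HD_le 2 p q (INR p - INR q + C 2%nat * (INR p / INR q) ^ 2 * (Llog p q) ^ 2)).
Proof. exact HadwigerDebrunner.HD_bounds. Qed.
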